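(* Suppose that $K\in\mathbb{L}_1(\mathbb{R})$ and that there are constants $\beta>0$, $\overline{\kappa}>0$ with $|\widehat K(\omega)|\le\overline\kappa(1+|\omega|^2)^{-\beta/2}$ for all $\omega\in\mathbb{R}$. Let $\nu,a,L>0$ be fixed, and let $\mathcal{A}_\nu=\mathcal{A}_\nu(a,L)$. Then for sufficiently small $\varepsilon$ the minimax risk over the class $\mathcal{A}_\nu$ is bounded from below as follows: 1. (Regular case.) If $\beta>1/2$, then $$R^*_\varepsilon[\mathcal{A}_\nu]\ge c_4^*\,a^{-1}\varepsilon\left(\frac1\nu\ln\frac{L}{\varepsilon}\right)^{\beta-1/2},$$ where $c_4^*>0$ is a constant independent of $\nu,a,L$. 2. (Singular case.) If $0<\beta\le1/2$, then $$R^*_\varepsilon[\mathcal{A}_\nu]\ge\begin{cases}c_5^*\,\varepsilon\left(\ln\frac1\varepsilon\right)^{-1/2},&\text{if }\beta=1/2,\\ c_6^*\,\varepsilon^{2/(2\beta+1)},&\text{if }0<\beta<1/2,\end{cases}$$ where $c_5^*,c_6^*>0$ are constants independent of $\nu$.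
   Context: Fourier transform: $\widehat g(\omega)=\int_{-\infty}^\infty g(x)e^{2\pi i\omega x}\,dx$ for $g\in\mathbb{L}_1(\mathbb{R})\cap\mathbb{L}_2(\mathbb{R})$, extended to $\mathbb{L}_2(\mathbb{R})$ as usual (and given by the same integral on $\mathbb{L}_1(\mathbb{R})$). Functions $f$, $K$ are real-valued. Model: for unknown $f\in\mathbb{L}_2(\mathbb{R})$ one observes $dY(x)=(\mathsf{K}f)(x)\,dx+\varepsilon\,dW(x)$, $x\in\mathbb{R}$, where $W$ is a standard two-sided Wiener process on $\mathbb{R}$, $0<\varepsilon<1$, and $(\mathsf{K}f)(x)=\int_{-\infty}^\infty K(x-y)f(y)\,dy$ with known $K\in\mathbb{L}_1(\mathbb{R})$. $\mathbb{E}_f$ is expectation with respect to the law $\mathbb{P}_f$ of the observations for given $f$. Change-point: $f(x\pm)=\lim_{t\to x\pm}f(t)$, $[f](x)=f(x+)-f(x-)$; $\theta$ is a change-point of $f$ if $[f](\theta)\ne0$ and $f(\theta+),f(\theta-)$ are finite. Class: $\mathcal{A}_\nu(a,L)$ is the set of $f\in\mathbb{L}_2(\mathbb{R})$ having a single change-point $\theta\in[0,1]$ such that: (i) $|[f](\theta)|\ge a$; (ii) $f'(x)$ exists for all $x\ne\theta$ and $[f'](\theta)=0$, so that the function $g_f$ defined by $g_f(x)=f'(x)$ for $x\neq\theta$, $g_f(\theta)=f'(\theta\pm)$ is continuous; and (iii) $\int_{-\infty}^\infty|\widehat g_f(\omega)|^2\exp\{2\nu|\omega|\}\,d\omega\le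 L^2$. Risk: for an estimator $\hat\theta$ based on $Y$ and a class $\mathcal{G}$ of functions $f$ with a single change-point $\theta=\theta(f)\in[0,1]$, $R_\varepsilon[\hat\theta;\mathcal{G}]=\sup_{f\in\mathcal{G}}\{\mathbb{E}_f|\hat\theta-\theta|^2\}^{1/2}$. The minimax risk is $R^*_\varepsilon[\mathcal{G}]=\inf_{\hat\theta}R_\varepsilon[\hat\theta;\mathcal{G}]$, the infimum being over all estimators (measurable functions of the observations). *)

(* Defs.v *)
From HB Require Import structures.
From mathcomp Require Import all_boot all_order all_algebra.
From mathcomp Require Import all_classical all_reals all_analysis.
From mathcomp Require Import complex.

Set Implicit Arguments.
Unset Strict Implicit.
Unset Printing Implicit Defensive.

Import Order.TTheory GRing.Theory Num.Theory.
Import numFieldNormedType.Exports.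

Local Open Scope classical_set_scope.
Local Open Scope ring_scope.

Section FourierTransform.
Context {R : realType}.
Implicit Types (g : R -> R) (G : R -> R[i]).
Local Notation mu := (@lebesgue_measure R).

(* The convention is \int g x * exp (2 * i * pi * w * x) dx, positive sign in
   the exponent.  Only real-valued functions are ever transformed, so the real
   and imaginary parts are a cosine and a sine integral. *)
Definition fourier g (w : R) : R[i] :=
  Complex (\int[mu]_x (g x * cos (2 * pi * w * x)))
          (\int[mu]_x (g x * sin (2 * pi * w * x))).

(* Extension to L2 by density: the graph of the extended transform is the
   closure in L2 x L2 of its graph over the intersection of L1 and L2.  By
   Plancherel, for g in L2 such a G exists and is unique almost everywhere. *)
Definition is_fourier2 g G : Prop :=
  [/\ g \in Lfun mu 2%:E,
      measurable_fun setT (fun w => complex.Re (G w)),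
      measurable_fun setT (fun w => complex.Im (G w)) &
      exists u : nat -> R -> R,
        [/\ forall n, u n \in Lfun mu 1 /\ u n \in Lfun mu 2%:E,
            ('N[mu]_2%:E[EFin \o (u n \- g)%R])%E @[n --> \oo] --> 0%E &
            ('N[mu]_2%:E[EFin \o
               (fun w => Normc.normc (fourier (u n) w - G w)%R)])%E
              @[n --> \oo] --> 0%E]].

End FourierTransform.

Section ChangePoint.
Context {R : realType}.
Implicit Types (f : R -> R) (x theta nu a L : R).
Local Notation mu := (@lebesgue_measure R).

Definition jump f x : R := lim (f @ x^'+) - lim (f @ x^'-).

Definition change_point f x : Prop :=
  [/\ cvg (f @ x^'+), cvg (f @ x^'-) & jump f x != 0].

Definition single_change_point f theta : Prop :=
  [/\ theta \in `[0, 1], change_point f theta &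
      forall x, change_point f x -> x = theta].

(* The derivative of f, extended to theta by its one-sided limit there. *)
Definition filled_derivative f theta : R -> R :=
  fun x => if x == theta then lim (derive1 f @ theta^'+) else derive1 f x.

Definition change_point_class nu a L : set (R -> R) :=
  [set f | f \in Lfun mu 2%:E /\
    exists theta,
      [/\ single_change_point f theta,
          a <= `|jump f theta|,
          [/\ forall x, x != theta -> derivable f x 1,
              cvg (derive1 f @ theta^'+), cvg (derive1 f @ theta^'-),
              jump (derive1 f) theta = 0 &
              continuous (filled_derivative f theta)] &
          exists2 G, is_fourier2 (filled_derivative f theta) G &
            (\int[mu]_w (Normc.normc (G w) ^+ 2 * expR (2 * nu * `|w|))%:E
              <= (L ^+ 2)%:E)%E]].

End ChangePoint.

Section WhiteNoiseModel.
Context {R : realType} d (Omega : measurableType d) (P : probability Omega R).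
Local Notation mu := (@lebesgue_measure R).

(* Two-sided standard Wiener process: stationary independent increments over
   the whole line, started from 0 at time 0.  normal_prob takes the standard
   deviation, not the variance. *)
Definition two_sided_wiener (W : R -> {RV P >-> R}) : Prop :=
  [/\ {ae P, forall w, W 0 w = 0},
      {ae P, forall w, continuous (fun x => W x w)},
      forall s t : R, s < t -> forall B : set R, measurable B ->
        P ((fun w => W t w - W s w) @^-1` B)
        = normal_prob 0 (Num.sqrt (t - s)) B &
      forall (n : nat) (t : nat -> R), {homo t : i j / (i < j)%N >-> i < j} ->
        forall B : nat -> set R, (forall i, measurable (B i)) ->
        P (\bigcap_(i in `I_n) ((fun w => W (t i.+1) w - W (t i) w) @^-1` B i))
        = (\prod_(i < n) P ((fun w => W (t i.+1) w - W (t i) w)%R @^-1` B i))%E].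

Definition convolution (K f : R -> R) : R -> R :=
  fun x => \int[mu]_y (K (x - y) * f y).

(* The integral of h from 0 to x, for x of either sign. *)
Definition primitive0 (h : R -> R) (x : R) : R :=
  parameterized_integral mu 0 x h - parameterized_integral mu x 0 h.

(* Integrated form, normalised by Y 0 = 0, of dY(x) = (K * f)(x) dx + eps dW(x). *)
Definition observation (K : R -> R) (eps : R) (W : R -> {RV P >-> R})
    (f : R -> R) (w : Omega) : R -> R :=
  fun x => primitive0 (convolution K f) x + eps * W x w.

Definition path_cylinders : set (set (R -> R)) :=
  [set C | exists (x : R) (B : set R),
     measurable B /\ C = (fun y : R -> R => y x) @^-1` B].

Definition estimators : set ((R -> R) -> R) :=
  [set est | measurable_fun setT
     (est : g_sigma_algebraType path_cylinders -> R)].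

Definition risk (K : R -> R) (eps : R) (W : R -> {RV P >-> R})
    (est : (R -> R) -> R) (F : set (R -> R)) : \bar R :=
  ereal_sup [set r | exists f theta,
    [/\ F f, single_change_point f theta &
        r = sqrte
          ('E_P[fun w => (`|est (observation K eps W f w) - theta| ^+ 2)%R])%E]].

Definition minimax_risk (K : R -> R) (eps : R) (W : R -> {RV P >-> R})
    (F : set (R -> R)) : \bar R :=
  ereal_inf [set risk K eps W est F | est in estimators].

End WhiteNoiseModel.

(* Main.v *)
Require Import Defs.
From HB Require Import structures.
From mathcomp Require Import all_boot all_order all_algebra.
From mathcomp Require Import all_classical all_reals all_analysis.
From mathcomp Require Import complex.
From mathcomp Require Import measurable_realfun ring lra.

Set Implicit Arguments.
Unset Strict Implicit.
Unset Printing Implicit Defensive.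

Import Order.TTheory GRing.Theory Num.Theory.
Import numFieldNormedType.Exports.

Local Open Scope classical_set_scope.
Local Open Scope ring_scope.

(** The bound is a two-point argument. Two signals [f0], [f1] of the class,
    with change-points [0] and [delta], are built so close to each other that
    after blurring by [K] their distance in [L2] is at most [eps]. The laws of
    the two observations are then so close that no estimator can tell them
    apart, and one of the two risks is at least [delta / (4 sqrt e)].

    Closeness of the laws ([path_event_bound]). For a drift moved by a function
    whose derivative has square integral at most [eps ^ 2], every event [A] of
    the path space satisfies [P1(A)^2 <= e P0(A)]. For one increment of the
    observation this is Cauchy-Schwarz against the Gaussian likelihood ratio;
    by independence the constants of finitely many increments multiply, and
    their exponents add up to the discrete energy of the drift
    ([dominated_noisy_path]); a monotone class argument reaches all events.

    The signals ([null_signal], [shifted_signal]). Let [V_N] be the kernel whose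
    transform [m_N] is a trapezoid, equal to 1 on [-N, N] and to 0 beyond
    [2 N], and let [S_N] be its primitive. With [D] the indicator of
    [[0, delta[], put [f0 = a (1_(x >= 0) - S_h)] and [f1 = f0 - a (D - V_N * D)].
    Then [f1] is [a 1_(x >= delta)] minus a smooth function, and the derivatives
    of [f0] and [f1] away from the jump have transforms supported in
    [[-2 h, 2 h]] and [[-2 max(h, N), 2 max(h, N)]]. The exponential weight of
    the class therefore costs [exp (4 nu h)] and, on a part whose square
    integral is of order [delta^2 N^3], [exp (4 nu N)].

    The energy ([blurred_gap_energy]). The transform of [f1 - f0] is [- a (1 - m_N)]
    times the one of [D], so Plancherel's inequality bounds the energy of the
    blurred difference by
      [a^2 kappa^2 \int (1 + w^2)^(-beta) (1 - m_N w)^2 |D^ w|^2 dw],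
    where [|D^ w|^2] is at most [2 delta^2] and at most [1 / (pi w)^2].
    If [beta > 1/2] the weight is integrable and the frequencies beyond [N]
    contribute [delta^2 N^(1 - 2 beta)]; the class allows [N] of order
    [ln (L / eps) / nu], which gives the logarithmic factor of the rate
    ([regular_lower_bound]). If [beta <= 1/2] the gain from [N] is of no use,
    and [N = h] is a small constant; splitting the integral at a frequency [T]
    leaves [delta^2 \int_0^T (1 + w)^(-2 beta) dw + T^(-2 beta - 1)], to be
    compared with [eps^2] for [T = 1 / eps^2] ([critical_lower_bound]) or
    [T = 1 / delta] ([singular_lower_bound]). *)

(** * Affine changes of variable and integrals of real functions *)

Section affine_change.
Context {R : realType}.
Local Notation mu := (@lebesgue_measure R).
Implicit Types (a c : R) (f : R -> R).

Lemma measurable_affine a c : measurable_fun [set: R] (fun x : R => a * x + c).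
Proof. by apply: measurable_funD => //; exact: measurable_funM. Qed.

Lemma lebesgue_affine_itv a c : a != 0 -> forall p q : R,
  (`|a|%:E * mu ((fun x : R => a * x + c)%R @^-1` `]p, q]) = mu `]p, q])%E.
Proof.
move=> a0 p q.
have [a_gt0|a_le0] := ltP 0 a.
  rewrite (_ : _ @^-1` _ = `](p - c) / a, (q - c) / a]%classic); last first.
    apply/seteqP; split=> x /=; rewrite !in_itv/= ltr_pdivrMr// ler_pdivlMr//
      ltrBlDr lerBrDr (mulrC x)//.
  rewrite !lebesgue_measure_itv/= !lte_fin ltr_pM2r ?invr_gt0// ltrD2r.
  case: ifPn => // _; last by rewrite mule0.
  by rewrite -!EFinB -EFinM gtr0_norm//; congr EFin; field.
have a_lt0 : a < 0 by rewrite lt_neqAle a0.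
rewrite (_ : _ @^-1` _ = `[(q - c) / a, (p - c) / a[%classic); last first.
  apply/seteqP; split=> x /=; rewrite !in_itv/= ler_ndivrMr// ltr_ndivlMr//
      ltrBlDr lerBrDr (mulrC x)// andbC//.
rewrite !lebesgue_measure_itv/= !lte_fin ltr_nM2r ?invr_lt0// ltrD2r.
case: ifPn => // _; last by rewrite mule0.
by rewrite -!EFinB -EFinM ltr0_norm//; congr EFin; field.
Qed.

Lemma ge0_integral_affine a c (f : R -> \bar R) : a != 0 ->
  measurable_fun setT f -> (forall x, 0 <= f x)%E ->
  (\int[mu]_x f x = `|a|%:E * \int[mu]_x f (a * x + c)%R)%E.
Proof.
move=> a0 mf f0.
pose F : R -> R := fun x => a * x + c.
have mF : measurable_fun [set: measurableTypeR R] (F : _ -> measurableTypeR R).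
  exact: measurable_affine.
have na : (0 <= `|a|)%R by [].
pose m := mscale (NngNum na) (pushforward mu (F : _ -> measurableTypeR R)).
have E : forall A : set R, measurable A -> mu A = m mF A.
  apply: lebesgue_measure_unique => X [[p q] _ <-] /=.
  by rewrite /m /mscale/= /pushforward -(@lebesgue_affine_itv a c).
rewrite (eq_measure_integral (m mF)); last by move=> A mA _; exact: E.
by rewrite /m ge0_integral_mscale//= ge0_integral_pushforward//.
Qed.

Lemma integrable_affine a c f : a != 0 ->
  mu.-integrable setT (EFin \o f) ->
  mu.-integrable setT (EFin \o (fun x => f (a * x + c))).
Proof.
move=> a0 /integrableP[/measurable_EFinP mf foo]; apply/integrableP; split.
  apply/measurable_EFinP; exact: (measurableT_comp mf (measurable_affine a c)).
move: foo; rewrite (@ge0_integral_affine a c)//; last first.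
  by apply: measurableT_comp => //; apply/measurable_EFinP.
move=> foo; rewrite -[X in (X < _)%E]mul1e -(@divff _ `|a|) ?normr_eq0//.
by rewrite mulrC EFinM -muleA lte_mul_pinfty// lee_fin invr_ge0.
Qed.

Lemma Rintegral_affine a c f : a != 0 ->
  mu.-integrable setT (EFin \o f) ->
  \int[mu]_x f x = `|a| * \int[mu]_x f (a * x + c).
Proof.
move=> a0 intf; rewrite -RintegralZl//; last exact: integrable_affine.
rewrite /Rintegral; congr fine.
under [RHS]eq_integral do rewrite EFinM.
rewrite integralZl//; last exact: integrable_affine.
have /measurable_EFinP mf := measurable_int _ intf.
have mF : measurable_fun setT (fun x => f (a * x + c)).
  exact: (measurableT_comp mf (measurable_affine a c)).
rewrite [LHS]integralE [X in (_ * X)%E]integralE muleBr//; last first.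
  by apply: integrable_add_def => //; exact: integrable_affine.
rewrite (@ge0_integral_affine a c)//; last exact/measurable_funepos/measurable_EFinP.
rewrite (@ge0_integral_affine a c (fun x => (EFin \o f)^\- x)%E)//.
  have -> : (fun x => (f (a * x + c))%:E) = (EFin \o f) \o (fun x => a * x + c) by [].
  by rewrite (funepos_comp (EFin \o f) (fun x => a * x + c))
    (funeneg_comp (EFin \o f) (fun x => a * x + c)).
exact: (measurable_funeneg (measurable_int _ intf)).
Qed.

Lemma Rintegral_shift c f : mu.-integrable setT (EFin \o f) ->
  \int[mu]_x f (x + c) = \int[mu]_x f x.
Proof.
move=> intf; rewrite (@Rintegral_affine 1 c f)// normr1 mul1r.
by apply: eq_Rintegral => x _; rewrite mul1r.
Qed.

Lemma Rintegral_reflect c f : mu.-integrable setT (EFin \o f) ->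
  \int[mu]_x f (c - x) = \int[mu]_x f x.
Proof.
move=> intf; rewrite (@Rintegral_affine (-1) c f)// ?oppr_eq0// normrN1 mul1r.
by apply: eq_Rintegral => x _; rewrite mulN1r addrC.
Qed.

End affine_change.

Section integration_tools.
Context {R : realType}.
Local Notation mu := (@lebesgue_measure R).
Implicit Types (f g : R -> R).

Lemma integrableMl (c : R) f : mu.-integrable setT (EFin \o f) ->
  mu.-integrable setT (EFin \o (fun x => c * f x)).
Proof.
move=> intf; have := @integrableZl _ _ _ mu _ measurableT c _ intf.
by apply: eq_integrable => // x _ /=; rewrite EFinM.
Qed.

Lemma integrableMr (c : R) f : mu.-integrable setT (EFin \o f) ->
  mu.-integrable setT (EFin \o (fun x => f x * c)).
Proof.
move=> intf; have := integrableMl c intf.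
by apply: eq_integrable => // x _ /=; rewrite mulrC.
Qed.

Lemma integrable_normr f : mu.-integrable setT (EFin \o f) ->
  mu.-integrable setT (EFin \o (fun x => `|f x|)).
Proof. by move=> intf; exact: (integrable_abse intf). Qed.

Lemma ge0_integrable f : measurable_fun setT f -> (forall x, 0 <= f x) ->
  (\int[mu]_x (f x)%:E < +oo)%E -> mu.-integrable setT (EFin \o f).
Proof.
move=> mf f0 ffin; apply/integrableP; split; first exact/measurable_EFinP.
apply: le_lt_trans ffin; rewrite le_eqVlt; apply/orP; left; apply/eqP.
by apply: eq_integral => x _ /=; rewrite ger0_norm.
Qed.

Lemma integrable_mulr_bounded f g (M : R) : mu.-integrable setT (EFin \o f) ->
  measurable_fun setT g -> (forall x, `|g x| <= M) ->
  mu.-integrable setT (EFin \o (fun x => f x * g x)).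
Proof.
move=> intf mg gM; have /measurable_EFinP mf := measurable_int _ intf.
apply: (@le_integrable _ _ _ mu _ measurableT _ (EFin \o (fun x => M * `|f x|))).
- by apply/measurable_EFinP; exact: measurable_funM.
- move=> x _ /=; rewrite lee_fin !normrM normr_id mulrC ler_wpM2r//.
  by rewrite (le_trans (gM x))// ler_norm.
- exact/integrableMl/integrable_normr.
Qed.

Lemma Rdominated_convergence (f_ : (R -> R)^nat) f g :
  (forall n, measurable_fun setT (f_ n)) -> measurable_fun setT f ->
  mu.-integrable setT (EFin \o g) ->
  {ae mu, forall x, f_ n x @[n --> \oo] --> f x} ->
  (forall n x, `|f_ n x| <= g x) ->
  mu.-integrable setT (EFin \o f) /\
  (\int[mu]_x f_ n x @[n --> \oo] --> \int[mu]_x f x).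
Proof.
move=> mf_ mf intg cvf fg.
have [] := @dominated_convergence _ _ _ mu _ measurableT
  (fun n => EFin \o f_ n) (EFin \o f) (EFin \o g).
- by move=> n; apply/measurable_EFinP; exact: mf_.
- by apply/measurable_EFinP; exact: mf.
- by apply: (@filterS _ _ (ae_filter_ringOfSetsType mu) _ _ _ cvf) => x h _;
    apply: cvg_EFin => //; exact: nearW.
- exact: intg.
- by apply: aeW => x n _ /=; rewrite lee_fin.
move=> intf _ h; split=> //.
move: h; rewrite -[(\int[mu]_x _)%E in X in X -> _]fineK; last first.
  exact: integrable_fin_num.
exact: fine_cvg.
Qed.

Lemma Fubini_Rintegral (G : R * R -> R) :
  (mu \x mu)%E.-integrable setT (EFin \o G) ->
  (forall x, mu.-integrable setT (EFin \o (fun y => G (x, y)))) ->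
  (forall y, mu.-integrable setT (EFin \o (fun x => G (x, y)))) ->
  \int[mu]_x \int[mu]_y G (x, y) = \int[mu]_y \int[mu]_x G (x, y).
Proof.
move=> intG intx inty; rewrite {1 3}/Rintegral; congr fine.
transitivity (\int[mu]_x \int[mu]_y (G (x, y))%:E)%E.
  apply: eq_integral => x _; rewrite fineK//.
  exact: (integrable_fin_num measurableT (intx x)).
transitivity (\int[mu]_y \int[mu]_x (G (x, y))%:E)%E; last first.
  apply: eq_integral => y _; rewrite fineK//.
  exact: (integrable_fin_num measurableT (inty y)).
exact: (@Fubini _ _ _ _ _ mu mu (EFin \o G)).
Qed.

Lemma integrable_Rintegral_fst (G : R * R -> R) :
  (mu \x mu)%E.-integrable setT (EFin \o G) ->
  (forall x, mu.-integrable setT (EFin \o (fun y => G (x, y)))) ->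
  mu.-integrable setT (EFin \o (fun x => \int[mu]_y G (x, y))).
Proof.
move=> intG intx; have := integrable_fubini_F intG.
apply: eq_integrable => // x _; rewrite /fubini_F /= /Rintegral fineK//.
exact: (integrable_fin_num measurableT (intx x)).
Qed.

End integration_tools.

(** * Cosine and sine transforms, and the convolution theorem *)

Section cosine_sine_transforms.
Context {R : realType}.
Local Notation mu := (@lebesgue_measure R).
Implicit Types (f g K u : R -> R) (w x y : R).

Definition cosT f w : R := \int[mu]_x (f x * cos (2 * pi * w * x)).
Definition sinT f w : R := \int[mu]_x (f x * sin (2 * pi * w * x)).

Lemma fourierE f w : fourier f w = Complex (cosT f w) (sinT f w).
Proof. by []. Qed.

Lemma measurable_coswave w : measurable_fun setT (fun x : R => cos (2 * pi * w * x)).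
Proof.
apply: measurableT_comp; last exact: measurable_funM.
by apply: continuous_measurable_fun; exact: continuous_cos.
Qed.

Lemma measurable_sinwave w : measurable_fun setT (fun x : R => sin (2 * pi * w * x)).
Proof.
apply: measurableT_comp; last exact: measurable_funM.
by apply: continuous_measurable_fun; exact: continuous_sin.
Qed.

Lemma normr_cos_le1 x : `|cos x| <= 1 :> R.
Proof. by rewrite ler_norml cos_geN1 cos_le1. Qed.

Lemma normr_sin_le1 x : `|sin x| <= 1 :> R.
Proof. by rewrite ler_norml sin_geN1 sin_le1. Qed.

Lemma integrable_cosT f w : mu.-integrable setT (EFin \o f) ->
  mu.-integrable setT (EFin \o (fun x => f x * cos (2 * pi * w * x))).
Proof.
move=> intf; apply: (@integrable_mulr_bounded _ _ _ 1) => //.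
- exact: measurable_coswave.
- by move=> x; exact: normr_cos_le1.
Qed.

Lemma integrable_sinT f w : mu.-integrable setT (EFin \o f) ->
  mu.-integrable setT (EFin \o (fun x => f x * sin (2 * pi * w * x))).
Proof.
move=> intf; apply: (@integrable_mulr_bounded _ _ _ 1) => //.
- exact: measurable_sinwave.
- by move=> x; exact: normr_sin_le1.
Qed.

Section convolution.
Variables (K u : R -> R) (M : R).
Hypothesis intK : mu.-integrable setT (EFin \o K).
Hypothesis mu_ : measurable_fun setT u.
Hypothesis uM : forall x, `|u x| <= M.

Let mK : measurable_fun setT K.
Proof. by apply/measurable_EFinP; exact: (measurable_int _ intK). Qed.

Lemma integrable_reflect x : mu.-integrable setT (EFin \o (fun y => K (x - y))).
Proof.
have N1 : (-1 : R) != 0 by rewrite oppr_eq0.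
have := @integrable_affine _ (-1) x _ N1 intK.
by apply: eq_integrable => // y _ /=; rewrite mulN1r addrC.
Qed.

Lemma integrable_convolution_slice x :
  mu.-integrable setT (EFin \o (fun y => K (x - y) * u y)).
Proof. exact: integrable_mulr_bounded (integrable_reflect x) mu_ uM. Qed.

Lemma normr_convolution_le x : `|convolution K u x| <= M * \int[mu]_y `|K y|.
Proof.
apply: (le_trans (le_normr_Rintegral _ (integrable_convolution_slice x))) => //.
have intK' : mu.-integrable setT (EFin \o (fun y => `|K y|)).
  exact: (integrable_abse intK).
rewrite -(Rintegral_reflect x intK') -RintegralZl//; last first.
  exact: (integrable_abse (integrable_reflect x)).
apply: le_Rintegral => //.
- exact: (integrable_abse (integrable_convolution_slice x)).
- by apply: integrableMl; exact: (integrable_normr (integrable_reflect x)).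
- by move=> y _; rewrite normrM mulrC ler_wpM2r.
Qed.

(** Dominated convergence, once the shift is moved onto the bounded factor: its
    translates converge off a countable, hence null, set. Only boundedness is
    asked of [u], so that the signals themselves, which decay slowly, qualify. *)
Lemma continuous_convolution (D : set R) : countable D ->
  (forall x, ~ D x -> {for x, continuous u}) ->
  continuous (convolution K u).
Proof.
move=> cD cu.
have -> : convolution K u = (fun z => \int[mu]_t (K t * u (z - t))).
  apply/funext => z.
  rewrite /convolution -(@Rintegral_reflect _ z)//; last exact: integrable_convolution_slice.
  by apply: eq_Rintegral => t _; rewrite opprB addrCA subrr addr0.
move=> x; apply/(@cvg_nbhsP _ R^o) => x_ x_x.
have mshift (z : R) : measurable_fun setT (fun t : R => u (z - t)).
  by apply: measurableT_comp => //; exact: measurable_funB.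
apply: (@Rdominated_convergence _ (fun n t => K t * u (x_ n - t)) _
  (fun t => M * `|K t|) _ _ _ _ _).2.
- by move=> n; exact: measurable_funM.
- exact: measurable_funM.
- by apply: integrableMl; exact: (integrable_normr intK).
- exists [set x - d | d in D]; split.
  + apply: countable_measurable => [t|]; [exact: measurable_set1|
      exact: sub_countable (card_image_le _ _) cD].
  + apply: countable_lebesgue_measure0; exact: sub_countable (card_image_le _ _) cD.
  + move=> t /=; apply: contra_notP => tD.
    apply: cvgM; first exact: cvg_cst.
    have /cu cut : ~ D (x - t).
      by move=> Dxt; apply: tD; exists (x - t) => //; rewrite opprB addrCA subrr addr0.
    apply: (@cvg_comp _ _ _ (fun n => x_ n - t) u \oo (nbhs (x - t)) _ _ cut).
    by apply: cvgB => //; exact: cvg_cst.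
- by move=> n t; rewrite normrM mulrC ler_wpM2r.
Qed.

Hypothesis intu : mu.-integrable setT (EFin \o u).

Let G (z : R * R) := K (z.1 - z.2) * u z.2.

Let mG : measurable_fun setT G.
Proof.
apply: measurable_funM; last exact: measurableT_comp.
by apply: measurableT_comp => //; exact: measurable_funB.
Qed.

Lemma integrable2_convolution : (mu \x mu)%E.-integrable setT (EFin \o G).
Proof.
apply/integrable21ltyP; first exact/measurable_EFinP.
have e y : (\int[mu]_x `|(EFin \o G) (x, y)|)%E
         = (`|u y|%:E * \int[mu]_x `|(K x)%:E|)%E.
  rewrite (@ge0_integral_affine _ 1 (- y) (fun x => `|(K x)%:E|)%E)//; last first.
    by apply: measurableT_comp => //; apply/measurable_EFinP.
  rewrite normr1 mul1e -ge0_integralZl//; last first.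
    apply: measurableT_comp => //; apply/measurable_EFinP.
    exact: (measurableT_comp mK (measurable_affine _ _)).
  by apply: eq_integral => x _; rewrite /= normrM EFinM muleC mul1r.
under eq_integral do rewrite e.
rewrite ge0_integralZr//; last 2 first.
- by apply/measurable_EFinP; apply: measurableT_comp.
- exact: integral_ge0.
have [_ Kfin] := integrableP _ _ _ intK.
have [_ ufin] := integrableP _ _ _ intu.
rewrite lte_mul_pinfty//; first exact: integral_ge0.
by rewrite ge0_fin_numE//; exact: integral_ge0.
Qed.

Lemma integrable_convolution : mu.-integrable setT (EFin \o convolution K u).
Proof.
exact: (@integrable_Rintegral_fst _ G integrable2_convolution
  integrable_convolution_slice).
Qed.

(** Fubini; both transforms are then read off from the addition formulas. *)
Let transform_convolution (e : R -> R) : measurable_fun setT e ->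
  (forall x, `|e x| <= 1) ->
  \int[mu]_x (convolution K u x * e x) =
  \int[mu]_y (\int[mu]_t (K t * e (t + y)) * u y).
Proof.
move=> me e1.
have intslice x : mu.-integrable setT
    (EFin \o (fun y => K (x - y) * u y * e x)).
  by apply: integrableMr; exact: (integrable_convolution_slice x).
have intslice' y : mu.-integrable setT
    (EFin \o (fun x => K (x - y) * u y * e x)).
  apply: (@integrable_mulr_bounded _ _ _ 1) => //.
  have := @integrableZr _ _ _ mu _ measurableT (u y) _
    (@integrable_affine _ 1 (- y) _ (oner_neq0 _) intK).
  by apply: eq_integrable => // x _ /=; rewrite mul1r EFinM.
transitivity (\int[mu]_x \int[mu]_y (K (x - y) * u y * e x)).
  apply: eq_Rintegral => x _; rewrite RintegralZr//.
  exact: integrable_convolution_slice.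
rewrite (@Fubini_Rintegral _ (fun z => G z * e z.1))//=; last first.
  apply: le_integrable integrable2_convolution => //.
    apply/measurable_EFinP; apply: measurable_funM => //.
    exact: measurableT_comp.
  by move=> z _ /=; rewrite lee_fin normrM ler_piMr.
apply: eq_Rintegral => y _; rewrite /G/=.
rewrite -RintegralZr//; last first.
  apply: (@integrable_mulr_bounded _ _ _ 1) => //.
  by apply: measurableT_comp => //; exact: measurable_funD.
rewrite -(@Rintegral_shift _ y); last exact: intslice'.
by apply: eq_Rintegral => t _; rewrite addrK mulrAC.
Qed.

Lemma cosT_convolution w :
  cosT (convolution K u) w = cosT K w * cosT u w - sinT K w * sinT u w.
Proof.
rewrite {1}/cosT transform_convolution; last 2 first.
- exact: measurable_coswave.
- by move=> x; exact: normr_cos_le1.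
have e y : \int[mu]_t (K t * cos (2 * pi * w * (t + y))) * u y =
    cosT K w * (u y * cos (2 * pi * w * y)) -
    sinT K w * (u y * sin (2 * pi * w * y)).
  have -> : \int[mu]_t (K t * cos (2 * pi * w * (t + y))) =
     \int[mu]_t ((K t * cos (2 * pi * w * t)) * cos (2 * pi * w * y) -
                 (K t * sin (2 * pi * w * t)) * sin (2 * pi * w * y)).
    by apply: eq_Rintegral => t _; rewrite mulrDr cosD; ring.
  rewrite RintegralB//; last 2 first.
  - by apply: integrableMr; exact: (integrable_cosT w intK).
  - by apply: integrableMr; exact: (integrable_sinT w intK).
  rewrite RintegralZr ?integrable_cosT// RintegralZr ?integrable_sinT//.
  by rewrite /cosT /sinT; ring.
under eq_Rintegral do rewrite e.
rewrite RintegralB//; last 2 first.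
- by apply: integrableMl; exact: (integrable_cosT w intu).
- by apply: integrableMl; exact: (integrable_sinT w intu).
by rewrite RintegralZl ?integrable_cosT// RintegralZl ?integrable_sinT.
Qed.

Lemma sinT_convolution w :
  sinT (convolution K u) w = sinT K w * cosT u w + cosT K w * sinT u w.
Proof.
rewrite {1}/sinT transform_convolution; last 2 first.
- exact: measurable_sinwave.
- by move=> x; exact: normr_sin_le1.
have e y : \int[mu]_t (K t * sin (2 * pi * w * (t + y))) * u y =
    sinT K w * (u y * cos (2 * pi * w * y)) +
    cosT K w * (u y * sin (2 * pi * w * y)).
  have -> : \int[mu]_t (K t * sin (2 * pi * w * (t + y))) =
     \int[mu]_t ((K t * sin (2 * pi * w * t)) * cos (2 * pi * w * y) +
                 (K t * cos (2 * pi * w * t)) * sin (2 * pi * w * y)).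
    by apply: eq_Rintegral => t _; rewrite mulrDr sinD; ring.
  rewrite RintegralD//; last 2 first.
  - by apply: integrableMr; exact: (integrable_sinT w intK).
  - by apply: integrableMr; exact: (integrable_cosT w intK).
  rewrite RintegralZr ?integrable_sinT// RintegralZr ?integrable_cosT//.
  by rewrite /cosT /sinT; ring.
under eq_Rintegral do rewrite e.
rewrite RintegralD//; last 2 first.
- by apply: integrableMl; exact: (integrable_cosT w intu).
- by apply: integrableMl; exact: (integrable_sinT w intu).
by rewrite RintegralZl ?integrable_cosT// RintegralZl ?integrable_sinT.
Qed.

End convolution.

End cosine_sine_transforms.

(** * Integrals computed from an antiderivative *)

Section fundamental_theorem_is_derive.
Context {R : realType}.
Local Notation mu := (@lebesgue_measure R).
Implicit Types (f F : R -> R) (a b l x s : R).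

Lemma is_derive_continuous F x (d : R) : is_derive x 1 F d -> {for x, continuous F}.
Proof.
by move=> [dF _]; apply: differentiable_continuous; exact/derivable1_diffP.
Qed.

Lemma ge0_FTC2y_is_derive f F a l :
  (forall x, a <= x -> 0 <= f x) ->
  (forall x, a <= x -> {for x, continuous f}) ->
  (forall x, a <= x -> is_derive x 1 F (f x)) ->
  F x @[x --> +oo] --> l ->
  (\int[mu]_(x in `[a, +oo[) (f x)%:E = (l - F a)%:E)%E.
Proof.
move=> f0 cf dF Fl; rewrite EFinB; apply: ge0_continuous_FTC2y => //.
- apply/continuous_within_itvcyP; split=> [x|].
    by rewrite in_itv/= andbT => /ltW/cf.
  by apply: cvg_at_right_filter; exact: cf.
- by move=> x /ltW/dF[].
- by apply: cvg_at_right_filter; exact: is_derive_continuous (dF _ (lexx a)).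
- by move=> x; rewrite in_itv/= andbT derive1E => /ltW/dF[_ ->].
Qed.

Lemma FTC2_is_derive f F a b : a < b ->
  (forall x, a <= x <= b -> {for x, continuous f}) ->
  (forall x, a <= x <= b -> is_derive x 1 F (f x)) ->
  (\int[mu]_(x in `[a, b]) (f x)%:E = (F b - F a)%:E)%E.
Proof.
move=> ab cf dF; rewrite EFinB.
have aab : a <= a <= b by rewrite lexx ltW.
have abb : a <= b <= b by rewrite lexx ltW.
apply: continuous_FTC2 => //.
- by apply: continuous_in_subspaceT => x /set_mem/=; rewrite in_itv/=; exact: cf.
- split.
  + by move=> x; rewrite in_itv/= => /andP[/ltW ax /ltW xb]; have [] : is_derive x 1 F (f x) by apply: dF; rewrite ax.
  + by apply: cvg_at_right_filter; exact: is_derive_continuous (dF _ aab).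
  + by apply: cvg_at_left_filter; exact: is_derive_continuous (dF _ abb).
- move=> x; rewrite in_itv/= => /andP[/ltW ax /ltW xb].
  have [_ <-] : is_derive x 1 F (f x) by apply: dF; rewrite ax.
  by rewrite derive1E.
Qed.

(** Damped trigonometric sums are stable under differentiation, so that the
    damped integrals below have antiderivatives of the same shape. *)
Lemma is_derive_damped_wave (s b A B C x : R) :
  is_derive x 1 (fun x => expR (- s * x) * (A * sin (b * x) + B * cos (b * x) + C))
    (expR (- s * x) * ((b * A - s * B) * cos (b * x) - (b * B + s * A) * sin (b * x) - s * C)).
Proof.
apply: trigger_derive; rewrite /GRing.scale/=.
ring.
Qed.

Lemma cvg_damped0 s (g : R -> R) (M : R) : 0 < s -> (forall x, `|g x| <= M) ->
  expR (- s * x) * g x @[x --> +oo] --> 0.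
Proof.
move=> s0 gM.
have E : (fun x => M * expR (- s * x)) x @[x --> +oo] --> 0.
  rewrite -(mulr0 M); apply: cvgM; first exact: cvg_cst.
  under eq_fun do rewrite mulNr.
  apply: (cvg_comp (fun x => s * x) (fun x => expR (- x)) _ (@cvgr_expR R)).
  exact: gt0_cvgMry.
apply/cvgr0Pnorm_lt => e e0.
have /cvgr0Pnorm_lt/(_ _ e0) := E.
apply: filterS => x /=; apply: le_lt_trans.
by rewrite !normrM mulrC ler_wpM2r// (le_trans (gM x))// ler_norm.
Qed.

End fundamental_theorem_is_derive.

(** * Abel summation of the inversion integral *)

Section abel_summation.
Context {R : realType}.
Local Notation mu := (@lebesgue_measure R).
Implicit Types (f g A : R -> R) (s b c x w z : R).

Lemma continuous_exp_abs s : continuous (fun x : R => expR (- s * `|x|)).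
Proof.
move=> x; apply: continuous_comp; last exact: continuous_expR.
by apply: continuousM; [exact: cst_continuous|exact: norm_continuous].
Qed.

Lemma measurable_exp_abs s : measurable_fun setT (fun x : R => expR (- s * `|x|)).
Proof. by apply: continuous_measurable_fun; exact: continuous_exp_abs. Qed.

(** The constant [c >= 1] keeps the integrand nonnegative, as the integral over
    a half-line of a derivative requires; the values for [c = 1] and [c = 2]
    will give the one of the cosine alone. *)
Let integral_damped c s b : 1 <= c -> 0 < s ->
  (\int[mu]_x (expR (- s * `|x|) * (c + cos (b * x)))%:E =
   (2 * (c / s + s / (s ^+ 2 + b ^+ 2)))%:E)%E.
Proof.
move=> c1 s0.
have sb0 : s ^+ 2 + b ^+ 2 != 0 by rewrite gt_eqF// ltr_pwDl ?exprn_gt0 ?sqr_ge0.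
have pos x : 0 <= c + cos (b * x).
  by have := cos_geN1 (b * x); lra.
have cf : continuous (fun x : R => expR (- s * `|x|) * (c + cos (b * x))).
  move=> x; apply: cvgM; first exact: continuous_exp_abs.
  apply: (@is_derive_continuous _ (fun x => c + cos (b * x)) x (- sin (b * x) * b)).
  by apply: trigger_derive; rewrite /GRing.scale/=; ring.
rewrite ge0_symfun_integralT//; last 2 first.
- by move=> x; rewrite mulr_ge0// expR_ge0.
- by move=> x /=; rewrite normrN mulrN cosN.
rewrite -set_itvcy.
rewrite (_ : (\int[mu]_(x in `[0%R, +oo[) _)%E =
  (\int[mu]_(x in `[0%R, +oo[) (expR (- s * x) * (c + cos (b * x)))%:E)%E); last first.
  by apply: eq_integral => x; rewrite inE/= in_itv/= andbT => x0; rewrite ger0_norm.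
pose A := b / (s ^+ 2 + b ^+ 2); pose B := - s / (s ^+ 2 + b ^+ 2).
pose F x := expR (- s * x) * (A * sin (b * x) + B * cos (b * x) + - (c / s)).
have -> : (\int[mu]_(x in `[0%R, +oo[) (expR (- s * x) * (c + cos (b * x)))%:E
           = (0 - F 0)%:E)%E; last first.
  rewrite -EFinM; congr EFin; rewrite /F !mulr0 expR0 sin0 cos0 /B; field.
  by rewrite sb0 gt_eqF.
apply: ge0_FTC2y_is_derive.
- by move=> x _; rewrite mulr_ge0// expR_ge0.
- move=> x _; apply: (@is_derive_continuous _ _ _ (expR (- s * x) * (- b * sin (b * x)) +
    (c + cos (b * x)) * (expR (- s * x) * - s))).
  by apply: trigger_derive; rewrite /GRing.scale/=; ring.
- move=> x _; apply: (trigger_derive (is_derive_damped_wave s b A B (- (c / s)) x)).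
  rewrite /A /B; field.
  by rewrite sb0 gt_eqF.
- apply: (@cvg_damped0 _ _ _ (`|A| + `|B| + `|c / s|)) => // x.
  rewrite (le_trans (ler_normB _ _))// lerD2r.
  rewrite (le_trans (ler_normD _ _))// !normrM lerD// ler_piMr//.
  + exact: normr_sin_le1.
  + exact: normr_cos_le1.
Qed.

Let integrable_damped c s b : 1 <= c -> 0 < s ->
  mu.-integrable setT (EFin \o (fun x => expR (- s * `|x|) * (c + cos (b * x)))).
Proof.
move=> c1 s0.
have mf : measurable_fun setT (fun x : R => expR (- s * `|x|) * (c + cos (b * x))).
  apply: measurable_funM; first exact: measurable_exp_abs.
  apply: measurable_funD => //.
  apply: measurableT_comp; last exact: measurable_funM.
  by apply: continuous_measurable_fun; exact: continuous_cos.
apply: ge0_integrable => //; last by rewrite integral_damped// ltry.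
move=> x; rewrite mulr_ge0 ?expR_ge0//.
by have := cos_geN1 (b * x); lra.
Qed.

Lemma integrable_exp_abs s : 0 < s ->
  mu.-integrable setT (EFin \o (fun x => expR (- s * `|x|))).
Proof.
move=> s0; apply: (@le_integrable _ _ _ mu _ measurableT _
   (EFin \o (fun x => expR (- s * `|x|) * (2 + cos (0 * x))))).
- by apply/measurable_EFinP; exact: measurable_exp_abs.
- move=> x _ /=; rewrite mul0r cos0 lee_fin normrM ler_peMr//.
  by rewrite ger0_norm; lra.
- by apply: integrable_damped => //; lra.
Qed.

Lemma cosT_exp_abs s z : 0 < s ->
  cosT (fun x => expR (- s * `|x|)) z = 2 * s / (s ^+ 2 + (2 * pi * z) ^+ 2).
Proof.
move=> s0; pose b := 2 * pi * z.
have I c : 1 <= c -> \int[mu]_x (expR (- s * `|x|) * (c + cos (b * x))) =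
    2 * (c / s + s / (s ^+ 2 + b ^+ 2)).
  by move=> c1; rewrite /Rintegral integral_damped.
have D c : 1 <= c -> \int[mu]_x (expR (- s * `|x|) * (c + cos (b * x))) =
    c * (\int[mu]_x expR (- s * `|x|)) + cosT (fun x => expR (- s * `|x|)) z.
  move=> c1; rewrite /cosT -RintegralZl//; last exact: integrable_exp_abs.
  rewrite -RintegralD//; last 2 first.
  - by apply: integrableMl; exact: integrable_exp_abs.
  - by apply: integrable_cosT; exact: integrable_exp_abs.
  by apply: eq_Rintegral => x _; rewrite mulrDr (mulrC c).
(* The cosine part is twice the value at 1 minus the value at 2. *)
have := D 1 (lexx _); have : (1 : R) <= 2 by lra.
move=> /[dup] h /D; rewrite !I//.
have sb0 : s ^+ 2 + b ^+ 2 != 0 by rewrite gt_eqF// ltr_pwDl ?exprn_gt0 ?sqr_ge0.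
set X := \int[mu]_x _; set Y := cosT _ _ => h1 h2.
rewrite -/b; transitivity (2 * (2 * (1 / s + s / (s ^+ 2 + b ^+ 2))) - 2 * (2 / s + s / (s ^+ 2 + b ^+ 2))).
  by rewrite h1 h2; ring.
by field; rewrite sb0 gt_eqF.
Qed.

Lemma integralT_oneDsqrV : (\int[mu]_x (1 + x ^+ 2)^-1%:E = pi%:E)%E.
Proof.
rewrite ge0_symfun_integralT//=; last 3 first.
- by move=> x; rewrite invr_ge0 addr_ge0// sqr_ge0.
- exact: continuous_oneDsqrV.
- by move=> x /=; rewrite sqrrN.
rewrite -set_itvcy integral0y_oneDsqr -EFinM; congr EFin.
by rewrite mulrC divfK.
Qed.

Lemma integrable_oneDsqrV : mu.-integrable setT (EFin \o (fun x : R => (1 + x ^+ 2)^-1)).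
Proof.
apply: ge0_integrable; last by rewrite integralT_oneDsqrV ltry.
- by apply: continuous_measurable_fun; exact: continuous_oneDsqrV.
- by move=> x; rewrite invr_ge0 addr_ge0// sqr_ge0.
Qed.

Lemma integrable_prod_mul f g : mu.-integrable setT (EFin \o f) ->
  mu.-integrable setT (EFin \o g) ->
  (mu \x mu)%E.-integrable setT (EFin \o (fun z : R * R => f z.1 * g z.2)).
Proof.
move=> intf intg.
have /measurable_EFinP mf := measurable_int _ intf.
have /measurable_EFinP mg := measurable_int _ intg.
have [_ ffin] := integrableP _ _ _ intf.
have [_ gfin] := integrableP _ _ _ intg.
apply/integrable21ltyP.
  by apply/measurable_EFinP; apply: measurable_funM; exact: measurableT_comp.
under eq_integral => y _.
  under eq_integral => x _ do rewrite /= normrM EFinM.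
  rewrite ge0_integralZr//; last first.
    by apply/measurable_EFinP; exact: measurableT_comp.
  over.
rewrite ge0_integralZl//; last 2 first.
- by apply/measurable_EFinP; exact: measurableT_comp.
- exact: integral_ge0.
rewrite lte_mul_pinfty//; first exact: integral_ge0.
by rewrite ge0_fin_numE//; exact: integral_ge0.
Qed.

(** Fubini exchanges the two integrals, and the transform of the damping factor
    is a Poisson kernel; rescaling brings this kernel to width one. *)
Lemma damped_inversion_integral A s : mu.-integrable setT (EFin \o A) -> 0 < s ->
  \int[mu]_w (cosT A w * expR (- s * `|w|)) =
  \int[mu]_t (A (s / (2 * pi) * t) * (pi^-1 * (1 + t ^+ 2)^-1)).
Proof.
move=> intA s0; have /measurable_EFinP mA := measurable_int _ intA.
have pi0 : pi != 0 :> R by rewrite gt_eqF// pi_gt0.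
transitivity (\int[mu]_w \int[mu]_z (expR (- s * `|w|) * A z * cos (2 * pi * w * z))).
  apply: eq_Rintegral => w _; rewrite /cosT mulrC -RintegralZl//; last exact: integrable_cosT.
  by apply: eq_Rintegral => z _; rewrite mulrA.
rewrite (@Fubini_Rintegral _ (fun p => expR (- s * `|p.1|) * A p.2 * cos (2 * pi * p.1 * p.2)))/=; last 3 first.
- apply: le_integrable (integrable_prod_mul (integrable_exp_abs s0) intA) => //.
    apply/measurable_EFinP; apply: measurable_funM.
      apply: measurable_funM; last exact: measurableT_comp.
      by apply: (measurableT_comp (measurable_exp_abs s)).
    apply: measurableT_comp; first by apply: continuous_measurable_fun; exact: continuous_cos.
    by apply: measurable_funM => //; exact: measurable_funM.
  by move=> p _ /=; rewrite lee_fin normrM ler_piMr// normr_cos_le1.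
- by move=> w; apply: (@integrable_cosT _ (fun z => _)); exact: integrableMl.
- move=> z; have := @integrable_cosT _ _ z (integrableMr (A z) (integrable_exp_abs s0)).
  by apply: eq_integrable => // w _ /=; rewrite (mulrAC _ w).
transitivity (\int[mu]_z (A z * (2 * s / (s ^+ 2 + (2 * pi * z) ^+ 2)))).
  apply: eq_Rintegral => z _; rewrite -cosT_exp_abs// /cosT -RintegralZl//; last first.
    by apply: integrable_cosT; exact: integrable_exp_abs.
  by apply: eq_Rintegral => w _; rewrite (mulrAC _ z w); ring.
have a0 : s / (2 * pi) != 0 by rewrite mulf_neq0 ?invr_eq0 ?mulf_neq0// gt_eqF.
have den z : s ^+ 2 + (2 * pi * z) ^+ 2 != 0.
  by rewrite gt_eqF// ltr_pwDl ?exprn_gt0 ?sqr_ge0.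
have s1 : s != 0 by rewrite gt_eqF.
have intQ : mu.-integrable setT
    (EFin \o (fun z => A z * (2 * s / (s ^+ 2 + (2 * pi * z) ^+ 2)))).
  apply: (@integrable_mulr_bounded _ _ _ (2 * s / s ^+ 2)) => //.
    apply: continuous_measurable_fun => z; apply: cvgM; first exact: cvg_cst.
    apply: cvgV; first exact: den.
    apply: (@is_derive_continuous _ (fun z => s ^+ 2 + (2 * pi * z) ^+ 2) z (8 * pi ^+ 2 * z)).
    by apply: trigger_derive; rewrite /GRing.scale/=; ring.
  move=> z; rewrite ger0_norm; last first.
    by rewrite divr_ge0 ?addr_ge0 ?sqr_ge0// mulr_ge0// ltW.
  rewrite ler_wpM2l ?mulr_ge0// ?(ltW s0)// lef_pV2 ?posrE ?exprn_gt0//.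
    by rewrite lerDl sqr_ge0.
  by rewrite ltr_pwDl ?exprn_gt0 ?sqr_ge0.
rewrite (@Rintegral_affine _ (s / (2 * pi)) 0)//.
rewrite -RintegralZl//; last exact: (integrable_affine 0 a0 intQ).
apply: eq_Rintegral => t _; rewrite addr0 ger0_norm; last first.
  by rewrite divr_ge0 ?mulr_ge0// ?pi_ge0// ltW.
have dt : 1 + t ^+ 2 != 0 by rewrite gt_eqF// ltr_pwDl// sqr_ge0.
move: (pi : R) pi0 => q q0 {den intQ}.
have -> : s ^+ 2 + (2 * q * (s / (2 * q) * t)) ^+ 2 = s ^+ 2 * (1 + t ^+ 2).
  by field.
by field; rewrite s1 dt q0.
Qed.

(** Abel summation of the inversion integral at the origin: damping the
    transform by [exp (- s |w|)] amounts to averaging [A] against a Poisson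
    kernel of width [s], which concentrates at [0] as [s] tends to [0]. *)
Lemma abel_inversion0 A (M : R) : mu.-integrable setT (EFin \o A) ->
  (forall x, `|A x| <= M) -> {for 0, continuous A} ->
  \int[mu]_w (cosT A w * expR (- n.+1%:R^-1 * `|w|)) @[n --> \oo] --> A 0.
Proof.
move=> intA AM cA; have /measurable_EFinP mA := measurable_int _ intA.
have pi0 : 0 < pi :> R by exact: pi_gt0.
pose p (t : R) : R := pi^-1 * (1 + t ^+ 2)^-1.
have p0 t : 0 <= p t.
  apply: mulr_ge0; first by rewrite invr_ge0 ltW.
  by rewrite invr_ge0 addr_ge0// sqr_ge0.
have intp : mu.-integrable setT (EFin \o p) := integrableMl _ integrable_oneDsqrV.
have /measurable_EFinP mp := measurable_int _ intp.
have -> : A 0 = \int[mu]_t (A 0 * p t).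
  rewrite RintegralZl// RintegralZl//; last exact: integrable_oneDsqrV.
  rewrite [X in _ * (_ * X)](_ : _ = pi); first by rewrite mulVf ?mulr1// gt_eqF.
  by rewrite /Rintegral integralT_oneDsqrV.
under eq_fun do rewrite damped_inversion_integral//.
apply: (@Rdominated_convergence _ (fun n t => A (n.+1%:R^-1 / (2 * pi) * t) * p t) _
  (fun t => M * p t) _ _ _ _ _).2.
- move=> n; apply: measurable_funM => //.
  have ml : measurable_fun setT (fun t : R => n.+1%:R^-1 / (2 * pi) * t).
    exact: measurable_funM.
  exact: (measurableT_comp mA ml).
- exact: measurable_funM.
- exact: integrableMl.
- apply: aeW => t; apply: cvgM; last exact: cvg_cst.
  have st0 : (n.+1%:R^-1 / (2 * pi) * t) @[n --> \oo] --> (0 / (2 * pi) * t : R).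
    apply: cvgM; last exact: cvg_cst.
    by apply: cvgM; [exact: cvg_harmonic|exact: cvg_cst].
  rewrite !mul0r in st0.
  exact: (cvg_comp _ _ st0 cA).
- by move=> n t; rewrite normrM (ger0_norm (p0 t)) ler_wpM2r.
Qed.

Lemma normr_cosT_le A w : mu.-integrable setT (EFin \o A) ->
  `|cosT A w| <= \int[mu]_x `|A x|.
Proof.
move=> intA; apply: (le_trans (le_normr_Rintegral _ (integrable_cosT w intA))) => //.
apply: le_Rintegral => //.
- exact: integrable_normr (integrable_cosT w intA).
- exact: integrable_normr.
- by move=> x _; rewrite normrM ler_piMr// normr_cos_le1.
Qed.

Lemma continuous_cosT A : mu.-integrable setT (EFin \o A) -> continuous (cosT A).
Proof.
move=> intA w; have /measurable_EFinP mA := measurable_int _ intA.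
apply/(@cvg_nbhsP _ R^o) => x_ x_x.
apply: (@Rdominated_convergence _ (fun n t => A t * cos (2 * pi * x_ n * t)) _
  (fun t => `|A t|) _ _ _ _ _).2.
- by move=> n; apply: measurable_funM => //; exact: measurable_coswave.
- by apply: measurable_funM => //; exact: measurable_coswave.
- exact: integrable_normr.
- apply: aeW => t; apply: cvgM; first exact: cvg_cst.
  have cx : (2 * pi * x_ n * t) @[n --> \oo] --> (2 * pi * w * t).
    by apply: cvgM; [apply: cvgM => //; exact: cvg_cst|exact: cvg_cst].
  exact: (cvg_comp _ _ cx (@continuous_cos _ _)).
- by move=> n t; rewrite normrM ler_piMr// normr_cos_le1.
Qed.

End abel_summation.

(** * Plancherel's inequality, and inversion for even functions *)

Section plancherel_inversion.
Context {R : realType}.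
Local Notation mu := (@lebesgue_measure R).
Implicit Types (f g h : R -> R) (c w x : R).

Lemma cosTD f g w : mu.-integrable setT (EFin \o f) ->
  mu.-integrable setT (EFin \o g) ->
  cosT (fun x => f x + g x) w = cosT f w + cosT g w.
Proof.
move=> intf intg; rewrite /cosT -RintegralD ?integrable_cosT//.
by apply: eq_Rintegral => x _; rewrite mulrDl.
Qed.

Lemma sinTD f g w : mu.-integrable setT (EFin \o f) ->
  mu.-integrable setT (EFin \o g) ->
  sinT (fun x => f x + g x) w = sinT f w + sinT g w.
Proof.
move=> intf intg; rewrite /sinT -RintegralD ?integrable_sinT//.
by apply: eq_Rintegral => x _; rewrite mulrDl.
Qed.

Lemma cosTZ c f w : mu.-integrable setT (EFin \o f) ->
  cosT (fun x => c * f x) w = c * cosT f w.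
Proof.
move=> intf; rewrite /cosT -RintegralZl ?integrable_cosT//.
by apply: eq_Rintegral => x _; rewrite mulrA.
Qed.

Lemma sinTZ c f w : mu.-integrable setT (EFin \o f) ->
  sinT (fun x => c * f x) w = c * sinT f w.
Proof.
move=> intf; rewrite /sinT -RintegralZl ?integrable_sinT//.
by apply: eq_Rintegral => x _; rewrite mulrA.
Qed.

Lemma integrable_shift c f : mu.-integrable setT (EFin \o f) ->
  mu.-integrable setT (EFin \o (fun x => f (x + c))).
Proof.
move=> intf; have := integrable_affine c (oner_neq0 R) intf.
by apply: eq_integrable => // x _ /=; rewrite mul1r.
Qed.

Lemma cosT_shift c f w : mu.-integrable setT (EFin \o f) ->
  cosT (fun x => f (x + c)) w =
  cos (2 * pi * w * c) * cosT f w + sin (2 * pi * w * c) * sinT f w.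
Proof.
move=> intf; rewrite {1}/cosT -(Rintegral_shift (- c)); last first.
  exact/integrable_cosT/integrable_shift.
rewrite /cosT /sinT -!RintegralZl ?integrable_cosT ?integrable_sinT//.
rewrite -RintegralD//; last 2 first.
- exact/integrableMl/integrable_cosT.
- exact/integrableMl/integrable_sinT.
by apply: eq_Rintegral => x _; rewrite subrK mulrBr cosB; ring.
Qed.

Lemma sinT_shift c f w : mu.-integrable setT (EFin \o f) ->
  sinT (fun x => f (x + c)) w =
  cos (2 * pi * w * c) * sinT f w - sin (2 * pi * w * c) * cosT f w.
Proof.
move=> intf; rewrite {1}/sinT -(Rintegral_shift (- c)); last first.
  exact/integrable_sinT/integrable_shift.
rewrite /cosT /sinT -!RintegralZl ?integrable_cosT ?integrable_sinT//.
rewrite -RintegralB//; last 2 first.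
- exact/integrableMl/integrable_sinT.
- exact/integrableMl/integrable_cosT.
by apply: eq_Rintegral => x _; rewrite subrK mulrBr sinB; ring.
Qed.

Lemma integrable_opp f : mu.-integrable setT (EFin \o f) ->
  mu.-integrable setT (EFin \o (fun x => f (- x))).
Proof.
move=> intf; have N1 : (-1 : R) != 0 by rewrite oppr_eq0.
have := integrable_affine 0 N1 intf.
by apply: eq_integrable => // x _ /=; rewrite mulN1r addr0.
Qed.

Lemma cosT_opp f w : mu.-integrable setT (EFin \o f) ->
  cosT (fun x => f (- x)) w = cosT f w.
Proof.
move=> intf; rewrite /cosT -(Rintegral_reflect 0); last first.
  exact/integrable_cosT/integrable_opp.
by apply: eq_Rintegral => x _; rewrite sub0r opprK mulrN cosN.
Qed.

Lemma sinT_opp f w : mu.-integrable setT (EFin \o f) ->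
  sinT (fun x => f (- x)) w = - sinT f w.
Proof.
move=> intf; rewrite /sinT -(Rintegral_reflect 0); last first.
  exact/integrable_sinT/integrable_opp.
rewrite -mulN1r -RintegralZl ?integrable_sinT//.
by apply: eq_Rintegral => x _; rewrite sub0r opprK mulrN sinN mulN1r mulrN.
Qed.

Lemma sinT_even f w : mu.-integrable setT (EFin \o f) ->
  (forall x, f (- x) = f x) -> sinT f w = 0.
Proof.
move=> intf fN; have := sinT_opp w intf.
rewrite (_ : (fun x => f (- x)) = f); last exact/funext.
by move=> ?; lra.
Qed.

(** Plancherel as an inequality. The power spectrum of [h] is the transform of
    its autocorrelation, whose value at the origin is the energy of [h]; Abel
    summation recovers that value from damped, hence smaller, spectral
    integrals. *)
Lemma energy_le_spectrum h (M : R) : mu.-integrable setT (EFin \o h) ->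
  (forall x, `|h x| <= M) -> continuous h ->
  (\int[mu]_x (h x ^+ 2)%:E <= \int[mu]_w (cosT h w ^+ 2 + sinT h w ^+ 2)%:E)%E.
Proof.
move=> inth hM ch; pose r x := h (- x).
have intr : mu.-integrable setT (EFin \o r) by exact: integrable_opp.
have rM x : `|r x| <= M by exact: hM.
have mr : measurable_fun setT r by apply/measurable_EFinP; exact: (measurable_int _ intr).
have cr x : {for x, continuous r}.
  by apply: continuous_comp; [exact: opp_continuous|exact: ch].
pose A := convolution h r.
have intA : mu.-integrable setT (EFin \o A) := integrable_convolution inth mr rM intr.
have AM x : `|A x| <= M * \int[mu]_y `|h y| := normr_convolution_le inth mr rM x.
have cA : continuous A.
  exact: (continuous_convolution inth mr rM (countable0 _) (fun x _ => cr x)).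
have CA w : cosT A w = cosT h w ^+ 2 + sinT h w ^+ 2.
  rewrite (cosT_convolution inth mr rM intr) cosT_opp// sinT_opp//.
  by ring.
have h2 : mu.-integrable setT (EFin \o (fun x => h x * h x)).
  apply: (@integrable_mulr_bounded _ _ _ M) => //.
  by apply/measurable_EFinP; exact: (measurable_int _ inth).
have A0 : (\int[mu]_x (h x ^+ 2)%:E = (A 0)%:E)%E.
  rewrite -[LHS]fineK; last exact: (integrable_fin_num measurableT h2).
  congr EFin; rewrite -[LHS]/(Rintegral mu setT (fun x => h x ^+ 2)).
  rewrite -(Rintegral_reflect 0 h2).
  by apply: eq_Rintegral => x _; rewrite /r sub0r.
rewrite A0.
have lim := abel_inversion0 intA AM (cA 0).
have C0 w : 0 <= cosT A w by rewrite CA addr_ge0// sqr_ge0.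
have mCA : measurable_fun setT (cosT A).
  by apply: continuous_measurable_fun; exact: continuous_cosT.
have le n : ((\int[mu]_w (cosT A w * expR (- n.+1%:R^-1 * `|w|)))%:E
    <= \int[mu]_w (cosT h w ^+ 2 + sinT h w ^+ 2)%:E)%E.
  have intE : mu.-integrable setT (EFin \o (fun w => cosT A w * expR (- n.+1%:R^-1 * `|w|))).
    have n0 : 0 < n.+1%:R^-1 :> R by rewrite invr_gt0.
    have := @integrable_mulr_bounded _ _ _ _ (integrable_exp_abs n0) mCA
      (fun w => normr_cosT_le w intA).
    by apply: eq_integrable => // w _ /=; rewrite mulrC.
  rewrite fineK; last exact: (integrable_fin_num measurableT intE).
  apply: ge0_le_integral => //.
  - by move=> w _; rewrite lee_fin mulr_ge0// expR_ge0.
  - by apply/measurable_EFinP; apply: measurable_funM => //; exact: measurable_exp_abs.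
  - by apply/measurable_EFinP; apply: (eq_measurable_fun (cosT A)) => // w _; rewrite CA.
  - move=> w _; rewrite lee_fin -CA; apply: ler_piMr; first exact: C0.
    by rewrite -expR0 ler_expR mulNr oppr_le0 mulr_ge0.
case: (\int[mu]_w _)%E le => [b| |] le; [|by rewrite leey|by have := le 0%N].
rewrite lee_fin; apply: (ler_cvg_to lim (cvg_cst b)).
by apply: nearW => n; rewrite -lee_fin.
Qed.

(** Abel summation at [x] is Abel summation at the origin for the translate
    [f (. + x)]; as [f] is even, translating only multiplies its cosine
    transform by a cosine. *)
Lemma cosT_inversion f (M : R) x : mu.-integrable setT (EFin \o f) ->
  (forall x, `|f x| <= M) -> continuous f -> (forall x, f (- x) = f x) ->
  mu.-integrable setT (EFin \o cosT f) -> cosT (cosT f) x = f x.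
Proof.
move=> intf fM cf fN intk; pose A z := f (z + x).
have intA : mu.-integrable setT (EFin \o A) by exact: integrable_shift.
have AM z : `|A z| <= M by exact: fM.
have cA : {for 0, continuous A}.
  apply: continuous_comp; last exact: cf.
  by apply: continuousD; [exact: id|exact: cst_continuous].
have := abel_inversion0 intA AM cA; rewrite /A add0r => lim1.
have /measurable_EFinP mk := measurable_int _ intk.
have lim2 : \int[mu]_w (cosT f w * cos (2 * pi * x * w) * expR (- n.+1%:R^-1 * `|w|))
    @[n --> \oo] --> cosT (cosT f) x.
  apply: (@Rdominated_convergence _
    (fun n w => cosT f w * cos (2 * pi * x * w) * expR (- n.+1%:R^-1 * `|w|)) _
    (fun w => `|cosT f w|) _ _ _ _ _).2.
  - move=> n; apply: measurable_funM; last exact: measurable_exp_abs.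
    by apply: measurable_funM => //; exact: measurable_coswave.
  - by apply: measurable_funM => //; exact: measurable_coswave.
  - exact: integrable_normr.
  - apply: aeW => w; rewrite -[X in _ --> X]mulr1; apply: cvgM; first exact: cvg_cst.
    have e0 : (- n.+1%:R^-1 * `|w|) @[n --> \oo] --> (- 0 * `|w| : R).
      apply: cvgM; last exact: cvg_cst.
      by apply: cvgN; exact: cvg_harmonic.
    rewrite oppr0 mul0r in e0.
    have e1 := cvg_comp _ _ e0 (@continuous_expR R 0).
    by rewrite expR0 in e1.
  - move=> n w; rewrite !normrM -mulrA ler_piMr// mulr_ile1// ?normr_cos_le1//.
    by rewrite ger0_norm ?expR_ge0// -expR0 ler_expR mulNr oppr_le0 mulr_ge0.
apply: (@cvg_unique _ (@Rhausdorff R) _ _ _ _ lim2).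
rewrite (_ : (fun n => _) = (fun n => \int[mu]_w (cosT (fun z => f (z + x)) w * expR (- n.+1%:R^-1 * `|w|))))//.
apply/funext => n; apply: eq_Rintegral => w _; congr (_ * _).
rewrite cosT_shift// (sinT_even _ intf fN) mulr0 addr0 mulrC.
by rewrite (mulrAC _ x w).
Qed.

End plancherel_inversion.

(** * Transforms of intervals *)

Section interval_transforms.
Context {R : realType}.
Local Notation mu := (@lebesgue_measure R).
Implicit Types (f g : R -> R) (p q r w x : R).

Lemma Rintegral_indicM (A : set R) g :
  \int[mu]_x (\1_A x * g x) = \int[mu]_(x in A) g x.
Proof.
rewrite [RHS]Rintegral_mkcond; apply: eq_Rintegral => x _.
by rewrite patchE indicE; case: (x \in A); rewrite ?mul1r ?mul0r.
Qed.

Lemma integrable_indic_itv (i : interval R) p q : [set` i] `<=` `[p, q] ->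
  mu.-integrable setT (EFin \o \1_[set` i]).
Proof.
move=> ipq; apply: ge0_integrable => //.
rewrite integral_indic// setIT.
apply: (@le_lt_trans _ _ (mu `[p, q])).
  by apply: le_measure => //; rewrite inE; exact: measurable_itv.
by rewrite lebesgue_measure_itv/=; case: ifPn => // _; rewrite -EFinB ltry.
Qed.

Lemma normr_indic_le1 (A : set R) x : `|\1_A x| <= 1 :> R.
Proof. by rewrite indicE; case: (x \in A); rewrite ?normr1 ?normr0. Qed.

Lemma integrable_indicM (A : set R) f : measurable A ->
  mu.-integrable setT (EFin \o f) ->
  mu.-integrable setT (EFin \o (fun x => \1_A x * f x)).
Proof.
move=> mA intf.
have mI : measurable_fun setT (\1_A : R -> R) by exact: measurable_indic.
have := @integrable_mulr_bounded _ _ _ 1 intf mI (@normr_indic_le1 A).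
by apply: eq_integrable => // x _ /=; rewrite mulrC.
Qed.

Lemma Rintegral_cos_itv p q b : p <= q -> b != 0 ->
  \int[mu]_(x in `[p, q]) cos (b * x) = (sin (b * q) - sin (b * p)) / b.
Proof.
rewrite le_eqVlt => /predU1P[<- _|pq b0].
  by rewrite set_itv1 Rintegral_set1 subrr mul0r.
rewrite /Rintegral (_ : integral _ _ _ = (sin (b * q) / b - sin (b * p) / b)%:E).
  by rewrite /= mulrBl.
apply: (@FTC2_is_derive _ (fun x => cos (b * x)) (fun x => sin (b * x) / b)) => //.
- move=> x _; apply: (@is_derive_continuous _ _ _ (- sin (b * x) * b)).
  by apply: trigger_derive; rewrite /GRing.scale/=; ring.
- move=> x _; apply: trigger_derive; rewrite /GRing.scale/=.
  by field.
Qed.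

Lemma Rintegral_sin_itv p q b : p <= q -> b != 0 ->
  \int[mu]_(x in `[p, q]) sin (b * x) = (cos (b * p) - cos (b * q)) / b.
Proof.
rewrite le_eqVlt => /predU1P[<- _|pq b0].
  by rewrite set_itv1 Rintegral_set1 subrr mul0r.
rewrite /Rintegral (_ : integral _ _ _ = (- cos (b * q) / b - (- cos (b * p) / b))%:E).
  by rewrite /=; ring.
apply: (@FTC2_is_derive _ (fun x => sin (b * x)) (fun x => - cos (b * x) / b)) => //.
- move=> x _; apply: (@is_derive_continuous _ _ _ (cos (b * x) * b)).
  by apply: trigger_derive; rewrite /GRing.scale/=; ring.
- move=> x _; apply: trigger_derive; rewrite /GRing.scale/=.
  by field.
Qed.

Lemma Rintegral_itv1 p q : p <= q -> \int[mu]_(x in `[p, q]) 1 = q - p.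
Proof.
move=> pq; rewrite Rintegral_cst//= mul1r lebesgue_measure_itv/= lte_fin.
by move: pq; rewrite le_eqVlt => /predU1P[->|->] //; rewrite ltxx subrr.
Qed.

Lemma Rintegral_indic_itv p q : p <= q -> \int[mu]_x \1_`[p, q] x = q - p.
Proof.
move=> pq; rewrite -Rintegral_itv1// -(Rintegral_indicM `[p, q]%classic (cst 1)).
by apply: eq_Rintegral => x _; rewrite mulr1.
Qed.

Lemma integrable_indic_cc p q : mu.-integrable setT (EFin \o \1_`[p, q]).
Proof. exact: (@integrable_indic_itv _ p q). Qed.

Lemma normr_sinT_le f w : mu.-integrable setT (EFin \o f) ->
  `|sinT f w| <= \int[mu]_x `|f x|.
Proof.
move=> intA; apply: (le_trans (le_normr_Rintegral _ (integrable_sinT w intA))) => //.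
apply: le_Rintegral => //.
- exact: integrable_normr (integrable_sinT w intA).
- exact: integrable_normr.
- by move=> x _; rewrite normrM ler_piMr// normr_sin_le1.
Qed.

Definition box r : R -> R := \1_`[- r, r].

Lemma integrable_box r : mu.-integrable setT (EFin \o box r).
Proof. exact: integrable_indic_cc. Qed.

Lemma measurable_box r : measurable_fun setT (box r).
Proof. by apply: measurable_indic; exact: measurable_itv. Qed.

Lemma box_even r x : box r (- x) = box r x.
Proof.
rewrite /box !indicE; congr ((_ : bool)%:R); apply/idP/idP;
  by rewrite !inE/= !in_itv/= => /andP[? ?]; apply/andP; split; lra.
Qed.

Lemma normr_cosT_box_le r w : 0 <= r -> `|cosT (box r) w| <= 2 * r.
Proof.
move=> r0; apply: (le_trans (normr_cosT_le w (integrable_box r))).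
rewrite (_ : 2 * r = r - - r); last by ring.
rewrite -Rintegral_indic_itv; last by lra.
rewrite le_eqVlt; apply/orP; left; apply/eqP; apply: eq_Rintegral => x _.
by rewrite /box ger0_norm// indicE.
Qed.

Lemma normr_cosT_box_decay r w : 0 <= r -> `|cosT (box r) w| * (pi * `|w|) <= 1.
Proof.
move=> r0; have [->|w0] := eqVneq w 0; first by rewrite normr0 !mulr0.
have p0 : pi != 0 :> R by rewrite gt_eqF// pi_gt0.
have b0 : 2 * pi * w != 0 by rewrite !mulf_neq0.
have pq : - r <= r by lra.
rewrite /cosT Rintegral_indicM Rintegral_cos_itv// mulrN sinN opprK.
rewrite -[X in X * `|w|](ger0_norm (pi_ge0 R)) -!normrM.
rewrite (_ : _ * (pi * w) = sin (2 * pi * w * r)); first exact: normr_sin_le1.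
by move: (sin _) => S; move: (pi : R) p0 b0 => P P0 B0; field; rewrite w0.
Qed.

Definition step r : R -> R := \1_`[0, r[.

Lemma integrable_step r : mu.-integrable setT (EFin \o step r).
Proof.
apply: (@integrable_indic_itv _ 0 r) => x /=; rewrite !in_itv/= => /andP[-> /ltW].
by [].
Qed.

Lemma measurable_step r : measurable_fun setT (step r).
Proof. by apply: measurable_indic; exact: measurable_itv. Qed.

Lemma Rintegral_step r g : measurable_fun setT g ->
  \int[mu]_x (step r x * g x) = \int[mu]_(x in `[0, r]) g x.
Proof.
move=> mg; rewrite Rintegral_indicM /Rintegral integral_itv_bndo_bndc//.
by apply/measurable_EFinP; exact: measurable_funTS.
Qed.

Lemma step_transform_le r w : 0 <= r ->
  cosT (step r) w ^+ 2 + sinT (step r) w ^+ 2 <= 2 * r ^+ 2.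
Proof.
move=> r0.
have int1 : \int[mu]_x `|step r x| = r.
  transitivity (\int[mu]_x (step r x * 1)).
    by apply: eq_Rintegral => x _; rewrite mulr1 ger0_norm// /step indicE.
  by rewrite Rintegral_step// Rintegral_itv1// subr0.
have c := normr_cosT_le w (integrable_step r).
have s := normr_sinT_le w (integrable_step r).
rewrite -(real_normK (num_real (cosT _ _))) -(real_normK (num_real (sinT _ _))).
rewrite int1 in c s; rewrite mulr_natl mulr2n.
by rewrite lerD// lerXn2r// nnegrE.
Qed.

Lemma step_transformE r w : 0 <= r ->
  (cosT (step r) w ^+ 2 + sinT (step r) w ^+ 2) * (2 * pi * w) ^+ 2 =
  2 * (1 - cos (2 * pi * w * r)).
Proof.
move=> r0; have [->|w0] := eqVneq w 0.
  by rewrite !mulr0 mul0r cos0 subrr mulr0 expr0n mulr0.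
have p0 : pi != 0 :> R by rewrite gt_eqF// pi_gt0.
have b0 : 2 * pi * w != 0 by rewrite !mulf_neq0.
rewrite /cosT /sinT Rintegral_step; last exact: measurable_coswave.
rewrite Rintegral_step; last exact: measurable_sinwave.
rewrite Rintegral_cos_itv// Rintegral_sin_itv// !mulr0 sin0 cos0 subr0.
have := cos2Dsin2 (2 * pi * w * r).
move: (sin _) (cos _) => S C CS; move: (2 * pi * w) b0 => B B0.
rewrite (_ : _ * _ = S ^+ 2 + (1 - C) ^+ 2); last by field.
by move: CS; nra.
Qed.

Lemma step_transform_decay r w : 0 <= r ->
  (cosT (step r) w ^+ 2 + sinT (step r) w ^+ 2) * (pi * w) ^+ 2 <= 1.
Proof.
move=> r0; have := step_transformE w r0; have := cos_geN1 (2 * pi * w * r).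
rewrite -mulrA exprMn; nra.
Qed.

(** Up to the factor [(2 pi w)^2 / 2] the left-hand side is the power spectrum of
    the interval, which its length bounds. *)
Lemma one_sub_cos_le r w : 0 <= r ->
  1 - cos (2 * pi * w * r) <= (2 * pi * w * r) ^+ 2.
Proof.
move=> r0; have := step_transform_le w r0; have := step_transformE w r0.
rewrite (exprMn _ (2 * pi * w)) => AB AD.
have {AD} := ler_wpM2r (sqr_ge0 (2 * pi * w)) AD; rewrite AB.
by move: ((2 * pi * w) ^+ 2) (cos _) (r ^+ 2) => B C D; lra.
Qed.

End interval_transforms.

(** * A band-limited kernel *)

Section band_limited_kernel.
Context {R : realType}.
Local Notation mu := (@lebesgue_measure R).
Implicit Types (w x y : R).

(** As a convolution of two boxes this is 1 on [-N, N] and 0 beyond [2 N]. Unlike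
    the transform of a sharp cut-off, its transform is a product of two box
    transforms, hence integrable. *)
Definition trapezoid (N w : R) : R :=
  N^-1 * convolution (box (3 / 2 * N)) (box (N / 2)) w.

(** The kernel of de la Vallee-Poussin. *)
Definition vkernel (N x : R) : R := cosT (trapezoid N) x.

Variable N : R.
Hypothesis N0 : 0 < N.

Let box1 r x : `|box r x| <= 1 := normr_indic_le1 _ x.

Let intconv : mu.-integrable setT (EFin \o convolution (box (3 / 2 * N)) (box (N / 2))).
Proof.
exact: (integrable_convolution (integrable_box _) (measurable_box _) (box1 _)
  (integrable_box _)).
Qed.

Let intsl w : mu.-integrable setT
  (EFin \o (fun y => box (3 / 2 * N) (w - y) * box (N / 2) y)).
Proof.
exact: (integrable_convolution_slice (integrable_box _) (measurable_box _) (box1 _)).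
Qed.

Let box_ge0 r x : 0 <= box r x.
Proof. by rewrite /box indicE. Qed.

Let int_box : \int[mu]_y box (N / 2) y = N.
Proof. by rewrite Rintegral_indic_itv; [field|move: N0; lra]. Qed.

Lemma integrable_trapezoid : mu.-integrable setT (EFin \o trapezoid N).
Proof. exact: integrableMl. Qed.

Lemma trapezoid_ge0 w : 0 <= trapezoid N w.
Proof.
rewrite mulr_ge0 ?invr_ge0 ?(ltW N0)//.
by apply: Rintegral_ge0 => y _; rewrite mulr_ge0.
Qed.

Lemma trapezoid_le1 w : trapezoid N w <= 1.
Proof.
rewrite ler_pdivrMl// mulr1 -[leRHS]int_box.
apply: le_Rintegral => //; first exact: integrable_box.
by move=> y _; rewrite ler_piMl// (le_trans (ler_norm _)).
Qed.

Lemma trapezoid_eq1 w : `|w| <= N -> trapezoid N w = 1.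
Proof.
move=> wN; rewrite /trapezoid (_ : convolution _ _ _ = N) ?mulVf ?gt_eqF//.
rewrite -[RHS]int_box; apply: eq_Rintegral => y _.
rewrite /box !indicE; case: (boolP (y \in `[_, _]%classic)); last by rewrite mulr0.
rewrite inE/= in_itv/= => /andP[y1 y2].
move: wN; rewrite ler_norml => /andP[w1 w2].
by rewrite mem_set ?mulr1//= in_itv/=; apply/andP; split; lra.
Qed.

Lemma trapezoid_eq0 w : 2 * N < `|w| -> trapezoid N w = 0.
Proof.
move=> wN; rewrite /trapezoid (_ : convolution _ _ _ = 0) ?mulr0//.
rewrite /convolution (_ : Rintegral _ _ _ = \int[mu]_y (0 * box (N / 2) y)).
  by rewrite RintegralZl ?mul0r//; exact: integrable_box.
apply: eq_Rintegral => y _; rewrite mul0r.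
rewrite /box !indicE; case: (boolP (y \in `[_, _]%classic)); last by rewrite mulr0.
rewrite inE/= in_itv/= => /andP[y1 y2].
rewrite memNset ?mul0r//= in_itv/= => /andP[w1 w2].
move: wN; rewrite ltNge => /negP; apply.
by rewrite ler_norml; apply/andP; split; lra.
Qed.

Lemma trapezoid_even w : trapezoid N (- w) = trapezoid N w.
Proof.
congr (_ * _); rewrite /convolution -(Rintegral_reflect 0)//.
apply: eq_Rintegral => y _; rewrite sub0r box_even.
by rewrite -[in LHS]box_even !opprD !opprK.
Qed.

Lemma normr_trapezoid_le1 w : `|trapezoid N w| <= 1.
Proof. by rewrite ger0_norm ?trapezoid_le1// trapezoid_ge0. Qed.

Lemma continuous_trapezoid : continuous (trapezoid N).
Proof.
move=> w; apply: cvgM; first exact: cvg_cst.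
apply: (continuous_convolution (integrable_box _) (measurable_box _) (box1 _)
  (D := [set (- (N / 2)); N / 2])).
  by apply: finite_set_countable; exact: finite_set2.
move=> x xD.
have [x1|x1] := ltP x (- (N / 2)).
  apply: (@near_cst_continuous _ _ 0); near=> y.
  rewrite /box indicE memNset//= in_itv/= => /andP[y1 y2].
  have : y < - (N / 2) by near: y; exact: lt_nbhsl.
  by lra.
have [x2|x2] := ltP (N / 2) x.
  apply: (@near_cst_continuous _ _ 0); near=> y.
  rewrite /box indicE memNset//= in_itv/= => /andP[y1 y2].
  have : N / 2 < y by near: y; exact: lt_nbhsr.
  by lra.
have {}x1 : - (N / 2) < x.
  by rewrite lt_neqAle x1 andbT; apply/eqP => xE; apply: xD; left.
have {}x2 : x < N / 2.
  by rewrite lt_neqAle x2 andbT; apply/eqP => xE; apply: xD; right.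
apply: (@near_cst_continuous _ R (1 : R)); near=> y.
rewrite /box indicE mem_set//= in_itv/=; apply/andP; split; apply: ltW.
- by near: y; exact: lt_nbhsr.
- by near: y; exact: lt_nbhsl.
Unshelve. all: by end_near. Qed.

Let vkernelE x : vkernel N x = N^-1 * (cosT (box (3 / 2 * N)) x * cosT (box (N / 2)) x).
Proof.
rewrite /vkernel cosTZ// (cosT_convolution (integrable_box _) (measurable_box _) (box1 _)
  (integrable_box _)).
by rewrite (sinT_even x (integrable_box _) (@box_even _ _)) mul0r subr0.
Qed.

Definition vkernel_bound : R := 3 * N + (N * pi ^+ 2)^-1.

Lemma vkernel_bound_ge0 : 0 <= vkernel_bound.
Proof.
have N0' := ltW N0; apply: addr_ge0; first by rewrite mulr_ge0.
by rewrite invr_ge0 mulr_ge0// sqr_ge0.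
Qed.

(** Each of the two box transforms is bounded by its mass near the origin and by
    [1 / (pi |x|)] far from it. *)
Lemma normr_vkernel_le x : `|vkernel N x| <= vkernel_bound * (1 + x ^+ 2)^-1.
Proof.
rewrite ler_pdivlMr ?ltr_pwDl ?sqr_ge0// mulrDr mulr1 vkernelE.
have p0 : 0 < pi :> R := pi_gt0 R.
rewrite !normrM ger0_norm ?invr_ge0 ?(ltW N0)//.
have r1 : 0 <= 3 / 2 * N by move: N0; lra.
have r2 : 0 <= N / 2 by move: N0; lra.
have := normr_cosT_box_le x r1; have := normr_cosT_box_decay x r1.
have := normr_cosT_box_le x r2; have := normr_cosT_box_decay x r2.
have := normr_ge0 (cosT (box (3 / 2 * N)) x); have := normr_ge0 (cosT (box (N / 2)) x).
have := normr_ge0 x; rewrite -(real_normK (num_real x)).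
move: `|cosT _ _| `|cosT _ _| `|x| => B A X X0 B0 A0 B1 B2 A1 A2.
apply: lerD.
  rewrite ler_pdivrMl//; apply: (@le_trans _ _ (2 * (3 / 2 * N) * (2 * (N / 2)))).
    exact: ler_pM.
  by rewrite le_eqVlt; apply/orP; left; apply/eqP; field.
rewrite -mulrA invfM ler_wpM2l ?invr_ge0 ?(ltW N0)// -[leRHS]mul1r ler_pdivlMr ?exprn_gt0//.
rewrite (_ : _ * _ = (B * (pi * X)) * (A * (pi * X))); last by ring.
by rewrite -[leRHS]mulr1 ler_pM// mulr_ge0// mulr_ge0// ltW.
Qed.

Lemma continuous_vkernel : continuous (vkernel N).
Proof. exact: continuous_cosT integrable_trapezoid. Qed.

Lemma measurable_vkernel : measurable_fun setT (vkernel N).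
Proof. by apply: continuous_measurable_fun; exact: continuous_vkernel. Qed.

Lemma integrable_vkernel : mu.-integrable setT (EFin \o vkernel N).
Proof.
apply: (@le_integrable _ _ _ mu _ measurableT _
  (EFin \o (fun x => vkernel_bound * (1 + x ^+ 2)^-1))).
- by apply/measurable_EFinP; exact: measurable_vkernel.
- move=> x _ /=; rewrite lee_fin (le_trans (normr_vkernel_le x))//.
  exact: ler_norm.
- by apply: integrableMl; exact: integrable_oneDsqrV.
Qed.

Lemma normr_vkernel_le_cst x : `|vkernel N x| <= vkernel_bound.
Proof.
apply: (le_trans (normr_vkernel_le x)); rewrite ler_piMr ?vkernel_bound_ge0//.
by rewrite invf_le1 ?ltr_pwDl ?sqr_ge0// lerDl sqr_ge0.
Qed.

Lemma vkernel_even x : vkernel N (- x) = vkernel N x.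
Proof. by apply: eq_Rintegral => w _; rewrite mulrN mulNr cosN. Qed.

Lemma cosT_vkernel w : cosT (vkernel N) w = trapezoid N w.
Proof.
apply: (cosT_inversion w integrable_trapezoid normr_trapezoid_le1
  continuous_trapezoid trapezoid_even).
exact: integrable_vkernel.
Qed.

Lemma sinT_vkernel w : sinT (vkernel N) w = 0.
Proof. exact: sinT_even integrable_vkernel vkernel_even. Qed.

Lemma Rintegral_vkernel : \int[mu]_x vkernel N x = 1.
Proof.
rewrite -(@trapezoid_eq1 0) ?normr0 ?(ltW N0)// -cosT_vkernel.
by apply: eq_Rintegral => x _; rewrite mulr0 mul0r cos0 mulr1.
Qed.

End band_limited_kernel.

(** * The smoothed jump *)

Section power_tails.
Context {R : realType}.
Local Notation mu := (@lebesgue_measure R).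
Implicit Types (c s T x : R).

Lemma cvg_powR_pinfty s : 0 < s -> x `^ (- s) @[x --> +oo] --> (0 : R).
Proof.
move=> s0; apply/cvgrPdist_lt => e e0.
have s'0 : 0 < s^-1 by rewrite invr_gt0.
near=> x; have x0 : 0 < x by near: x; exact: nbhs_pinfty_gt.
rewrite sub0r normrN ger0_norm ?powR_ge0// powRN.
rewrite invf_plt ?posrE ?powR_gt0//.
have -> : e^-1 = ((e^-1) `^ s^-1) `^ s.
  by rewrite -powRrM mulVf ?gt_eqF// powRr1// invr_ge0 ltW.
have ex : (e^-1) `^ s^-1 < x by near: x; exact: nbhs_pinfty_gt.
by apply: gt0_ltr_powR; rewrite ?nnegrE ?powR_ge0// ltW.
Unshelve. all: by end_near. Qed.

Lemma integral_powR_tail s T : 0 < s -> 0 < T ->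
  (\int[mu]_(x in `[T, +oo[) (x `^ (- s - 1))%:E = (T `^ (- s) / s)%:E)%E.
Proof.
move=> s0 T0.
have x0 x : T <= x -> 0 < x by move=> Tx; exact: lt_le_trans Tx.
have d x : T <= x -> is_derive x 1 (fun y => - s^-1 * y `^ (- s)) (x `^ (- s - 1)).
  move=> /x0 xp; have h := is_derive1_powR (- s) xp.
  apply: (trigger_derive (is_deriveZ (- s^-1) h)); rewrite /GRing.scale/=.
  by move: (x `^ _) => y; field; rewrite gt_eqF.
have -> : T `^ (- s) / s = 0 - (- s^-1 * T `^ (- s)) by move: (T `^ _) => y; field; rewrite gt_eqF.
apply: ge0_FTC2y_is_derive d _.
- by move=> x _; exact: powR_ge0.
- by move=> x /x0 xp; exact: is_derive_continuous (is_derive1_powR _ xp).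
- rewrite -[X in _ --> X](mulr0 (- s^-1)); apply: cvgM; first exact: cvg_cst.
  exact: cvg_powR_pinfty.
Qed.

Lemma integral_inv_sqr c : 0 < c ->
  (\int[mu]_(x in `[c, +oo[) (x ^- 2)%:E = (c^-1)%:E)%E.
Proof.
move=> c0; have := integral_powR_tail ltr01 c0.
rewrite divr1 (powRN c 1) powRr1 ?(ltW c0)// => <-.
apply: eq_integral => x; rewrite inE/= in_itv/= andbT => cx.
have -> : - 1 - 1 = - 2%:R :> R by ring.
by rewrite powRN powR_mulrn// (le_trans (ltW c0)).
Qed.

End power_tails.

Section smoothed_jump.
Context {R : realType}.
Local Notation mu := (@lebesgue_measure R).
Implicit Types (c r w x y : R).

Definition vprimitive (N x : R) : R := \int[mu]_(t in `]-oo, x]) vkernel N t.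

Variable N : R.
Hypothesis N0 : 0 < N.

Let intV := integrable_vkernel N0.

Let intVS (A : set R) : measurable A -> mu.-integrable A (EFin \o vkernel N).
Proof. by move=> mA; exact: integrableS intV. Qed.

Lemma is_derive_vprimitive x : is_derive x 1 (vprimitive N) (vkernel N x).
Proof.
have x1 : x < x + 1 by rewrite ltrDl.
have [|||dF F'] := @continuous_FTC1 R (vkernel N) -oo%O x (x + 1) x1.
- by apply: intVS; exact: measurable_itv.
- by rewrite ltNyr.
- exact: continuous_vkernel.
by apply: DeriveDef => //; rewrite -derive1E.
Qed.

(** This identity makes the gap between the two signals a convolution, whose
    transform is then explicit. *)
Lemma vprimitiveB r x : 0 <= r ->
  vprimitive N x - vprimitive N (x - r) = convolution (vkernel N) (step r) x.
Proof.
move=> r0; rewrite /vprimitive Rintegral_itvB; last 3 first.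
- by apply: intVS; exact: measurable_itv.
- by [].
- by rewrite bnd_simp; lra.
rewrite -(Rintegral_indicM `]x - r, x]%classic).
rewrite /convolution -(@Rintegral_reflect _ x (fun y => vkernel N (x - y) * step r y)); last first.
  apply: (@integrable_convolution_slice _ _ _ 1) => //.
  - exact: measurable_step.
  - by move=> y; exact: normr_indic_le1.
apply: eq_Rintegral => t _; rewrite opprB addrCA subrr addr0 mulrC; congr (_ * _).
rewrite /step !indicE; congr ((_ : bool)%:R); apply/idP/idP;
  by rewrite !inE/= !in_itv/= => /andP[? ?]; apply/andP; split; lra.
Qed.

(** A unit jump is not square integrable; subtracting a smooth step with the
    same limits makes it so. *)
Definition jump_profile x : R := \1_`[0, +oo[ x - vprimitive N x.

Let tail_bound (A : set R) : measurable A ->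
  `|\int[mu]_(t in A) vkernel N t|
   <= vkernel_bound N * \int[mu]_(t in A) (1 + t ^+ 2)^-1.
Proof.
move=> mA.
have intq : mu.-integrable A (EFin \o (fun t : R => (1 + t ^+ 2)^-1)).
  by apply: integrableS integrable_oneDsqrV.
rewrite -RintegralZl//.
apply: (le_trans (le_normr_Rintegral _ (intVS mA))) => //.
apply: le_Rintegral => //.
- by apply: integrableS (integrable_normr intV).
- by apply: integrableS (integrableMl (vkernel_bound N) integrable_oneDsqrV).
- by move=> t _; exact: normr_vkernel_le.
Qed.

(** The kernel having total mass one, only a tail of it is left on either side
    of the jump. *)
Let normr_jump_profile x :
  `|jump_profile x| <= vkernel_bound N * \int[mu]_(t in `[`|x|, +oo[) (1 + t ^+ 2)^-1.
Proof.
rewrite /jump_profile /vprimitive indicE; have [x0|x0] := leP 0 x.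
  rewrite mem_set//=; last by rewrite in_itv/= x0.
  rewrite -[X in `|X - _|](Rintegral_vkernel N0) -[X in Rintegral mu X]set_itvNyy.
  rewrite Rintegral_itvB//; last by apply: intVS; exact: measurable_itv.
  rewrite Rintegral_itv_obnd_cbnd; last by apply: intVS; exact: measurable_itv.
  by rewrite (ger0_norm x0); apply: tail_bound; exact: measurable_itv.
rewrite memNset//=; last by rewrite in_itv/= andbT; apply/negP; rewrite -ltNge.
rewrite sub0r normrN (ltr0_norm x0) -(Rintegral_indicM `]-oo, x]%classic) -(Rintegral_reflect 0); last first.
  by apply: integrable_indicM => //; exact: measurable_itv.
rewrite (_ : Rintegral _ _ _ = \int[mu]_(t in `[- x, +oo[) vkernel N t).
  by apply: tail_bound; exact: measurable_itv.
rewrite -(Rintegral_indicM `[- x, +oo[%classic); apply: eq_Rintegral => t _.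
rewrite sub0r vkernel_even; congr (_ * _).
rewrite !indicE; congr ((_ : bool)%:R); apply/idP/idP;
  by rewrite !inE/= !in_itv/= ?andbT => ?; lra.
Qed.

Lemma normr_jump_profile_le x : `|jump_profile x| <= vkernel_bound N * pi.
Proof.
apply: (le_trans (normr_jump_profile x)); rewrite ler_wpM2l ?vkernel_bound_ge0//.
have -> : pi = \int[mu]_t (1 + t ^+ 2)^-1 :> R by rewrite /Rintegral integralT_oneDsqrV.
rewrite -(Rintegral_indicM `[`|x|, +oo[%classic); apply: le_Rintegral => //.
- by apply: integrable_indicM integrable_oneDsqrV; exact: measurable_itv.
- exact: integrable_oneDsqrV.
- by move=> t _; rewrite ler_piMl ?invr_ge0 ?addr_ge0 ?sqr_ge0.
Qed.

Lemma normr_jump_profile_decay x : `|jump_profile x| * `|x| <= vkernel_bound N.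
Proof.
have [->|x0] := eqVneq x 0; first by rewrite normr0 mulr0 vkernel_bound_ge0.
have {}x0 : 0 < `|x| by rewrite normr_gt0.
rewrite -ler_pdivlMr//; apply: (le_trans (normr_jump_profile x)).
rewrite ler_wpM2l ?vkernel_bound_ge0//.
have intq : mu.-integrable `[`|x|, +oo[ (EFin \o (fun t => (1 + t ^+ 2)^-1)).
  by apply: integrableS integrable_oneDsqrV => //; exact: measurable_itv.
rewrite -lee_fin fineK; last by apply: integrable_fin_num intq => //; exact: measurable_itv.
rewrite -integral_inv_sqr//; apply: ge0_le_integral => //.
- by move=> t _; rewrite lee_fin invr_ge0 addr_ge0// sqr_ge0.
- exact: (measurable_int _ intq).
- apply/measurable_EFinP.
  have m0 : measurable_fun (`]0, +oo[%classic : set R) (fun t : R => t ^- 2).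
    apply: open_continuous_measurable_fun; first exact: interval_open.
    move=> t; rewrite inE/= in_itv/= andbT => t0.
    by apply: cvgV; [rewrite expf_neq0// gt_eqF|exact: exprn_continuous].
  apply: measurable_funS m0 => //.
  by move=> t /=; rewrite !in_itv/= !andbT; exact: lt_le_trans.
- move=> t; rewrite /= in_itv/= andbT => xt.
  have t0 : 0 < t by exact: lt_le_trans xt.
  by rewrite lee_fin lef_pV2 ?posrE ?exprn_gt0// ?ltr_pwDl ?sqr_ge0// lerDr.
Qed.

Lemma measurable_jump_profile : measurable_fun setT jump_profile.
Proof.
apply: measurable_funB => //.
apply: continuous_measurable_fun => x.
exact: is_derive_continuous (is_derive_vprimitive x).
Qed.

Lemma integrable_sqr_jump_profile :
  mu.-integrable setT (EFin \o (fun x => jump_profile x ^+ 2)).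
Proof.
pose B := (vkernel_bound N * pi) ^+ 2 + vkernel_bound N ^+ 2.
apply: (@le_integrable _ _ _ mu _ measurableT _ (EFin \o (fun x => B * (1 + x ^+ 2)^-1))).
- by apply/measurable_EFinP; apply: measurable_funX; exact: measurable_jump_profile.
- move=> x _ /=; rewrite lee_fin normrX.
  apply: le_trans (ler_norm _).
  rewrite ler_pdivlMr ?ltr_pwDl ?sqr_ge0// mulrDr mulr1 /B.
  rewrite -[x ^+ 2]real_normK ?num_real// -exprMn.
  rewrite lerD// lerXn2r ?nnegrE ?mulr_ge0 ?vkernel_bound_ge0 ?pi_ge0//.
    exact: normr_jump_profile_le.
  exact: normr_jump_profile_decay.
- by apply: integrableMl; exact: integrable_oneDsqrV.
Qed.

End smoothed_jump.

(** * Membership in the change-point class *)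

Section jump_class.
Context {R : realType}.
Local Notation mu := (@lebesgue_measure R).
Implicit Types (f g : R -> R) (x w : R).

Lemma integrable_sqr_Lfun2 f : measurable_fun setT f ->
  mu.-integrable setT (EFin \o (fun x => f x ^+ 2)) -> f \in Lfun mu 2%:E.
Proof.
move=> mf intf2; rewrite inE; apply/andP; split; rewrite inE//=.
rewrite /finite_norm unlock /Lnorm poweR_lty//.
have [_] := integrableP _ _ _ intf2; apply: le_lt_trans.
rewrite le_eqVlt; apply/orP; left; apply/eqP; apply: eq_integral => x _ /=.
by rewrite powR_mulrn// normrX.
Qed.

Lemma continuous_sinT f : mu.-integrable setT (EFin \o f) -> continuous (sinT f).
Proof.
move=> intA w; have /measurable_EFinP mA := measurable_int _ intA.
apply/(@cvg_nbhsP _ R^o) => x_ x_x.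
apply: (@Rdominated_convergence _ (fun n t => f t * sin (2 * pi * x_ n * t)) _
  (fun t => `|f t|) _ _ _ _ _).2.
- by move=> n; apply: measurable_funM => //; exact: measurable_sinwave.
- by apply: measurable_funM => //; exact: measurable_sinwave.
- exact: integrable_normr.
- apply: aeW => t; apply: cvgM; first exact: cvg_cst.
  have cx : (2 * pi * x_ n * t) @[n --> \oo] --> (2 * pi * w * t).
    by apply: cvgM; [apply: cvgM => //; exact: cvg_cst|exact: cvg_cst].
  exact: (cvg_comp _ _ cx (@continuous_sin _ _)).
- by move=> n t; rewrite normrM ler_piMr// normr_sin_le1.
Qed.

Lemma normc_fourier_sqr f w :
  Normc.normc (fourier f w) ^+ 2 = cosT f w ^+ 2 + sinT f w ^+ 2.
Proof. by rewrite fourierE /= sqr_sqrtr// addr_ge0// sqr_ge0. Qed.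

(** For integrable functions the constant sequence realises the [L2] extension
    of the transform. *)
Lemma is_fourier2_fourier g : mu.-integrable setT (EFin \o g) ->
  g \in Lfun mu 2%:E -> is_fourier2 g (fourier g).
Proof.
move=> intg g2; split=> //.
- by apply: continuous_measurable_fun; exact: continuous_cosT.
- by apply: continuous_measurable_fun; exact: continuous_sinT.
exists (fun=> g); split=> [_| |].
- by split=> //; apply/Lfun1_integrable.
- rewrite (_ : EFin \o (g \- g) = cst 0%E).
    by rewrite Lnorm0//; exact: cvg_cst.
  by apply/funext => x /=; rewrite subrr.
- rewrite [X in 'N[mu]_2%:E[X]%E](_ : _ = cst 0%E).
    by rewrite Lnorm0//; exact: cvg_cst.
  apply/funext => w /=; rewrite subrr.
  by rewrite subrr expr0n/= addr0 sqrtr0.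
Qed.

Section jump_minus_smooth.
Variables (nu a L theta : R) (F f : R -> R).
Hypothesis a0 : 0 < a.
Hypothesis theta01 : theta \in `[0, 1].
Variable g : R -> R.
Hypothesis dF : forall x, is_derive x 1 F (g x).
Hypothesis cg : continuous g.
Hypothesis intg : mu.-integrable setT (EFin \o g).
Variable M : R.
Hypothesis gM : forall x, `|g x| <= M.
Hypothesis fE : forall x, f x = a * (\1_`[theta, +oo[ x - F x).

Let cF : continuous F.
Proof. by move=> x; exact: is_derive_continuous (dF x). Qed.

Let f_right x : theta <= x -> f x = a * (1 - F x).
Proof. by move=> tx; rewrite fE indicE mem_set//= in_itv/= tx. Qed.

Let f_left x : x < theta -> f x = a * (0 - F x).
Proof.
by move=> tx; rewrite fE indicE memNset//= in_itv/= andbT; apply/negP; rewrite -ltNge.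
Qed.

Let is_derive_branch c x : is_derive x 1 (fun y => a * (c - F y)) (- a * g x).
Proof.
have h := dF x.
by apply: trigger_derive; rewrite /GRing.scale/=; ring.
Qed.

Let is_derive_f x : x != theta -> is_derive x 1 f (- a * g x).
Proof.
move=> xt; have [tx|tx] := ltP theta x.
  apply: (near_eq_is_derive _ (is_derive_branch 1 x)).
  near=> y; rewrite f_right//; apply: ltW; near: y; exact: lt_nbhsr.
have {}tx : x < theta by rewrite lt_neqAle xt.
apply: (near_eq_is_derive _ (is_derive_branch 0 x)).
near=> y; rewrite f_left//; near: y; exact: lt_nbhsl.
Unshelve. all: by end_near. Qed.

Let cvg_right : f @ theta^'+ --> a * (1 - F theta).
Proof.
apply: (@cvg_trans _ ((fun y => a * (1 - F y)) @ theta^'+)).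
  apply: near_eq_cvg; apply: filterS (nbhs_right_ge theta) => y ty.
  by rewrite f_right.
by apply: cvg_at_right_filter; exact: is_derive_continuous (is_derive_branch 1 _).
Qed.

Let cvg_left : f @ theta^'- --> a * (0 - F theta).
Proof.
apply: (@cvg_trans _ ((fun y => a * (0 - F y)) @ theta^'-)).
  apply: near_eq_cvg; apply: filterS (nbhs_left_lt theta) => y ty.
  by rewrite f_left.
by apply: cvg_at_left_filter; exact: is_derive_continuous (is_derive_branch 0 _).
Qed.

Let jump_theta : jump f theta = a.
Proof.
rewrite /jump (cvg_lim _ cvg_right)// (cvg_lim _ cvg_left)//.
by ring.
Qed.

Lemma jump_continuous x : x != theta -> {for x, continuous f}.
Proof. by move=> /is_derive_f; exact: is_derive_continuous. Qed.

Lemma jump_single_change_point : single_change_point f theta.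
Proof.
split=> //.
  split; first by apply/cvg_ex; exists (a * (1 - F theta)).
    by apply/cvg_ex; exists (a * (0 - F theta)).
  by rewrite jump_theta gt_eqF.
move=> x [_ _]; apply: contra_neq_eq => xt.
have cf := is_derive_continuous (is_derive_f xt).
rewrite /jump (cvg_lim _ (cvg_at_right_filter cf))//.
by rewrite (cvg_lim _ (cvg_at_left_filter cf))// subrr.
Qed.

Let derive1_f x : x != theta -> derive1 f x = - a * g x.
Proof. by move=> xt; rewrite derive1E; have [_ ->] := is_derive_f xt. Qed.

Let cag : continuous (fun x => - a * g x).
Proof. by move=> x; apply: cvgM; [exact: cvg_cst|exact: cg]. Qed.

Let cvg_right' : derive1 f @ theta^'+ --> - a * g theta.
Proof.
apply: (@cvg_trans _ ((fun y => - a * g y) @ theta^'+)).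
  apply: near_eq_cvg; apply: filterS (nbhs_right_gt theta) => y ty.
  by rewrite derive1_f// gt_eqF.
by apply: cvg_at_right_filter; exact: cag.
Qed.

Let cvg_left' : derive1 f @ theta^'- --> - a * g theta.
Proof.
apply: (@cvg_trans _ ((fun y => - a * g y) @ theta^'-)).
  apply: near_eq_cvg; apply: filterS (nbhs_left_lt theta) => y ty.
  by rewrite derive1_f// lt_eqF.
by apply: cvg_at_left_filter; exact: cag.
Qed.

Let filledE : filled_derivative f theta = (fun x => - a * g x).
Proof.
apply/funext => x; rewrite /filled_derivative; case: eqVneq => [->|xt].
  exact: (cvg_lim _ cvg_right').
exact: derive1_f.
Qed.

(** The derivative of [f] off the jump is [- a g], which is continuous across it.
    The filled derivative is therefore integrable and bounded, and its
    transform is given by the plain integrals. *)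
Lemma jump_in_class : measurable_fun setT f ->
  mu.-integrable setT (EFin \o (fun x => f x ^+ 2)) ->
  (\int[mu]_w (a ^+ 2 * (cosT g w ^+ 2 + sinT g w ^+ 2) * expR (2 * nu * `|w|))%:E
    <= (L ^+ 2)%:E)%E ->
  change_point_class nu a L f.
Proof.
move=> mf f2 bound; split; first exact: integrable_sqr_Lfun2.
have intag : mu.-integrable setT (EFin \o (fun x => - a * g x)) := integrableMl _ intg.
exists theta; split.
- exact: jump_single_change_point.
- by rewrite jump_theta ler_norm.
- split.
  + by move=> x /is_derive_f[].
  + by apply/cvg_ex; exists (- a * g theta).
  + by apply/cvg_ex; exists (- a * g theta).
  + by rewrite /jump (cvg_lim _ cvg_right')// (cvg_lim _ cvg_left')// subrr.
  + by rewrite filledE.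
- rewrite filledE; exists (fourier (fun x => - a * g x)).
    have mag : measurable_fun setT (fun x => - a * g x).
      by apply/measurable_EFinP; exact: (measurable_int _ intag).
    apply: is_fourier2_fourier => //; apply: integrable_sqr_Lfun2 => //.
    have agM x : `|- a * g x| <= a * M.
      by rewrite normrM normrN (gtr0_norm a0) ler_pM2l.
    have := integrable_mulr_bounded intag mag agM.
    by apply: eq_integrable => // x _ /=; rewrite expr2.
  apply: le_trans bound; rewrite le_eqVlt; apply/orP; left; apply/eqP.
  apply: eq_integral => w _; rewrite normc_fourier_sqr cosTZ// sinTZ//.
  by congr (_%:E); ring.
Qed.

End jump_minus_smooth.

End jump_class.

(** * Cauchy-Schwarz and densities *)

Section cauchy_schwarz.
Context d (T : measurableType d) (R : realType) (m : {measure set T -> \bar R}).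

(** The discriminant of the nonnegative quadratic t |-> \int (f - t g)^2. *)
Lemma Rintegral_cauchy_schwarz (f g : T -> R) :
  m.-integrable setT (EFin \o (fun x => f x ^+ 2)) ->
  m.-integrable setT (EFin \o (fun x => g x ^+ 2)) ->
  m.-integrable setT (EFin \o (fun x => f x * g x)) ->
  (\int[m]_x (f x * g x)) ^+ 2 <= (\int[m]_x (f x ^+ 2)) * (\int[m]_x (g x ^+ 2)).
Proof.
move=> f2 g2 fg.
set A := \int[m]_x (f x ^+ 2); set C := \int[m]_x (g x ^+ 2).
set B := \int[m]_x (f x * g x).
have Zl c (h : T -> R) : m.-integrable setT (EFin \o h) ->
    m.-integrable setT (EFin \o (fun x => c * h x)).
  move=> inth; have := @integrableZl _ _ _ m _ measurableT c _ inth.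
  by apply: eq_integrable => // x _ /=; rewrite EFinM.
have q t : 0 <= A + t * (-2 * B) + t ^+ 2 * C.
  rewrite -(RintegralZl (-2) measurableT fg) -(RintegralZl t measurableT (Zl _ _ fg)).
  rewrite -(RintegralZl _ measurableT g2) -RintegralD//; last exact: (Zl _ _ (Zl _ _ fg)).
  rewrite -RintegralD//; last 2 first.
  - have := @integrableD _ _ _ m _ measurableT _ _ f2 (Zl t _ (Zl (-2) _ fg)).
    by apply: eq_integrable.
  - exact: Zl.
  apply: Rintegral_ge0 => x _.
  rewrite (_ : _ + _ = (f x - t * g x) ^+ 2) ?sqr_ge0//.
  by ring.
have C0 : 0 <= C by apply: Rintegral_ge0 => x _; rewrite sqr_ge0.
have A0 : 0 <= A by apply: Rintegral_ge0 => x _; rewrite sqr_ge0.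
move: C0; rewrite le_eqVlt => /predU1P[C0|C0].
  have [->|B0] := eqVneq B 0; first by rewrite expr0n mulr_ge0// -C0.
  have := q ((A + 1) / (2 * B)); rewrite -C0 mulr0 addr0.
  rewrite (_ : A + _ = - 1); last by field.
  by rewrite leNgt oppr_lt0 ltr01.
(* The minimum of the quadratic. *)
have := q (B / C).
rewrite (_ : _ + _ = A - B ^+ 2 / C); last by field; rewrite gt_eqF.
by rewrite subr_ge0 ler_pdivrMr.
Qed.

End cauchy_schwarz.

Section density.
Context d (T : measurableType d) (R : realType).
Variables (nu mu : {measure set T -> \bar R}) (p : T -> R).
Hypothesis mp : measurable_fun setT p.
Hypothesis p0 : forall x, 0 <= p x.
Hypothesis nuE : forall A, measurable A -> nu A = (\int[mu]_(x in A) (p x)%:E)%E.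
Local Open Scope ereal_scope.

Import HBNNSimple.

Let density_indic A : measurable A ->
  \int[nu]_x (\1_A x)%:E = \int[mu]_x ((\1_A x)%:E * (p x)%:E).
Proof.
move=> mA; rewrite integral_indic// setIT nuE// [LHS]integral_mkcond.
apply: eq_integral => x _; rewrite patchE indicE.
by case: (x \in A); rewrite ?mul1e ?mul0e.
Qed.

Let density_nnsfun (f : {nnsfun T >-> R}) :
  \int[nu]_x (f x)%:E = \int[mu]_x ((f x)%:E * (p x)%:E).
Proof.
under [LHS]eq_integral do rewrite fimfunE -fsumEFin//.
rewrite [LHS]ge0_integral_fsum//; last 2 first.
  - by move=> r; exact/measurable_EFinP/measurableT_comp.
  - by move=> n x _; rewrite EFinM nnfun_muleindic_ge0.
under [RHS]eq_integral.
  move=> x xD; rewrite fimfunE -fsumEFin// muleC ge0_mule_fsumr; last first.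
    by move=> r; rewrite EFinM nnfun_muleindic_ge0.
  over.
rewrite [RHS]ge0_integral_fsum//; last 2 first.
  - move=> r; apply: emeasurable_funM; first exact/measurable_EFinP.
    by apply/measurable_EFinP; exact/measurableT_comp.
  - move=> n x _; apply: mule_ge0; first by rewrite lee_fin.
    by rewrite EFinM nnfun_muleindic_ge0.
apply: eq_fsbigr => r _.
under [RHS]eq_integral do rewrite EFinM muleCA (muleC (p _)%:E).
have [r0|r0] := leP 0%R r.
  rewrite [RHS]ge0_integralZl//.
  - rewrite -density_indic//.
    under eq_integral do rewrite EFinM.
    by rewrite ge0_integralZl//; apply/measurable_EFinP.
  - apply: emeasurable_funM; last exact/measurable_EFinP.
    by apply/measurable_EFinP.
  - by move=> x _; rewrite mule_ge0// lee_fin.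
rewrite preimage_nnfun0//.
by rewrite !integral0_eq// => x _; rewrite indic0 ?mulr0 ?mul0e ?mule0.
Qed.

(** The usual ascent from indicators through simple functions. *)
Lemma ge0_integral_density (f : T -> \bar R) : measurable_fun setT f ->
  (forall x, 0 <= f x) -> \int[nu]_x f x = \int[mu]_x (f x * (p x)%:E).
Proof.
move=> mf f0; pose f_ := nnsfun_approx measurableT mf.
transitivity (lim (\int[nu]_x (f_ n x)%:E @[n --> \oo])).
  rewrite -monotone_convergence//=.
  - apply: eq_integral => x _; apply/esym/cvg_lim => //=.
    exact: cvg_nnsfun_approx.
  - by move=> n; exact/measurable_EFinP/measurable_funTS.
  - by move=> n ? _; rewrite lee_fin.
  - by move=> ? _ ? ? mn; rewrite lee_fin; exact/lefP/nd_nnsfun_approx.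
under eq_fun do rewrite density_nnsfun.
rewrite -monotone_convergence//=.
- apply: eq_integral => x _; apply/cvg_lim => //=.
  apply: cvgeZr => //.
  exact: (@cvg_nnsfun_approx _ _ _ _ measurableT _ mf (fun x _ => f0 x) x I).
- move=> n; apply: emeasurable_funM; last exact/measurable_EFinP.
  exact/measurable_EFinP/measurable_funTS.
- by move=> n x _; rewrite mule_ge0// lee_fin.
- move=> x _ a b ab; rewrite lee_wpmul2r// lee_fin//.
  exact/lefP/nd_nnsfun_approx.
Qed.

End density.

(** * Quadratic domination of laws *)

Section domination.
Context d (Omega : measurableType d) (R : realType) (P : probability Omega R).
Local Notation mu := (@lebesgue_measure R).

(** The constant [C] bounds the second moment of the likelihood ratio of [U1] to
    [U0], without mentioning that ratio: in this form the property passes to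
    images and to independent pairs. *)
Definition dominated d' (T : measurableType d') (U0 U1 : Omega -> T) (C : R) : Prop :=
  forall phi : T -> R, measurable_fun setT phi -> (forall t, 0 <= phi t <= 1) ->
  (\int[P]_w phi (U1 w)) ^+ 2 <= C * \int[P]_w (phi (U0 w) ^+ 2).

Lemma integrable_unit (phi : Omega -> R) : measurable_fun setT phi ->
  (forall w, 0 <= phi w <= 1) -> P.-integrable setT (EFin \o phi).
Proof.
move=> mphi phi01; apply: (@le_integrable _ _ _ P _ measurableT _ (EFin \o cst 1)).
- exact/measurable_EFinP.
- by move=> w _ /=; rewrite lee_fin normr1 ger0_norm; case/andP: (phi01 w).
- exact: finite_measure_integrable_cst.
Qed.

Lemma Rintegral_unit (phi : Omega -> R) : measurable_fun setT phi ->
  (forall w, 0 <= phi w <= 1) -> 0 <= \int[P]_w phi w <= 1.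
Proof.
move=> mphi phi01; apply/andP; split.
  by apply: Rintegral_ge0 => w _; case/andP: (phi01 w).
have -> : 1 = \int[P]_w 1 :> R.
  by rewrite Rintegral_cst//= probability_setT mulr1.
apply: le_Rintegral => //.
- exact: integrable_unit.
- exact: finite_measure_integrable_cst.
- by move=> w _; case/andP: (phi01 w).
Qed.

Lemma dominated_comp d1 d2 (T1 : measurableType d1) (T2 : measurableType d2)
    (f : T1 -> T2) (U0 U1 : Omega -> T1) (C : R) : measurable_fun setT f ->
  dominated U0 U1 C -> dominated (f \o U0) (f \o U1) C.
Proof.
move=> mf dom phi mphi phi01; apply: (dom (phi \o f)).
  exact: (measurableT_comp mphi mf).
by move=> t; exact: phi01.
Qed.

Lemma dominated_const d' (T : measurableType d') (t : T) :
  dominated (fun=> t) (fun=> t) 1.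
Proof.
move=> phi _ _; rewrite mul1r !Rintegral_cst//= probability_setT !mulr1.
exact: lexx.
Qed.

Section gaussian.
Variables (X : Omega -> R) (s : R).
Hypothesis mX : measurable_fun setT X.
Hypothesis s0 : 0 < s.
Hypothesis law : forall B : set R, measurable B -> P (X @^-1` B) = normal_prob 0 s B.

Let n := normal_pdf 0 s.

Let nE x : n x = normal_peak s * expR (- x ^+ 2 / (s ^+ 2 *+ 2)).
Proof. by rewrite /n normal_pdfE ?gt_eqF// /normal_fun subr0. Qed.

Lemma Rintegral_gaussian (psi : R -> R) : measurable_fun setT psi ->
  (forall x, 0 <= psi x) -> \int[P]_w psi (X w) = \int[mu]_x (psi x * n x).
Proof.
move=> mpsi psi0; rewrite /Rintegral; congr fine.
have mE : measurable_fun setT (EFin \o psi) by exact/measurable_EFinP.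
have h := @ge0_integral_pushforward _ _ _ (measurableTypeR R) _ X mX P setT
  (EFin \o psi) measurableT mE (fun y _ => psi0 y : (0 <= (EFin \o psi) y)%E).
rewrite preimage_setT in h; rewrite -[LHS]h.
under [RHS]eq_integral do rewrite EFinM.
transitivity (\int[normal_prob 0 s]_y (EFin \o psi) y)%E.
  by apply: eq_measure_integral => B mB _; exact: law.
apply: (@ge0_integral_density _ (measurableTypeR R) R (normal_prob 0 s) mu n) => //.
- exact: measurable_normal_pdf.
- by move=> x; exact: normal_pdf_ge0.
Qed.

(** The likelihood ratio of two Gaussian laws whose means differ by [c] has second moment
    [exp (c^2 / s^2)]; domination is Cauchy-Schwarz against that ratio. *)
Lemma dominated_gaussian (eps p q : R) : eps != 0 ->
  dominated (fun w => eps * X w + p) (fun w => eps * X w + q)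
    (expR (((q - p) / eps) ^+ 2 / s ^+ 2)).
Proof.
move=> eps0 phi mphi phi01; set c := (q - p) / eps.
pose psi x := phi (eps * x + p).
have mpsi : measurable_fun setT psi.
  exact: (measurableT_comp mphi (measurable_affine eps p)).
have psi01 x : 0 <= psi x <= 1 by exact: phi01.
have psi0 x : 0 <= psi x by case/andP: (psi01 x).
have mpsic : measurable_fun setT (fun x : R => psi (x + c)).
  by apply: measurableT_comp => //; exact: measurable_funD.
have -> : \int[P]_w phi (eps * X w + q) = \int[mu]_x (psi (x + c) * n x).
  rewrite -Rintegral_gaussian//; apply: eq_Rintegral => w _.
  by rewrite /psi /c; congr phi; field.
rewrite (@Rintegral_gaussian (fun x => psi x ^+ 2)); last 2 first.
- exact: measurable_funX.
- by move=> x; exact: sqr_ge0.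
have intn m : mu.-integrable setT (EFin \o normal_pdf m s).
  exact: integrable_normal_pdf.
have mn m : measurable_fun setT (normal_pdf m s) by exact: measurable_normal_pdf.
have n0 x : 0 <= n x by exact: normal_pdf_ge0.
have intpn m (h : R -> R) : measurable_fun setT h -> (forall x, 0 <= h x <= 1) ->
    mu.-integrable setT (EFin \o (fun x => h x * normal_pdf m s x)).
  move=> mh h01; have hb x : `|h x| <= 1 by rewrite ger0_norm; case/andP: (h01 x).
  have := integrable_mulr_bounded (intn m) mh hb.
  by apply: eq_integrable => // x _ /=; rewrite mulrC.
(* Ratio of the densities centred at [c] and at [0]. *)
pose r x := expR ((2 * x * c - c ^+ 2) / (s ^+ 2 *+ 2)).
have s20 : s ^+ 2 *+ 2 != 0 by rewrite gt_eqF// pmulrn_lgt0// exprn_gt0.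
have ss0 : s != 0 by rewrite gt_eqF.
have nshift m x : normal_pdf m s x = normal_peak s * expR (- (x - m) ^+ 2 / (s ^+ 2 *+ 2)).
  by rewrite normal_pdfE.
have rn x : n x * r x = normal_pdf c s x.
  rewrite nE nshift -mulrA -expRD; congr (_ * expR _).
  by field.
have r2n x : r x ^+ 2 * n x = expR (c ^+ 2 / s ^+ 2) * normal_pdf (2 * c) s x.
  rewrite nE nshift /r expr2 -expRD [LHS]mulrCA [RHS]mulrCA -!expRD.
  by congr (_ * expR _); field.
have sq x : Num.sqrt (n x) ^+ 2 = n x by rewrite sqr_sqrtr.
have -> : \int[mu]_x (psi (x + c) * n x) =
    \int[mu]_x (psi x * Num.sqrt (n x) * (r x * Num.sqrt (n x))).
  rewrite -(@Rintegral_shift _ c (fun x => psi x * Num.sqrt (n x) * (r x * Num.sqrt (n x)))); last first.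
    have := intpn c _ mpsi psi01; apply: eq_integrable => // x _ /=.
    by rewrite mulrACA -expr2 sq -rn (mulrC (n x)) mulrA.
  apply: eq_Rintegral => x _; rewrite mulrACA -expr2 sq -mulrA (mulrC (r _)) rn.
  by rewrite nE nshift addrK.
have psi2 x : 0 <= psi x ^+ 2 <= 1.
  by rewrite sqr_ge0 exprn_ile1//; case/andP: (psi01 x).
have mpsi2 : measurable_fun setT (fun x => psi x ^+ 2) by exact: measurable_funX.
apply: le_trans (Rintegral_cauchy_schwarz _ _ _) _.
- have := intpn 0 _ mpsi2 psi2.
  by apply: eq_integrable => // x _ /=; rewrite exprMn sq.
- have := integrableMl (expR (c ^+ 2 / s ^+ 2)) (intn (2 * c)).
  by apply: eq_integrable => // x _ /=; rewrite [in RHS]exprMn sq r2n.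
- have := intpn c _ mpsi psi01; apply: eq_integrable => // x _ /=.
  by rewrite mulrACA -expr2 sq -rn (mulrC (n x)) mulrA.
rewrite mulrC le_eqVlt; apply/orP; left; apply/eqP; congr (_ * _).
  under eq_Rintegral do rewrite exprMn sq r2n.
  rewrite RintegralZl// /Rintegral integral_normal_pdf/=.
  by rewrite mulr1.
by apply: eq_Rintegral => x _; rewrite exprMn sq.
Qed.

End gaussian.

Section independent_pair.
Context d' (T : measurableType d').

Definition independent_of (U : Omega -> T) (X : Omega -> R) : Prop :=
  forall A B, measurable A -> measurable B ->
  (P ((U @^-1` A) `&` (X @^-1` B)) = P (U @^-1` A) * P (X @^-1` B))%E.

(** Independence makes the joint law a product, to which Fubini applies. *)
Lemma Rintegral_independent (U : {RV P >-> T}) (X : {RV P >-> R})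
    (phi : T * R -> R) : independent_of U X -> measurable_fun setT phi ->
  (forall z, 0 <= phi z <= 1) ->
  \int[P]_w phi (U w, X w) = \int[P]_w \int[P]_w' phi (U w, X w').
Proof.
move=> indep mphi phi01.
have phi0 z : (0 <= (EFin \o phi) z)%E by rewrite lee_fin; case/andP: (phi01 z).
have mE : measurable_fun setT (EFin \o phi) by exact/measurable_EFinP.
have mUX : measurable_fun setT (fun w => (U w, X w)).
  exact: measurable_fun_pair.
transitivity (fine (\int[P]_w \int[P]_w' (phi (U w, X w'))%:E)%E); last first.
  rewrite /Rintegral; congr fine; apply: eq_integral => w _.
  rewrite fineK//; apply: (integrable_fin_num measurableT).
  apply: integrable_unit => //.
  exact: (measurableT_comp (measurable_fun_pair2 (U w) mphi) (measurable_funP X)).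
rewrite /Rintegral; congr fine.
have h := @ge0_integral_pushforward _ _ _ _ _ (fun w => (U w, X w)) mUX P setT
  (EFin \o phi) measurableT mE (fun z _ => phi0 z).
rewrite preimage_setT in h; rewrite -[LHS]h.
transitivity (\int[distribution P U \x distribution P X]_z (EFin \o phi) z)%E.
  apply: eq_measure_integral => A mA _; apply/esym.
  by apply: product_measure_unique => // B C mB mC; exact: indep.
rewrite fubini_tonelli1//.
rewrite ge0_integral_distribution//; last 2 first.
- exact: measurable_fun_fubini_tonelli_F.
- by move=> t; apply: integral_ge0 => x _.
apply: eq_integral => w _ /=; rewrite /fubini_F ge0_integral_distribution//.
exact: (measurable_fun_pair2 (U w) mE).
Qed.

(** Integrating out the last component leaves a test function of the first one.
    Domination of the first components bounds the square of its mean by the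
    mean of its square, and domination of the last ones bounds each such square. *)
Lemma dominated_pair (U0 U1 : {RV P >-> T}) (X0 X1 : {RV P >-> R}) (C1 C2 : R) :
  0 <= C1 -> 0 <= C2 -> independent_of U0 X0 -> independent_of U1 X1 ->
  dominated U0 U1 C1 -> dominated X0 X1 C2 ->
  dominated (fun w => (U0 w, X0 w)) (fun w => (U1 w, X1 w)) (C1 * C2).
Proof.
move=> C10 C20 ind0 ind1 domU domX phi mphi phi01.
have phi2 z : 0 <= phi z ^+ 2 <= 1.
  by rewrite sqr_ge0 exprn_ile1//; case/andP: (phi01 z).
have mphi2 : measurable_fun setT (fun z => phi z ^+ 2) by exact: measurable_funX.
rewrite (Rintegral_independent ind1 mphi phi01).
rewrite (@Rintegral_independent _ _ (fun z => phi z ^+ 2) ind0 mphi2 phi2).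
have mean (psi : T * R -> R) (X : {RV P >-> R}) : measurable_fun setT psi ->
    (forall z, 0 <= psi z <= 1) ->
    measurable_fun setT (fun t => \int[P]_w psi (t, X w)) /\
    forall t, 0 <= \int[P]_w psi (t, X w) <= 1.
  move=> mpsi psi01; split=> [|t]; last first.
    apply: Rintegral_unit => //.
    exact: (measurableT_comp (measurable_fun_pair2 t mpsi) (measurable_funP X)).
  have psi0 z : (0 <= (EFin \o psi) z)%E by rewrite lee_fin; case/andP: (psi01 z).
  have mE : measurable_fun setT (EFin \o psi) by exact/measurable_EFinP.
  have := @measurable_fun_fubini_tonelli_F _ _ _ _ _ (distribution P X) _ mE psi0.
  move=> /(measurableT_comp (@fine_measurable R setT measurableT)).
  apply: eq_measurable_fun => t _ /=; rewrite /fubini_F /Rintegral; congr fine.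
  rewrite ge0_integral_distribution//.
  exact: (measurable_fun_pair2 t mE).
have [mg g01] := mean phi X1 mphi phi01.
have [mg2 g201] := mean _ X0 mphi2 phi2.
apply: (le_trans (domU _ mg g01)); rewrite -mulrA ler_wpM2l//.
rewrite -RintegralZl//; last first.
  by apply: integrable_unit => //; exact: (measurableT_comp mg2 (measurable_funP U0)).
have mgU : measurable_fun setT (fun w => (\int[P]_w' phi (U0 w, X1 w')) ^+ 2).
  apply: measurable_funX; exact: (measurableT_comp mg (measurable_funP U0)).
apply: le_Rintegral => //.
- apply: integrable_unit => // w.
  by rewrite sqr_ge0 exprn_ile1//; case/andP: (g01 (U0 w)).
- have := integrable_unit (measurableT_comp mg2 (measurable_funP U0)) (fun w => g201 (U0 w)).
  move=> /(@integrableZl _ _ _ P _ measurableT C2).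
  by apply: eq_integrable => // w _ /=; rewrite EFinM.
- move=> w _; apply: (domX (fun x => phi (U0 w, x))) => //.
  exact: (measurable_fun_pair2 (U0 w) mphi).
Qed.

End independent_pair.

End domination.

(** * Paths rebuilt from Wiener increments *)

Section path_space.
Context {R : realType}.
Local Notation paths := (g_sigma_algebraType (@path_cylinders R)).

Lemma measurable_path d (T : measurableType d) (U : T -> paths) :
  (forall x : R, measurable_fun setT (fun w => (U w : R -> R) x)) ->
  measurable_fun setT U.
Proof.
move=> mU; apply: (@measurability _ _ T paths setT U (@path_cylinders R)) => //.
move=> _ [C [x [B [mB ->]]] <-].
exact: mU.
Qed.

Lemma measurable_coordinate (x : R) :
  measurable_fun setT (fun y : paths => (y : R -> R) x).
Proof.
move=> _ B mB; rewrite setTI; apply: sub_sigma_algebra.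
by exists x, B.
Qed.

End path_space.

Section wiener_increments.
Context d (Omega : measurableType d) (R : realType) (P : probability Omega R).
Variable W : R -> {RV P >-> R}.
Hypothesis wienerW : two_sided_wiener W.
Variable t : nat -> R.
Hypothesis tS : {homo t : i j / (i < j)%N >-> i < j}.

Local Notation paths := (g_sigma_algebraType (@path_cylinders R)).

Definition increment (i : nat) (w : Omega) : R := W (t i.+1) w - W (t i) w.

Lemma measurable_increment i : measurable_fun setT (increment i).
Proof. by apply: measurable_funB; exact: measurable_funP. Qed.

Definition increment_events (k : nat) : set (set Omega) :=
  [set E | exists B : nat -> set R, (forall i, measurable (B i)) /\
    E = \bigcap_(i in `I_k) (increment i @^-1` B i)].

Let measurable_pre i (B : set R) : measurable B -> measurable (increment i @^-1` B).
Proof.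
by move=> mB; rewrite -[X in measurable X]setTI; exact: measurable_increment.
Qed.

Let increment_events_measurable k : increment_events k `<=` measurable.
Proof.
move=> _ [B [mB ->]]; apply: bigcap_measurableType => i _.
exact: measurable_pre.
Qed.

Let increment_events_setI k : setI_closed (increment_events k).
Proof.
move=> _ _ [B [mB ->]] [B' [mB' ->]].
exists (fun i => B i `&` B' i); split=> [i|]; first exact: measurableI.
by rewrite -bigcapI; apply: eq_bigcapr => i _; rewrite preimage_setI.
Qed.

Let increment_events_setT k : increment_events k setT.
Proof.
exists (fun=> setT); split=> //; apply/seteqP; split=> // w _ i _ //.
Qed.

Lemma increment_law i (B : set R) : measurable B ->
  P (increment i @^-1` B) = normal_prob 0 (Num.sqrt (t i.+1 - t i)) B.
Proof. by case: wienerW => _ _ law _; apply: law; apply: tS. Qed.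

(** Independence from the past, from the product rule on boxes by the uniqueness
    of finite measures on a pi-system. *)
Lemma increment_independent k (A : set Omega) (B : set R) :
  <<s increment_events k >> A -> measurable B ->
  P (A `&` (increment k @^-1` B)) = (P A * P (increment k @^-1` B))%E.
Proof.
move=> kA mB; have [_ _ _ prod] := wienerW.
have mD := measurable_pre k mB.
have PD0 : 0 <= fine (P (increment k @^-1` B)) by rewrite fine_ge0.
have PDE : (fine (P (increment k @^-1` B)))%:E = P (increment k @^-1` B).
  by rewrite fineK// fin_num_measure.
pose m1 := mrestr P mD.
pose m2 := mscale (NngNum PD0) P.
have base (C : nat -> set R) : (forall i, measurable (C i)) ->
    P (\bigcap_(i in `I_k) (increment i @^-1` C i) `&` (increment k @^-1` B)) =
    (P (increment k @^-1` B) * P (\bigcap_(i in `I_k) (increment i @^-1` C i)))%E.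
  move=> mC.
  (* Append [B] to the boxes of the first [k] increments. *)
  pose C' i := if (i < k)%N then C i else B.
  have mC' i : measurable (C' i) by rewrite /C'; case: ifP.
  rewrite (_ : _ `&` _ = \bigcap_(i in `I_k.+1) (increment i @^-1` C' i)); last first.
    apply/seteqP; split=> [w [Cw Bw] i /= ik|w Cw].
      rewrite /C'; case: ifPn => [ik'|]; first exact: Cw.
      by rewrite -leqNgt => ki; have -> : i = k by apply/eqP; rewrite eqn_leq ki -ltnS ik.
    split=> [i /= ik|].
      by have := Cw i (ltnW ik); rewrite /C' /= ik.
    by have := Cw k (ltnSn k); rewrite /C' /= ltnn.
  have -> := prod k.+1 t tS C' mC'.
  have -> := prod k t tS C mC.
  rewrite big_ord_recr/= muleC; congr (_ * _)%E.
    by rewrite /C' ltnn.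
  by apply: eq_bigr => i _; rewrite /C' ltn_ord.
have cov : \bigcup_(i : nat) (fun=> setT) i = [set: Omega].
  by apply/seteqP; split=> // w _; exists 0%N.
suff E : m1 A = m2 A.
  by rewrite muleC -PDE; exact: E.
apply: (g_sigma_algebra_measure_unique (increment_events k)
  (@increment_events_measurable k) (fun=> setT) (fun=> increment_events_setT k)
  cov m1 m2 (@increment_events_setI k) _ _ A kA).
  by move=> _ [C [mC ->]]; have e := base C mC; rewrite -PDE in e; exact: e.
move=> _; apply: (@le_lt_trans _ _ 1%E); last exact: ltry.
apply: probability_le1; exact: measurableI.
Qed.

(** Each increment is added from the right end of its time interval on, so that
    the path built from the increments of the observation agrees with it at
    the times [t m], up to the value at [t 0]. *)
Definition step_path (v : nat -> R) (k : nat) : R -> R :=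
  fun x => \sum_(i < k) (t i.+1 <= x)%R%:R * v i.

Variable eps : R.
Hypothesis eps0 : eps != 0.

Definition noisy_path (p : nat -> R) (k : nat) (w : Omega) : R -> R :=
  step_path (fun i => eps * increment i w + p i) k.

Lemma noisy_pathS p k w x : noisy_path p k.+1 w x =
  noisy_path p k w x + (t k.+1 <= x)%R%:R * (eps * increment k w + p k).
Proof. by rewrite /noisy_path /step_path big_ord_recr. Qed.

Lemma measurable_noisy_path p k :
  measurable_fun setT (noisy_path p k : Omega -> paths).
Proof.
apply: measurable_path => x; elim: k => [|k IH].
  rewrite (_ : (fun _ => _) = cst 0)//; apply/funext => w.
  by rewrite /noisy_path /step_path big_ord0.
rewrite (_ : (fun _ => _) = (fun w => noisy_path p k w x +
    (t k.+1 <= x)%R%:R * (eps * increment k w + p k))); last first.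
  by apply/funext => w; rewrite noisy_pathS.
apply: measurable_funD => //; apply: measurable_funM => //.
apply: measurable_funD => //; apply: measurable_funM => //.
exact: measurable_increment.
Qed.

(** The path up to [k] is measurable for the sigma-algebra of the first [k]
    increments. *)
Let noisy_path_past p k (A : set paths) : measurable A ->
  <<s increment_events k >> (noisy_path p k @^-1` A).
Proof.
move=> mA; pose past := g_sigma_algebraType (increment_events k).
have mincr i : (i < k)%N -> measurable_fun setT (increment i : past -> R).
  move=> ik _ B mB; rewrite setTI; apply: sub_sigma_algebra.
  exists (fun j => if j == i then B else setT); split=> [j|]; first by case: ifP.
  apply/seteqP; split=> [w Bw j /= jk|w Bw]; first by case: eqP => // ->.
  by have := Bw i ik; rewrite /= eqxx.
have : measurable_fun setT (noisy_path p k : past -> paths).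
  apply: measurable_path => x.
  apply: (@measurable_sum _ past R setT 'I_k (index_enum _)
    (fun i w => (t i.+1 <= x)%R%:R * (eps * increment i w + p i))) => i.
  apply: measurable_funM => //; apply: measurable_funD => //.
  by apply: measurable_funM => //; exact: mincr.
by move=> /(_ measurableT _ mA); rewrite setTI.
Qed.

Lemma noisy_path_independent p k :
  independent_of P (noisy_path p k : Omega -> paths)
    (fun w => eps * increment k w + p k).
Proof.
move=> A B mA mB.
have mB' : measurable ((fun x : R => eps * x + p k) @^-1` B).
  by rewrite -[X in measurable X]setTI; exact: measurable_affine.
exact: (increment_independent (noisy_path_past p mA) mB').
Qed.

(** One increment at a time: the path built from the first [k] increments is
    independent of the next one, so the constants multiply. *)
Lemma dominated_noisy_path (p q : nat -> R) k :
  dominated P (noisy_path p k : Omega -> paths) (noisy_path q k)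
    (\prod_(i < k) expR (((q i - p i) / eps) ^+ 2 / (t i.+1 - t i))).
Proof.
elim: k => [|k IH].
  rewrite big_ord0.
  have e r : noisy_path r 0 = (fun=> (fun=> 0 : R)).
    by apply/funext => w; apply/funext => x; rewrite /noisy_path /step_path big_ord0.
  by rewrite !e; exact: (@dominated_const _ _ _ P _ paths (fun=> 0)).
rewrite big_ord_recr /=.
pose glue (z : paths * R) : paths := fun x => (z.1 : R -> R) x + (t k.+1 <= x)%R%:R * z.2.
have mglue : measurable_fun setT glue.
  apply: measurable_path => x; apply: measurable_funD.
    exact: (measurableT_comp (measurable_coordinate x) measurable_fst).
  by apply: measurable_funM => //; exact: measurable_snd.
have e r : noisy_path r k.+1 =
    glue \o (fun w => (noisy_path r k w : paths, eps * increment k w + r k)).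
  by apply/funext => w; apply/funext => x; rewrite noisy_pathS.
rewrite !e; apply: dominated_comp => //.
have mX r : measurable_fun setT (fun w => eps * increment k w + r).
  apply: measurable_funD => //; apply: measurable_funM => //.
  exact: measurable_increment.
pose Z r : {RV P >-> paths} := HB.pack (noisy_path r k : Omega -> paths)
  (isMeasurableFun.Build _ _ _ _ _ (measurable_noisy_path r k)).
pose X r : {RV P >-> R} := HB.pack (fun w => eps * increment k w + r)
  (isMeasurableFun.Build _ _ _ _ _ (mX r)).
have tk : 0 < t k.+1 - t k by rewrite subr_gt0 tS.
apply: (@dominated_pair _ _ _ _ _ _ (Z p) (Z q) (X (p k)) (X (q k))) => //.
- by apply: prodr_ge0 => i _; exact: expR_ge0.
- exact: noisy_path_independent.
- exact: noisy_path_independent.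
have s0 : 0 < Num.sqrt (t k.+1 - t k) by rewrite sqrtr_gt0.
have := @dominated_gaussian _ _ _ P _ _ (measurable_increment k) s0
  (@increment_law k) eps (p k) (q k) eps0.
by rewrite sqr_sqrtr// ltW.
Qed.

End wiener_increments.

(** * From finitely many times to the whole path space *)

Section cylinder_algebra.
Context {R : realType}.
Local Notation paths := (g_sigma_algebraType (@path_cylinders R)).

Definition cylinders_on (s : seq R) : set (set (R -> R)) :=
  [set C | exists (x : R) (B : set R),
     [/\ x \in s, measurable B & C = (fun y : R -> R => y x) @^-1` B]].

Definition finite_cylinders : set (set (R -> R)) :=
  [set A | exists s, <<s cylinders_on s >> A].

(** The sets that cannot tell [y] from [z] form a sigma-algebra, which contains
    the generating cylinders. *)
Lemma cylinders_on_local s (A : set (R -> R)) (y z : R -> R) :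
  <<s cylinders_on s >> A -> {in s, y =1 z} -> A y -> A z.
Proof.
move=> sA yz; have zy : {in s, z =1 y} by move=> x xs; rewrite yz.
suff : (A y <-> A z) by case.
pose M := [set A : set (R -> R) | A y <-> A z].
have : M A; last by [].
apply: sA; split; first split => //.
- by move=> B MB; rewrite /M/=; split=> -[_ nB]; split=> // /MB.
- move=> F MF; split=> [[n _ Fn]|[n _ Fn]]; exists n => //; exact/(MF n).
- by move=> _ [x [B [xs mB ->]]]; rewrite /M /= yz.
Qed.

Lemma cylinders_onS s1 s2 : {subset s1 <= s2} ->
  <<s cylinders_on s1 >> `<=` <<s cylinders_on s2 >>.
Proof.
move=> s12; apply: smallest_sub; first exact: smallest_sigma_algebra.
move=> _ [x [B [xs mB ->]]]; apply: sub_sigma_algebra; exists x, B.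
by split=> //; exact: s12.
Qed.

Lemma finite_cylinders_setring : setring finite_cylinders.
Proof.
split.
- by exists [::]; apply: (@measurable0 _ (g_sigma_algebraType (cylinders_on [::]))).
- move=> A B [s1 A1] [s2 B2]; exists (s1 ++ s2).
  apply: (@measurableU _ (g_sigma_algebraType (cylinders_on (s1 ++ s2)))).
    by apply: cylinders_onS A1 => x xs; rewrite mem_cat xs.
  by apply: cylinders_onS B2 => x xs; rewrite mem_cat xs orbT.
- move=> A B [s1 A1] [s2 B2]; exists (s1 ++ s2).
  apply: (@measurableD _ (g_sigma_algebraType (cylinders_on (s1 ++ s2)))).
    by apply: cylinders_onS A1 => x xs; rewrite mem_cat xs.
  by apply: cylinders_onS B2 => x xs; rewrite mem_cat xs orbT.
Qed.

Lemma measurable_finite_cylinders (A : set paths) : finite_cylinders A -> measurable A.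
Proof.
move=> [s sA]; apply: (smallest_sub _ _ sA); first exact: smallest_sigma_algebra.
by move=> _ [x [B [xs mB ->]]]; apply: sub_sigma_algebra; exists x, B.
Qed.

Lemma path_measurable_sub : <<s @path_cylinders R >> `<=` <<sr finite_cylinders >>.
Proof.
have [sr0 srD srU] := smallest_sigma_ring finite_cylinders.
apply: smallest_sub.
  split=> // A srA; apply: srD => //; apply: sub_g_sigma_ring.
  by exists [::]; apply: (@measurableT _ (g_sigma_algebraType (cylinders_on [::]))).
move=> _ [x [B [mB ->]]]; apply: sub_g_sigma_ring; exists [:: x].
by apply: sub_sigma_algebra; exists x, B; rewrite inE eqxx.
Qed.

(** The times of a cylinder, sorted together with the origin, where the
    observation is normalised: increments are taken along increasing times. *)
Lemma increasing_times (s : seq R) : exists (t : nat -> R) (n : nat),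
  {homo t : i j / (i < j)%N >-> i < j} /\
  (forall x, x \in 0 :: s -> exists2 m, (m <= n)%N & t m = x).
Proof.
pose s' := sort <=%O (undup (0 :: s)).
pose n := (size s').-1.
have s'0 : (0 < size s')%N.
  by rewrite size_sort lt0n size_eq0; apply/eqP => /(congr1 (fun l => 0 \in l)); rewrite mem_undup inE eqxx.
have sn : size s' = n.+1 by rewrite prednK.
have s's : sorted <%O s'.
  by rewrite lt_sorted_uniq_le sort_uniq undup_uniq sort_le_sorted.
pose t i := if (i <= n)%N then s'`_i else s'`_n + (i - n)%:R.
exists t, n; split=> [i j ij|x xs].
  rewrite /t; case: (leqP j n) => jn.
    rewrite (leq_trans (ltnW ij) jn) sorted_ltn_nth ?inE ?sn//.
      exact: lt_trans.
    exact: leq_trans ij (leqW jn).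
  case: (leqP i n) => ni.
    apply: (@le_lt_trans _ _ s'`_n); last by rewrite ltrDl ltr0n subn_gt0.
    move: ni; rewrite leq_eqVlt => /predU1P[->//|ni].
    by apply/ltW; rewrite sorted_ltn_nth ?inE ?sn//; [exact: lt_trans|exact: ltnW].
  by rewrite ltrD2l ltr_nat ltn_sub2r// (ltn_trans ni).
have xs' : x \in s' by rewrite mem_sort mem_undup.
exists (index x s'); first by rewrite -ltnS -sn index_mem.
by rewrite /t -ltnS -sn index_mem xs' nth_index.
Qed.

End cylinder_algebra.

Section observation_laws.
Context d (Omega : measurableType d) (R : realType) (P : probability Omega R).
Variable W : R -> {RV P >-> R}.
Hypothesis wienerW : two_sided_wiener W.
Local Notation paths := (g_sigma_algebraType (@path_cylinders R)).
Variable eps : R.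
Hypothesis eps0 : eps != 0.

Definition drifted_path (H : R -> R) (w : Omega) : R -> R := fun x => H x + eps * W x w.

Lemma measurable_drifted_path H : measurable_fun setT (drifted_path H : Omega -> paths).
Proof.
apply: measurable_path => x; apply: measurable_funD => //.
by apply: measurable_funM => //; exact: measurable_funP.
Qed.

(** Increments telescope up to the time [t m], or to the last one that was built. *)
Lemma noisy_path_drifted (t : nat -> R) H k m w :
  {homo t : i j / (i < j)%N >-> i < j} ->
  noisy_path W t eps (fun i => H (t i.+1) - H (t i)) k w (t m) =
  drifted_path H w (t (minn k m)) - drifted_path H w (t 0%N).
Proof.
move=> tS; elim: k => [|k IH].
  by rewrite min0n subrr /noisy_path /step_path big_ord0.
have tle : (t k.+1 <= t m) = (k < m)%N.
  case: (ltngtP k.+1 m) => [km|mk|->]; last by rewrite lexx.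
  - by rewrite ltW// tS.
  - by rewrite lt_geF// tS.
rewrite noisy_pathS IH tle; case: (ltnP k m) => km.
  rewrite (minn_idPl km) mul1r /drifted_path /increment.
  by ring.
by rewrite (minn_idPr (leqW km)) mul0r addr0.
Qed.

Lemma fine_probabilityE d' (T : measurableType d') (U : Omega -> T) (A : set T) :
  measurable_fun setT U -> measurable A ->
  fine (P (U @^-1` A)) = \int[P]_w \1_A (U w).
Proof.
move=> mU mA; rewrite /Rintegral; congr fine.
rewrite (_ : (fun w => _) = (fun w => (\1_(U @^-1` A) w)%:E)).
  by rewrite integral_indic// ?setIT// -[X in measurable X]setTI; exact: mU.
by apply/funext => w; rewrite !indicE; congr (_%:R%:E); apply/idP/idP; rewrite !inE.
Qed.

Section two_drifts.
Variables (H0 H1 : R -> R).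
Hypothesis H00 : H0 0 = 0.
Hypothesis H10 : H1 0 = 0.
Hypothesis energy : forall (t : nat -> R) (n : nat),
  {homo t : i j / (i < j)%N >-> i < j} ->
  \sum_(i < n) ((H1 (t i.+1) - H0 (t i.+1)) - (H1 (t i) - H0 (t i))) ^+ 2
    / (t i.+1 - t i) <= eps ^+ 2.

Let centre (z : paths) : paths := fun x => (z : R -> R) x - (z : R -> R) 0.

Let measurable_centre : measurable_fun setT centre.
Proof.
by apply: measurable_path => x; apply: measurable_funB; exact: measurable_coordinate.
Qed.

(** On events that look at finitely many times, the observed path can be
    replaced by the partial sums of its increments. *)
Let finite_cylinder_bound (A : set paths) : finite_cylinders A ->
  fine (P (drifted_path H1 @^-1` A)) ^+ 2 <=
  expR 1 * fine (P (drifted_path H0 @^-1` A)).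
Proof.
move=> fA; have mA := measurable_finite_cylinders fA; have [s sA] := fA.
have [t [n [tS ts]]] := increasing_times s.
have [m0 m0n t0] := ts 0 (mem_head _ _).
have [W0 _ _ _] := wienerW.
pose p H i := H (t i.+1) - H (t i) : R.
pose Z H : Omega -> paths := noisy_path W t eps (p H) n.
have mZ H : measurable_fun setT (Z H) by exact: measurable_noisy_path.
have mI : measurable_fun setT (\1_A : paths -> R) by exact: measurable_indic.
have swap H : H 0 = 0 ->
    \int[P]_w \1_A (drifted_path H w : paths) = \int[P]_w \1_A (centre (Z H w)).
  move=> HE; rewrite /Rintegral; congr fine; apply: ae_eq_integral => //.
  - apply/measurable_EFinP.
    exact: (measurableT_comp mI (measurable_drifted_path H)).
  - apply/measurable_EFinP.
    exact: (measurableT_comp mI (measurableT_comp measurable_centre (mZ H))).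
  apply: (@filterS _ _ (ae_filter_ringOfSetsType P) _ _ _ W0) => w W0w _.
  congr (_%:E); rewrite !indicE.
  have same : {in s, (drifted_path H w : R -> R) =1 (centre (Z H w) : R -> R)}.
    move=> x xs; have xs' : x \in 0 :: s by rewrite inE xs orbT.
    have [m mn tx] := ts x xs'.
    rewrite /centre -tx -[X in _ - Z H w X]t0 /Z !noisy_path_drifted//.
    rewrite (minn_idPr mn) (minn_idPr m0n) t0 opprB addrA subrK.
    by rewrite {3}/drifted_path HE W0w mulr0 addr0 subr0.
  congr ((_ : bool)%:R); apply/idP/idP; rewrite !inE; apply: (cylinders_on_local sA) => //.
  by move=> x xs; rewrite same.
have dom := @dominated_comp _ _ _ P _ _ _ _ _ _ _ _ measurable_centre
  (dominated_noisy_path wienerW tS eps0 (p H0) (p H1) n).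
have I01 (y : paths) : 0 <= (\1_A y : R) <= 1 by rewrite indicE; case: (y \in A); rewrite /= ?lexx ?ler01.
have := dom _ mI I01.
rewrite (@fine_probabilityE _ paths _ A (measurable_drifted_path H1) mA).
rewrite (@fine_probabilityE _ paths _ A (measurable_drifted_path H0) mA).
rewrite swap// swap// => /le_trans; apply.
have sqI : \int[P]_w (\1_A ((centre \o noisy_path W t eps (p H0) n) w) ^+ 2) =
    \int[P]_w \1_A (centre (Z H0 w)).
  by apply: eq_Rintegral => w _ /=; rewrite indicE; case: (_ \in A); rewrite /= ?expr1n ?expr0n.
rewrite sqI ler_wpM2r//; first by apply: Rintegral_ge0 => w _; case/andP: (I01 (centre (Z H0 w))).
rewrite -(big_morph _ (@expRD R) (@expR0 R)) ler_expR.
rewrite (_ : \sum_(i < n) _ = eps ^- 2 * \sum_(i < n) ((H1 (t i.+1) - H0 (t i.+1)) - (H1 (t i) - H0 (t i))) ^+ 2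
    / (t i.+1 - t i)); last first.
  rewrite mulr_sumr; apply: eq_bigr => i _; rewrite /p exprMn exprVn -mulrA mulrCA.
  by congr (_ * (_ ^+ 2 / _)); ring.
rewrite ler_pdivrMl ?exprn_even_gt0// mulr1.
exact: energy.
Qed.

(** The inequality survives monotone limits, so it spreads from the algebra of
    finite cylinders to every measurable event. *)
Lemma path_event_bound (A : set paths) : measurable A ->
  fine (P (drifted_path H1 @^-1` A)) ^+ 2 <=
  expR 1 * fine (P (drifted_path H0 @^-1` A)).
Proof.
move=> mA; pose M := [set A : set paths | measurable A /\
  fine (P (drifted_path H1 @^-1` A)) ^+ 2 <=
  expR 1 * fine (P (drifted_path H0 @^-1` A))].
suff : M A by case.
have mpre H (B : set paths) : measurable B -> measurable (drifted_path H @^-1` B).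
  by move=> mB; rewrite -[X in measurable X]setTI; exact: measurable_drifted_path.
have lim_bound (F : (set paths)^nat) (B : set paths) : (forall n, M (F n)) -> measurable B ->
    (forall H, P (drifted_path H @^-1` F n) @[n --> \oo] --> P (drifted_path H @^-1` B)) ->
    M B.
  move=> MF mB cF; split=> //.
  have cv H : fine (P (drifted_path H @^-1` F n)) @[n --> \oo] -->
      fine (P (drifted_path H @^-1` B)).
    apply: fine_cvg; rewrite fineK; first exact: cF.
    by apply: fin_num_measure; exact: mpre.
  have c1 : fine (P (drifted_path H1 @^-1` F n)) * fine (P (drifted_path H1 @^-1` F n))
      @[n --> \oo] --> fine (P (drifted_path H1 @^-1` B)) * fine (P (drifted_path H1 @^-1` B)).
    by apply: cvgM; exact: cv.
  have c0 : expR 1 * fine (P (drifted_path H0 @^-1` F n)) @[n --> \oo] -->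
      expR 1 * fine (P (drifted_path H0 @^-1` B)).
    by apply: cvgM; [exact: cvg_cst|exact: cv].
  rewrite expr2; apply: (ler_cvg_to c1 c0).
  by apply: nearW => n; rewrite -expr2; case: (MF n).
apply: (@monotone_setring_sub_g_sigma_ring _ M finite_cylinders).
- split=> F mono MF.
  + have mU : measurable (\bigcup_i F i) by apply: bigcupT_measurable => i; case: (MF i).
    apply: (lim_bound F) => // H; rewrite preimage_bigcup.
    apply: nondecreasing_cvg_mu.
    * by move=> i; apply: mpre; case: (MF i).
    * by rewrite -preimage_bigcup; exact: mpre.
    * by move=> i j ij; apply/subsetPset; apply: preimage_subset; apply/subsetPset; exact: mono.
  + have mI : measurable (\bigcap_i F i) by apply: bigcapT_measurable => i; case: (MF i).
    apply: (lim_bound F) => // H; rewrite preimage_bigcap.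
    apply: nonincreasing_cvg_mu.
    * by rewrite (le_lt_trans (probability_le1 _ _)) ?ltry//; apply: mpre; case: (MF 0%N).
    * by move=> i; apply: mpre; case: (MF i).
    * by rewrite -preimage_bigcap; exact: mpre.
    * by move=> i j ij; apply/subsetPset; apply: preimage_subset; apply/subsetPset; exact: mono.
- exact: finite_cylinders_setring.
- move=> B fB; split; first exact: measurable_finite_cylinders.
  exact: finite_cylinder_bound.
- exact: path_measurable_sub.
Qed.

End two_drifts.

End observation_laws.

(** * The two-point bound *)

Section signal_energy.
Context {R : realType}.
Local Notation mu := (@lebesgue_measure R).
Implicit Types (h : R -> R) (x y s t : R).

Let cumul h x := \int[mu]_(t in `]-oo, x]) h t.

Let cumulB h s t : mu.-integrable setT (EFin \o h) -> s <= t ->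
  cumul h t - cumul h s = \int[mu]_(x in `]s, t]) h x.
Proof.
move=> inth st; rewrite /cumul Rintegral_itvB//.
exact: integrableS inth.
Qed.

Lemma primitive0_cumul h x : mu.-integrable setT (EFin \o h) ->
  primitive0 h x = \int[mu]_(t in `]-oo, x]) h t - \int[mu]_(t in `]-oo, 0]) h t.
Proof.
move=> inth; rewrite -!/(cumul _ _) /primitive0 /parameterized_integral.
have inthS (b c : itv_bound R) : mu.-integrable [set` Interval b c] (EFin \o h).
  exact: integrableS inth.
have [x0|x0|->] := ltgtP 0 x; last by rewrite !subrr.
- rewrite (@set_itv_ge _ _ (BLeft x) (BRight 0)) ?Rintegral_set0 ?subr0; last first.
    by rewrite bnd_simp -ltNge.
  by rewrite -Rintegral_itv_obnd_cbnd// cumulB// ltW.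
- rewrite (@set_itv_ge _ _ (BLeft 0) (BRight x)) ?Rintegral_set0 ?sub0r; last first.
    by rewrite bnd_simp -ltNge.
  by rewrite -Rintegral_itv_obnd_cbnd// -cumulB ?opprB// ltW.
Qed.

Lemma primitive0B h0 h1 x : continuous h0 -> continuous h1 ->
  primitive0 h1 x - primitive0 h0 x = primitive0 (fun y => h1 y - h0 y) x.
Proof.
move=> c0 c1; rewrite /primitive0 /parameterized_integral.
have int h (c : continuous h) a b : mu.-integrable `[a, b] (EFin \o h).
  apply: continuous_compact_integrable; first exact: segment_compact.
  by apply: continuous_subspaceT.
by rewrite !RintegralB ?int//; ring.
Qed.

Lemma primitive00 h : primitive0 h 0 = 0.
Proof. by rewrite /primitive0 subrr. Qed.

(** Cauchy-Schwarz on each interval of the partition: the discrete energy of a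
    drift never exceeds the integral of the square of its derivative. *)
Lemma increment_energy_le h E : mu.-integrable setT (EFin \o h) ->
  (\int[mu]_x (h x ^+ 2)%:E <= E%:E)%E ->
  forall (t : nat -> R) (n : nat), {homo t : i j / (i < j)%N >-> i < j} ->
  \sum_(i < n) (primitive0 h (t i.+1) - primitive0 h (t i)) ^+ 2
    / (t i.+1 - t i) <= E.
Proof.
move=> inth hE t n tS.
have mh : measurable_fun setT h by apply/measurable_EFinP; exact: (measurable_int _ inth).
have inth2 : mu.-integrable setT (EFin \o (fun x => h x ^+ 2)).
  apply: ge0_integrable; first exact: measurable_funX.
  - by move=> x; exact: sqr_ge0.
  - exact: le_lt_trans hE (ltry _).
pose h2 x := h x ^+ 2.
have step i : (primitive0 h (t i.+1) - primitive0 h (t i)) ^+ 2 / (t i.+1 - t i) <=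
    cumul h2 (t i.+1) - cumul h2 (t i).
  have ti : t i < t i.+1 by exact: tS.
  rewrite !primitive0_cumul// opprB addrA subrK !(cumulB _ (ltW ti))//.
  rewrite ler_pdivrMr ?subr_gt0//.
  set A := [set` `]t i, t i.+1]].
  have AA (x : R) : (\1_A x : R) ^+ 2 = \1_A x.
    by rewrite indicE expr2 -natrM mulnb andbb.
  have mA : measurable_fun setT (\1_A : R -> R) by apply: measurable_indic; exact: measurable_itv.
  have int1 : mu.-integrable setT (EFin \o (fun x => (\1_A x : R))).
    by apply: (@integrable_indic_itv _ _ (t i) (t i.+1)) => x /=; rewrite !in_itv/= => /andP[/ltW -> ->].
  have intAh g : mu.-integrable setT (EFin \o g) -> mu.-integrable setT (EFin \o (fun x => \1_A x * g x)).
    move=> ig; have := @integrable_mulr_bounded _ _ _ 1 ig mA.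
    move=> /(_ (fun x => normr_indic_le1 _ _)).
    by apply: eq_integrable => // x _ /=; rewrite mulrC.
  have := @Rintegral_cauchy_schwarz _ _ _ mu (\1_A : R -> R) (fun x => \1_A x * h x).
  have e1 : \int[mu]_x (\1_A x * (\1_A x * h x)) = \int[mu]_(x in A) h x.
    by rewrite -(Rintegral_indicM A); apply: eq_Rintegral => x _; rewrite mulrA -expr2 AA.
  have e2 : \int[mu]_x ((\1_A x * h x) ^+ 2) = \int[mu]_(x in A) h2 x.
    by rewrite -(Rintegral_indicM A); apply: eq_Rintegral => x _; rewrite exprMn AA.
  have e3 : \int[mu]_x ((\1_A x : R) ^+ 2) = t i.+1 - t i.
    transitivity (\int[mu]_x (\1_A x * cst 1 x)).
      by apply: eq_Rintegral => x _; rewrite AA mulr1.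
    rewrite Rintegral_indicM Rintegral_cst//= ?mul1r; last exact: measurable_itv.
    have -> : mu A = (t i.+1 - t i)%:E by rewrite (lebesgue_measure_itv `]t i, t i.+1])/= lte_fin ti.
    by [].
  rewrite e1 e2 e3 [X in _ -> _ <= X]mulrC; apply.
  - by apply: eq_integrable int1 => // x _ /=; rewrite AA.
  - by apply: eq_integrable (intAh _ inth2) => // x _ /=; rewrite exprMn AA.
  - by apply: eq_integrable (intAh _ inth) => // x _ /=; rewrite mulrA -expr2 AA.
apply: (@le_trans _ _ (\sum_(i < n) (cumul h2 (t i.+1) - cumul h2 (t i)))).
  by apply: ler_sum => i _; exact: step.
rewrite -(big_mkord xpredT (fun i => cumul h2 (t i.+1) - cumul h2 (t i))).
rewrite telescope_sumr// lerBlDr.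
have cumul0 x : 0 <= cumul h2 x by apply: Rintegral_ge0 => // y _; exact: sqr_ge0.
apply: (@le_trans _ _ E); last by rewrite lerDl.
rewrite -lee_fin; apply: le_trans hE.
rewrite /cumul /Rintegral fineK; last first.
  by apply: integrable_fin_num => //; exact: (integrableS _ _ _ inth2).
apply: ge0_subset_integral => //.
- by apply/measurable_EFinP; exact: measurable_funX.
- by move=> x _; rewrite lee_fin sqr_ge0.
Qed.

End signal_energy.

(** The factor lost when the distance of two change-points is turned into a
    bound on the risk. *)
Definition two_point_loss (R : realType) : R := 4 * Num.sqrt (expR 1).

Section two_points.
Context d (Omega : measurableType d) (R : realType) (P : probability Omega R).
Variable W : R -> {RV P >-> R}.
Hypothesis wienerW : two_sided_wiener W.
Variable eps : R.
Hypothesis eps0 : eps != 0.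
Variables (K f0 f1 : R -> R) (theta0 theta1 : R) (F : set (R -> R)).
Local Notation mu := (@lebesgue_measure R).
Local Notation paths := (g_sigma_algebraType (@path_cylinders R)).
Hypothesis Ff0 : F f0.
Hypothesis Ff1 : F f1.
Hypothesis cp0 : single_change_point f0 theta0.
Hypothesis cp1 : single_change_point f1 theta1.
Hypothesis theta01 : theta0 < theta1.
Hypothesis c0 : continuous (convolution K f0).
Hypothesis c1 : continuous (convolution K f1).
Let D x := convolution K f1 x - convolution K f0 x.
Hypothesis intD : mu.-integrable setT (EFin \o D).
Hypothesis energyD : (\int[mu]_x (D x ^+ 2)%:E <= (eps ^+ 2)%:E)%E.

Let expectation_ge (X : Omega -> R) (A : set Omega) (r p : R) :
  measurable_fun setT X -> (forall w, 0 <= X w) -> measurable A -> 0 <= r ->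
  (forall w, A w -> r <= X w) -> p <= fine (P A) -> ((p * r)%:E <= 'E_P[X])%E.
Proof.
move=> mX X0 mA r0 AX pA; rewrite expectation.unlock.
apply: (@le_trans _ _ (\int[P]_w (r * \1_A w)%:E)%E).
  under eq_integral do rewrite EFinM.
  rewrite ge0_integralZl//; last by apply: measurableT_comp => //; exact: measurable_indic.
  rewrite integral_indic// setIT mulrC EFinM lee_wpmul2l ?lee_fin//.
  by move: pA; rewrite -lee_fin fineK ?fin_num_measure.
apply: ge0_le_integral => //.
- by move=> w _; rewrite lee_fin mulr_ge0// indicE.
- by apply: measurableT_comp => //; apply: measurable_funM => //; exact: measurable_indic.
- exact: measurableT_comp.
- move=> w _; rewrite lee_fin indicE; case: (boolP (w \in A)) => /= [/set_mem|_].
    by rewrite mulr1; exact: AX.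
  by rewrite mulr0.
Qed.

(** If the estimator puts the change-point in the upper half often enough under
    the first signal it errs there; otherwise, the two laws being close, it
    must often put it in the lower half under the second signal. *)
Lemma two_point_risk : (((theta1 - theta0) / two_point_loss R)%:E
  <= minimax_risk K eps W F)%E.
Proof.
have upper_half (x : R) : (theta0 + theta1) / 2 <= x ->
    (theta1 - theta0) / 2 <= `|x - theta0|.
  by move=> xm; rewrite (le_trans _ (ler_norm _))//; lra.
have lower_half (x : R) : x < (theta0 + theta1) / 2 ->
    (theta1 - theta0) / 2 <= `|x - theta1|.
  by move=> xm; rewrite -normrN (le_trans _ (ler_norm _))//; lra.
have complement (e q : R) : 1 <= e -> q < 1 / 2 -> 1 / (4 * e) <= 1 - q.
  move=> e1 q12; have : 1 / (4 * e) <= 1 / 4 by rewrite ler_pdivrMr ?mulr_gt0//; lra.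
  by lra.
have small_prob (e q q0 : R) : 1 <= e -> 0 <= q -> q ^+ 2 <= e * q0 ->
    q0 < 1 / (4 * e) -> q < 1 / 2.
  move=> e1 q0' qe PA; have e0 : 0 < e by exact: lt_le_trans e1.
  rewrite -ltr_sqr ?nnegrE//; apply: (le_lt_trans qe).
  rewrite mulrC -ltr_pdivlMr//; apply: (lt_le_trans PA).
  by rewrite le_eqVlt; apply/orP; left; apply/eqP; field; rewrite gt_eqF.
pose delta := theta1 - theta0; rewrite -/delta.
have delta0 : 0 < delta by rewrite subr_gt0.
have [e eE] : exists e : R, e = expR 1 by exists (expR 1).
suff main : ((delta / (4 * Num.sqrt e))%:E <= minimax_risk K eps W F)%E.
  by apply: le_trans main; rewrite lee_fin le_eqVlt; apply/orP; left; apply/eqP; rewrite eE; congr (_ * _).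
have e1 : 1 <= e by rewrite eE -expR0 ler_expR.
have e0 : 0 < e by exact: lt_le_trans e1.
apply: le_ereal_inf_tmp => _ [est mest <-].
pose A : set paths := [set y | (theta0 + theta1) / 2 <= est y].
have mA : measurable A.
  rewrite -[A]setTI (_ : A = est @^-1` `[(theta0 + theta1) / 2, +oo[%classic).
    exact: mest.
  by apply/seteqP; split=> y /=; rewrite in_itv/= andbT.
pose H f : R -> R := primitive0 (convolution K f).
have obsE f w : observation K eps W f w = drifted_path W eps (H f) w by [].
have mY f : measurable_fun setT (drifted_path W eps (H f) : Omega -> paths).
  exact: measurable_drifted_path.
have mX f theta : measurable_fun setT (fun w => `|est (observation K eps W f w) - theta| ^+ 2 : R).
  apply: measurable_funX; apply: measurableT_comp => //.
  apply: measurable_funB => //; exact: (measurableT_comp mest (mY f)).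
have mB f (B : set paths) : measurable B -> measurable (drifted_path W eps (H f) @^-1` B).
  by move=> mB; rewrite -[X in measurable X]setTI; exact: mY.
have bound := @path_event_bound _ _ _ _ _ wienerW eps eps0 (H f0) (H f1)
  (primitive00 _) (primitive00 _).
have {}bound : fine (P (drifted_path W eps (H f1) @^-1` A)) ^+ 2 <=
    e * fine (P (drifted_path W eps (H f0) @^-1` A)).
  rewrite eE.
  apply: bound => // t n tS.
  rewrite (eq_bigr (fun i : 'I_n => (primitive0 D (t i.+1) - primitive0 D (t i)) ^+ 2
    / (t i.+1 - t i))); first exact: increment_energy_le.
  by move=> i _; rewrite /H (primitive0B _ c0 c1) (primitive0B _ c0 c1).
have far_estimates f theta : F f -> single_change_point f theta ->
    (exists2 B : set paths, measurable B &
      (forall y, B y -> delta / 2 <= `|est y - theta|) /\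
      1 / (4 * e) <= fine (P (drifted_path W eps (H f) @^-1` B))) ->
    ((delta / (4 * Num.sqrt e))%:E <= risk K eps W est F)%E.
  move=> Ff cpf [B mB' [Bd PB]].
  apply: (@le_trans _ _ (sqrte
    ('E_P[fun w => (`|est (observation K eps W f w) - theta| ^+ 2)%R])%E)); last first.
    by apply: ereal_sup_ubound; exists f, theta.
  have -> : delta / (4 * Num.sqrt e) = Num.sqrt (1 / (4 * e) * (delta / 2) ^+ 2).
    apply: (@pexpIrn _ 2) => //; rewrite ?nnegrE ?sqrtr_ge0//.
      by rewrite divr_ge0 ?mulr_ge0 ?sqrtr_ge0// ltW.
    rewrite sqr_sqrtr; last by rewrite mulr_ge0 ?sqr_ge0// divr_ge0// ltW// mulr_gt0.
    rewrite expr_div_n exprMn sqr_sqrtr ?ltW//.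
    by field; rewrite gt_eqF.
  change (sqrte (1 / (4 * e) * (delta / 2) ^+ 2)%:E <=
    sqrte ('E_P[fun w => (`|est (observation K eps W f w) - theta| ^+ 2)%R]))%E.
  have lo : ((1 / (4 * e) * (delta / 2) ^+ 2)%:E <=
      'E_P[fun w => (`|est (observation K eps W f w) - theta| ^+ 2)%R])%E.
    apply: (expectation_ge (mX f theta) _ (mB f B mB') _ _ PB) => //.
    - exact: sqr_ge0.
    - move=> w Bw; rewrite ler_sqr ?nnegrE//; first exact: Bd.
      by rewrite divr_ge0// ltW.
  rewrite lee_sqrt//; apply: le_trans lo.
  by rewrite lee_fin mulr_ge0 ?sqr_ge0// divr_ge0// ltW// mulr_gt0.
(* The threshold is such that [P1(A)^2 <= e P0(A)] leaves [P1(A) < 1/2]. *)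
have [PA|PA] := leP (1 / (4 * e)) (fine (P (drifted_path W eps (H f0) @^-1` A))).
  by apply: (far_estimates f0 theta0) => //; exists A => //; split=> // y; exact: upper_half.
apply: (far_estimates f1 theta1) => //; exists (~` A); first exact: measurableC.
split=> [y /negP|]; first by rewrite -ltNge; exact: lower_half.
rewrite preimage_setC probability_setC; last exact: (mB f1 A mA).
rewrite -(fineK (fin_num_measure P _ (mB f1 A mA))) -EFinB/=.
by apply: complement => //; apply: (small_prob _ _ _ e1 _ bound PA); exact: fine_ge0.
Qed.

End two_points.

(** * The two signals *)

Section two_box_bound.
Context {R : realType}.
Local Notation mu := (@lebesgue_measure R).

Lemma integral_le_two_boxes (f : R -> R) (A B r s : R) :
  measurable_fun setT f -> (forall w, 0 <= f w) -> 0 <= A -> 0 <= B ->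
  0 <= r -> 0 <= s -> (forall w, f w <= A * box r w + B * box s w) ->
  (\int[mu]_w (f w)%:E <= (A * (2 * r) + B * (2 * s))%:E)%E.
Proof.
move=> mf f0 A0 B0 r0 s0 fAB.
have box0 q w : 0 <= box q w :> R by rewrite /box indicE.
have mbox q C : measurable_fun setT (fun w => (C * box q w)%:E : \bar R).
  by apply: measurableT_comp => //; apply: measurable_funM => //; exact: measurable_box.
apply: (@le_trans _ _ (\int[mu]_w ((A * box r w)%:E + (B * box s w)%:E))%E).
  apply: ge0_le_integral => //.
  - by move=> w _; rewrite lee_fin.
  - exact: measurableT_comp.
  - exact: (emeasurable_funD (mbox r A) (mbox s B)).
  - by move=> w _; rewrite -EFinD lee_fin.
rewrite ge0_integralD//; last 4 first.
- by move=> w _; rewrite lee_fin mulr_ge0.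
- exact: mbox.
- by move=> w _; rewrite lee_fin mulr_ge0.
- exact: mbox.
have e q C : 0 <= q -> (\int[mu]_w (C * box q w)%:E = (C * (2 * q))%:E)%E.
  move=> q0; have iq : mu.-integrable setT (EFin \o (fun w => C * box q w)).
    by apply: integrableMl; exact: integrable_box.
  rewrite -(fineK (integrable_fin_num measurableT iq)).
  rewrite -/(Rintegral mu setT (fun w => C * box q w)) RintegralZl//; last exact: integrable_box.
  rewrite Rintegral_indic_itv; first by congr (_ * _)%:E; ring.
  by rewrite lerNl (le_trans _ q0)// lerNl oppr0.
by rewrite !e.
Qed.

Lemma measurable_spectrum (g : R -> R) : mu.-integrable setT (EFin \o g) ->
  measurable_fun setT (fun w => cosT g w ^+ 2 + sinT g w ^+ 2).
Proof.
move=> intg; apply: measurable_funD; apply: measurable_funX.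
  by apply: continuous_measurable_fun; exact: continuous_cosT.
by apply: continuous_measurable_fun; exact: continuous_sinT.
Qed.

(** The gap [g (. - r) - g] has transform [q (exp (2 i pi w r) - 1)]. *)
Lemma real_transform_gap (f g : R -> R) (w r p q : R) :
  mu.-integrable setT (EFin \o f) -> mu.-integrable setT (EFin \o g) ->
  cosT f w = p -> sinT f w = 0 -> cosT g w = q -> sinT g w = 0 ->
  cosT (fun x => f x + (g (x - r) + -1 * g x)) w ^+ 2 +
  sinT (fun x => f x + (g (x - r) + -1 * g x)) w ^+ 2 =
  (p + q * (cos (2 * pi * w * r) - 1)) ^+ 2 + (q * sin (2 * pi * w * r)) ^+ 2.
Proof.
move=> intf intg cf sf cg sg.
have int_sh : mu.-integrable setT (EFin \o (fun x => g (x - r))) by exact: integrable_shift.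
have intm := integrableMl (-1) intg.
have intB : mu.-integrable setT (EFin \o (fun x => g (x - r) + -1 * g x)).
  exact: (eq_integrable _ _ _ (fun _ _ => erefl) (integrableD measurableT int_sh intm)).
rewrite (cosTD w intf intB) (sinTD w intf intB) (cosTD w int_sh intm).
rewrite (sinTD w int_sh intm) (cosTZ (-1) w intg) (sinTZ (-1) w intg).
rewrite (cosT_shift (- r) w intg) (sinT_shift (- r) w intg) cf sf cg sg.
rewrite (mulrN (2 * pi * w)) sinN cosN.
by move: (cos _) (sin _) => C S; ring.
Qed.

End two_box_bound.

Section two_hypotheses.
Context {R : realType}.
Local Notation mu := (@lebesgue_measure R).
Variables (a nu L h N delta : R).
Hypothesis a0 : 0 < a.
Hypothesis nu0 : 0 < nu.
Hypothesis h0 : 0 < h.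
Hypothesis N0 : 0 < N.
Hypothesis delta0 : 0 < delta.
Hypothesis delta1 : delta <= 1.

Definition null_signal x := a * jump_profile h x.

Let Psi x := vprimitive h x + (vprimitive N (x - delta) - vprimitive N x).
Let psi x := vkernel h x + (vkernel N (x - delta) + - 1 * vkernel N x).

(** The smooth part is chosen so that moving the jump from [0] to [delta] changes
    no frequency below [N]. *)
Definition shifted_signal x := a * (\1_`[delta, +oo[ x - Psi x).

Definition signal_gap x :=
  - a * (step delta x + -1 * convolution (vkernel N) (step delta) x).

Let delta0' := ltW delta0.

Lemma signal_gapE x : shifted_signal x - null_signal x = signal_gap x.
Proof.
rewrite /shifted_signal /null_signal /signal_gap /jump_profile /Psi.
rewrite -(vprimitiveB N0 _ delta0') [step delta x]/step.
have -> : \1_`[0, +oo[ x = \1_`[0, delta[ x + \1_`[delta, +oo[ x :> R.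
  rewrite !indicE !mem_setE !in_itv/= !andbT.
  have [dx|xd] := leP delta x; first by rewrite (le_trans delta0' dx) /= add0r.
  by rewrite andbT addr0.
move: (\1_`[0, delta[ x : R) (\1_`[delta, +oo[ x : R) => S T.
move: (vprimitive h x) (vprimitive N x) (vprimitive N _) => V U U'; ring.
Qed.

Let int_step : mu.-integrable setT (EFin \o step delta).
Proof. exact: integrable_step. Qed.

Let step1 x : `|step delta x| <= 1 :> R.
Proof. exact: normr_indic_le1. Qed.

Let int_conv : mu.-integrable setT (EFin \o convolution (vkernel N) (step delta)).
Proof.
exact: (integrable_convolution (integrable_vkernel N0) (measurable_step _) step1 int_step).
Qed.

Lemma integrable_signal_gap : mu.-integrable setT (EFin \o signal_gap).
Proof.
apply: integrableMl; apply: eq_integrable (integrableD measurableT int_step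
  (integrableMl (-1) int_conv)) => // x _.
Qed.

Lemma measurable_signal_gap : measurable_fun setT signal_gap.
Proof. by apply/measurable_EFinP; exact: (measurable_int _ integrable_signal_gap). Qed.

Let gap_bound := a * (1 + \int[mu]_y `|vkernel N y|).

Lemma normr_signal_gap_le x : `|signal_gap x| <= gap_bound.
Proof.
rewrite /signal_gap /gap_bound normrM normrN (gtr0_norm a0) ler_pM2l// (le_trans (ler_normD _ _))//.
rewrite lerD// mulN1r normrN.
rewrite (le_trans (normr_convolution_le (integrable_vkernel N0) (measurable_step _) step1 _))//.
by rewrite mul1r.
Qed.

(** The gap only carries the frequencies beyond [N] of the indicator of
    [[0, delta[]. *)
Lemma signal_gap_spectrum w :
  cosT signal_gap w ^+ 2 + sinT signal_gap w ^+ 2 =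
  a ^+ 2 * (1 - trapezoid N w) ^+ 2 *
  (cosT (step delta) w ^+ 2 + sinT (step delta) w ^+ 2).
Proof.
have intN1 := integrableMl (-1) int_conv.
have intS : mu.-integrable setT (EFin \o (fun x =>
    step delta x + -1 * convolution (vkernel N) (step delta) x)).
  exact: (eq_integrable _ _ _ (fun _ _ => erefl) (integrableD measurableT int_step intN1)).
rewrite /signal_gap cosTZ// sinTZ// cosTD// sinTD// cosTZ// sinTZ//.
rewrite (cosT_convolution (integrable_vkernel N0) (measurable_step _) step1 int_step).
rewrite (sinT_convolution (integrable_vkernel N0) (measurable_step _) step1 int_step).
rewrite cosT_vkernel// sinT_vkernel//; ring.
Qed.

Let int_vh := integrable_vkernel h0.
Let int_vN := integrable_vkernel N0.

Lemma null_signal_cp : single_change_point null_signal 0.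
Proof.
apply: (@jump_single_change_point _ a 0 (vprimitive h) null_signal a0 _ (vkernel h)) => //.
- by rewrite in_itv/= lexx ler01.
- by move=> x; exact: is_derive_vprimitive.
Qed.

Let dPsi (x : R) : is_derive x 1 Psi (psi x).
Proof.
have dB : is_derive x 1 (fun y => vprimitive N (y - delta)) (vkernel N (x - delta)).
  have dN := is_derive_vprimitive N0 (x - delta).
  have ds : is_derive x 1 (fun y : R => y - delta) 1 by apply: trigger_derive; rewrite subr0.
  have := @is_derive1_comp _ (vprimitive N) (fun y => y - delta) x _ _ dN ds.
  by rewrite mulr1; exact.
have dh := is_derive_vprimitive h0 x; have dN := is_derive_vprimitive N0 x.
rewrite /psi mulN1r; exact: (is_deriveD dh (is_deriveB dB dN)).
Qed.

Lemma shifted_signal_cp : single_change_point shifted_signal delta.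
Proof.
apply: (@jump_single_change_point _ a delta Psi shifted_signal a0 _ psi) => //.
by rewrite in_itv/= delta0'.
Qed.

Lemma null_signal_continuous x : x != 0 -> {for x, continuous null_signal}.
Proof.
apply: (@jump_continuous _ a 0 (vprimitive h) null_signal (vkernel h)) => //.
by move=> y; exact: is_derive_vprimitive.
Qed.

Lemma shifted_signal_continuous x : x != delta -> {for x, continuous shifted_signal}.
Proof. exact: (@jump_continuous _ a delta Psi shifted_signal psi). Qed.

Lemma measurable_null_signal : measurable_fun setT null_signal.
Proof. by apply: measurable_funM => //; exact: measurable_jump_profile. Qed.

Lemma shifted_signalE : shifted_signal = null_signal \+ signal_gap.
Proof. by apply/funext => x /=; rewrite -signal_gapE addrC subrK. Qed.

Lemma measurable_shifted_signal : measurable_fun setT shifted_signal.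
Proof.
rewrite shifted_signalE; apply: measurable_funD; first exact: measurable_null_signal.
exact: measurable_signal_gap.
Qed.

Lemma normr_null_signal_le x : `|null_signal x| <= a * (vkernel_bound h * pi).
Proof. by rewrite normrM (gtr0_norm a0) ler_pM2l//; exact: normr_jump_profile_le. Qed.

Lemma normr_shifted_signal_le x :
  `|shifted_signal x| <= a * (vkernel_bound h * pi) + gap_bound.
Proof.
rewrite shifted_signalE (le_trans (ler_normD _ _))// lerD ?normr_null_signal_le//.
exact: normr_signal_gap_le.
Qed.

Let int_null2 : mu.-integrable setT (EFin \o (fun x => null_signal x ^+ 2)).
Proof.
apply: eq_integrable (integrableMl (a ^+ 2) (integrable_sqr_jump_profile h0)) => // x _ /=.
by rewrite /null_signal exprMn.
Qed.

Let int_shifted2 : mu.-integrable setT (EFin \o (fun x => shifted_signal x ^+ 2)).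
Proof.
have int_gap2 : mu.-integrable setT (EFin \o (fun x => signal_gap x * signal_gap x)).
  apply: integrable_mulr_bounded integrable_signal_gap measurable_signal_gap _.
  exact: normr_signal_gap_le.
apply: le_integrable (integrableD measurableT (integrableMl 2 int_null2) (integrableMl 2 int_gap2)) => //.
  by apply/measurable_EFinP; apply: measurable_funX; exact: measurable_shifted_signal.
move=> x _ /=; rewrite lee_fin shifted_signalE/=.
rewrite ger0_norm ?sqr_ge0// (le_trans _ (ler_norm _))//.
by have := sqr_ge0 (null_signal x - signal_gap x); nra.
Qed.

Let weight (w : R) := expR (2 * nu * `|w|).

Let mweight : measurable_fun setT weight.
Proof.
apply: (measurableT_comp (@measurable_expR R)); exact: measurable_funM.
Qed.

Let weight_trapezoid M w : 0 < M ->
  trapezoid M w ^+ 2 * weight w <= expR (4 * nu * M) * box (2 * M) w.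
Proof.
move=> M0; have [wM|wM] := leP `|w| (2 * M); last first.
  by rewrite trapezoid_eq0// expr0n mul0r mulr_ge0 ?expR_ge0// /box indicE.
have -> : box (2 * M) w = 1 :> R by rewrite /box indicE mem_set//= in_itv/= -ler_norml.
rewrite mulr1 -[leRHS]mul1r ler_pM ?sqr_ge0 ?expR_ge0//.
  by rewrite expr_le1// ?trapezoid_ge0 ?trapezoid_le1.
by rewrite ler_expR; have := ler_wpM2l (ltW nu0) wM; lra.
Qed.

(** Both signals have a derivative whose transform lives on [-2 h, 2 h] and
    [-2 N, 2 N], so the exponential weight costs at most its value at the ends
    of these intervals. *)
Lemma null_signal_in_class :
  4 * a ^+ 2 * h * expR (4 * nu * h) <= L ^+ 2 ->
  change_point_class nu a L null_signal.
Proof.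
move=> hL.
apply: (@jump_in_class _ nu a L 0 (vprimitive h) null_signal a0 _ (vkernel h) _ _ int_vh
  _ (normr_vkernel_le_cst h0)) => //.
- by rewrite in_itv/= lexx ler01.
- by move=> x; exact: is_derive_vprimitive.
- exact: continuous_vkernel.
- exact: measurable_null_signal.
have h0' := ltW h0.
have : (\int[mu]_w (a ^+ 2 * (cosT (vkernel h) w ^+ 2 + sinT (vkernel h) w ^+ 2) * weight w)%:E
    <= (a ^+ 2 * expR (4 * nu * h) * (2 * (2 * h)) + 0 * (2 * (2 * h)))%:E)%E.
  apply: integral_le_two_boxes => //.
  - apply: measurable_funM; last exact: mweight.
    by apply: measurable_funM => //; exact: measurable_spectrum.
  - by move=> w; rewrite mulr_ge0 ?expR_ge0// mulr_ge0 ?sqr_ge0// addr_ge0 ?sqr_ge0.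
  - by rewrite mulr_ge0 ?sqr_ge0 ?expR_ge0.
  - by rewrite mulr_ge0.
  - by rewrite mulr_ge0.
  - move=> w; rewrite mul0r addr0 cosT_vkernel// sinT_vkernel// expr0n/= addr0.
    by have := ler_wpM2l (sqr_ge0 a) (weight_trapezoid w h0); rewrite !mulrA.
move=> /le_trans; apply; rewrite lee_fin; apply: le_trans hL.
by rewrite le_eqVlt; apply/orP; left; apply/eqP; ring.
Qed.

Let psi_spectrum w : cosT psi w ^+ 2 + sinT psi w ^+ 2 =
  (trapezoid h w + trapezoid N w * (cos (2 * pi * w * delta) - 1)) ^+ 2
  + (trapezoid N w * sin (2 * pi * w * delta)) ^+ 2.
Proof.
exact: (real_transform_gap delta int_vh int_vN (cosT_vkernel h0 w) (sinT_vkernel h0 w)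
  (cosT_vkernel N0 w) (sinT_vkernel N0 w)).
Qed.

(** The part of the derivative that lives on the larger band carries the factor
    [exp (2 i pi w delta) - 1], of size at most [N delta] there: the closeness of
    the two change-points pays for the weight [exp (4 nu N)]. *)
Lemma shifted_signal_in_class :
  8 * a ^+ 2 * h * expR (4 * nu * h) <= L ^+ 2 / 2 ->
  a ^+ 2 * (256 * pi ^+ 2) * delta ^+ 2 * N ^+ 3 * expR (4 * nu * N) <= L ^+ 2 / 2 ->
  change_point_class nu a L shifted_signal.
Proof.
move=> hL NL.
have int_psi : mu.-integrable setT (EFin \o psi).
  have int_sh : mu.-integrable setT (EFin \o (fun x => vkernel N (x - delta))).
    exact: integrable_shift.
  exact: (eq_integrable _ _ _ (fun _ _ => erefl) (integrableD measurableT int_vh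
    (integrableD measurableT int_sh (integrableMl (-1) int_vN)))).
have cpsi : continuous psi.
  move=> x; apply: cvgD; first exact: continuous_vkernel.
  apply: cvgD; last by apply: cvgM; [exact: cvg_cst|exact: continuous_vkernel].
  apply: (@cvg_comp _ _ _ (fun y => y - delta) (vkernel N) (nbhs x) (nbhs (x - delta))).
    by apply: cvgB; [exact: cvg_id|exact: cvg_cst].
  exact: continuous_vkernel.
have psiM x : `|psi x| <= vkernel_bound h + (vkernel_bound N + vkernel_bound N).
  rewrite (le_trans (ler_normD _ _))// lerD ?normr_vkernel_le_cst//.
  rewrite (le_trans (ler_normD _ _))// lerD ?normr_vkernel_le_cst//.
  by rewrite mulN1r normrN normr_vkernel_le_cst.
apply: (@jump_in_class _ nu a L delta Psi shifted_signal a0 _ psi _ _ int_psi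
  _ psiM) => //.
- by rewrite in_itv/= delta0'.
- exact: measurable_shifted_signal.
have [h0' N0'] := (ltW h0, ltW N0).
have : (\int[mu]_w (a ^+ 2 * (cosT psi w ^+ 2 + sinT psi w ^+ 2) * weight w)%:E
    <= (2 * a ^+ 2 * expR (4 * nu * h) * (2 * (2 * h)) +
        (a ^+ 2 * (64 * pi ^+ 2) * delta ^+ 2 * N ^+ 2 * expR (4 * nu * N)) * (2 * (2 * N)))%:E)%E.
  apply: integral_le_two_boxes => //.
  - apply: measurable_funM; last exact: mweight.
    by apply: measurable_funM => //; exact: measurable_spectrum.
  - by move=> w; rewrite mulr_ge0 ?expR_ge0// mulr_ge0 ?sqr_ge0// addr_ge0 ?sqr_ge0.
  - by rewrite mulr_ge0 ?expR_ge0// mulr_ge0 ?sqr_ge0.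
  - by rewrite mulr_ge0 ?expR_ge0// mulr_ge0 ?sqr_ge0// mulr_ge0 ?sqr_ge0// mulr_ge0 ?sqr_ge0// mulr_ge0 ?sqr_ge0.
  - by rewrite mulr_ge0.
  - by rewrite mulr_ge0.
  - move=> w; rewrite psi_spectrum.
    have key : (trapezoid h w + trapezoid N w * (cos (2 * pi * w * delta) - 1)) ^+ 2
        + (trapezoid N w * sin (2 * pi * w * delta)) ^+ 2 <=
        2 * trapezoid h w ^+ 2 + 64 * pi ^+ 2 * delta ^+ 2 * N ^+ 2 * trapezoid N w ^+ 2.
      have [wN|wN] := leP `|w| (2 * N); last first.
        rewrite (trapezoid_eq0 wN) !mul0r expr0n/= !mulr0 !addr0.
        by have := sqr_ge0 (trapezoid h w); lra.
      have := one_sub_cos_le w delta0'; have := cos2Dsin2 (2 * pi * w * delta).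
      have : (2 * pi * w * delta) ^+ 2 <= 16 * pi ^+ 2 * delta ^+ 2 * N ^+ 2.
        rewrite (_ : _ ^+ 2 = 4 * pi ^+ 2 * delta ^+ 2 * `|w| ^+ 2); last first.
          by rewrite real_normK ?num_real//; ring.
        rewrite (_ : 16 * _ * _ * _ = 4 * pi ^+ 2 * delta ^+ 2 * (2 * N) ^+ 2); last by ring.
        have k0 : 0 <= 4 * pi ^+ 2 * delta ^+ 2 by rewrite mulr_ge0 ?sqr_ge0// mulr_ge0 ?sqr_ge0.
        by rewrite ler_wpM2l// ler_sqr ?nnegrE ?normr_ge0// mulr_ge0.
      move: (cos _) (sin _) ((_ * delta) ^+ 2) => C S Q QN CS CQ.
      have : 4 * (1 - C) * trapezoid N w ^+ 2 <=
          64 * pi ^+ 2 * delta ^+ 2 * N ^+ 2 * trapezoid N w ^+ 2.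
        by rewrite ler_wpM2r ?sqr_ge0//; lra.
      have := sqr_ge0 (trapezoid h w - trapezoid N w * (C - 1)).
      move: (64 * _ * _ * _ * _) => Y; move: (trapezoid h w) (trapezoid N w) => p q.
      rewrite (_ : (q * S) ^+ 2 = q ^+ 2 * (1 - C ^+ 2)); last by rewrite -CS; ring.
      by have := sqr_ge0 (q * S); nra.
    have := ler_wpM2r (expR_ge0 (2 * nu * `|w|)) key; rewrite -/(weight w) => {}key.
    have wh := weight_trapezoid w h0; have wN := weight_trapezoid w N0.
    rewrite -mulrA (le_trans (ler_wpM2l (sqr_ge0 a) key))//.
    have C0 : 0 <= 64 * pi ^+ 2 * delta ^+ 2 * N ^+ 2.
      by rewrite mulr_ge0 ?sqr_ge0// mulr_ge0 ?sqr_ge0// mulr_ge0 ?sqr_ge0.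
    have := ler_wpM2l (mulr_ge0 (sqr_ge0 a) C0) wN.
    have := ler_wpM2l (sqr_ge0 a) wh.
    lra.
move=> /le_trans; apply; rewrite lee_fin.
by move: hL NL; lra.
Qed.

End two_hypotheses.

(** * The energy of the blurred gap *)

Section blurred_gap.
Context {R : realType}.
Local Notation mu := (@lebesgue_measure R).
Variables (a nu L h N delta : R).
Hypothesis a0 : 0 < a.
Hypothesis nu0 : 0 < nu.
Hypothesis h0 : 0 < h.
Hypothesis N0 : 0 < N.
Hypothesis delta0 : 0 < delta.
Hypothesis delta1 : delta <= 1.
Variables (K : R -> R) (beta kappa : R).
Hypothesis intK : mu.-integrable setT (EFin \o K).
Hypothesis kappa0 : 0 < kappa.
Hypothesis K_decay : forall w : R,
  Normc.normc (fourier K w) <= kappa * (1 + `|w| ^+ 2) `^ (- (beta / 2)).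

Lemma spectrum_decay w :
  cosT K w ^+ 2 + sinT K w ^+ 2 <= kappa ^+ 2 * (1 + w ^+ 2) `^ (- beta).
Proof.
rewrite -normc_fourier_sqr.
have -> : kappa ^+ 2 * (1 + w ^+ 2) `^ (- beta) =
    (kappa * (1 + `|w| ^+ 2) `^ (- (beta / 2))) ^+ 2.
  rewrite exprMn real_normK ?num_real// -(powR_mulrn 2 (powR_ge0 _ _)) -powRrM.
  by congr (_ * _ `^ _); field.
have k0 := ltW kappa0.
by rewrite ler_sqr ?nnegrE ?mulr_ge0 ?powR_ge0// fourierE /= sqrtr_ge0.
Qed.

(** Spectral density of the energy that the blurred gap carries. *)
Definition gap_energy w := a ^+ 2 * kappa ^+ 2 * (1 + w ^+ 2) `^ (- beta) *
  (1 - trapezoid N w) ^+ 2 * (cosT (step delta) w ^+ 2 + sinT (step delta) w ^+ 2).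

Lemma gap_energy_ge0 w : 0 <= gap_energy w.
Proof.
rewrite mulr_ge0// ?addr_ge0 ?sqr_ge0// mulr_ge0 ?sqr_ge0// mulr_ge0 ?powR_ge0//.
by rewrite mulr_ge0 ?sqr_ge0.
Qed.

Lemma measurable_gap_energy : measurable_fun setT gap_energy.
Proof.
have mt : measurable_fun setT (fun w => (1 - trapezoid N w) ^+ 2).
  apply: measurable_funX; apply: measurable_funB => //.
  by apply: continuous_measurable_fun; exact: continuous_trapezoid.
have mp : measurable_fun setT (fun w : R => (1 + w ^+ 2) `^ (- beta)).
  by apply: (measurableT_comp (@measurable_powR R (- beta))); apply: measurable_funD => //; exact: measurable_funX.
apply: measurable_funM; last by apply: measurable_spectrum; exact: integrable_step.
by apply: measurable_funM => //; exact: measurable_funM.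
Qed.

Let u := signal_gap a N delta.
Let intu : mu.-integrable setT (EFin \o u).
Proof. exact: integrable_signal_gap. Qed.
Let mu_ : measurable_fun setT u.
Proof. exact: measurable_signal_gap. Qed.
Let uM x : `|u x| <= a * (1 + \int[mu]_y `|vkernel N y|).
Proof. exact: normr_signal_gap_le. Qed.

Let conv_gap x : convolution K (shifted_signal a h N delta) x
  - convolution K (null_signal a h) x = convolution K u x.
Proof.
rewrite /convolution -RintegralB//; last 2 first.
- apply: (integrable_convolution_slice intK (measurable_shifted_signal _ _ _ _)) => //.
  exact: normr_shifted_signal_le.
- apply: (integrable_convolution_slice intK (measurable_null_signal _ _)) => //.
  exact: normr_null_signal_le.
by apply: eq_Rintegral => y _; rewrite -mulrBr signal_gapE.
Qed.

Let cont0 : continuous (convolution K (null_signal a h)).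
Proof.
apply: (continuous_convolution intK (measurable_null_signal _ h0)
  (normr_null_signal_le a0 h0) (D := [set 0])) => //.
by move=> x /eqP; exact: null_signal_continuous.
Qed.

Let cont1 : continuous (convolution K (shifted_signal a h N delta)).
Proof.
apply: (continuous_convolution intK (measurable_shifted_signal _ h0 N0 delta0)
  (normr_shifted_signal_le a0 h0 N0 delta0) (D := [set delta])) => //.
by move=> x /eqP; exact: shifted_signal_continuous.
Qed.

(** Plancherel's inequality and the convolution theorem. The blurred gap is
    continuous because each signal has a single discontinuity. *)
Lemma blurred_gap_energy :
  (\int[mu]_x (convolution K u x ^+ 2)%:E <= \int[mu]_w (gap_energy w)%:E)%E.
Proof.
have intD := integrable_convolution intK mu_ uM intu.
have cD : continuous (convolution K u).
  have -> : convolution K u = convolution K (shifted_signal a h N delta) \- convolution K (null_signal a h).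
    by apply/funext => x /=; rewrite conv_gap.
  by move=> x; apply: cvgB; [exact: cont1|exact: cont0].
apply: (le_trans (energy_le_spectrum intD (normr_convolution_le intK mu_ uM) cD)).
apply: ge0_le_integral => //.
- by move=> w _; rewrite lee_fin addr_ge0 ?sqr_ge0.
- by apply: measurableT_comp => //; exact: measurable_spectrum.
- by apply: measurableT_comp => //; exact: measurable_gap_energy.
move=> w _; rewrite lee_fin.
rewrite (cosT_convolution intK mu_ uM intu) (sinT_convolution intK mu_ uM intu).
rewrite (_ : _ + _ = (cosT K w ^+ 2 + sinT K w ^+ 2) * (cosT u w ^+ 2 + sinT u w ^+ 2)); last by ring.
rewrite signal_gap_spectrum// /gap_energy.
set q := a ^+ 2 * _ * _; have q0 : 0 <= q.
  by rewrite mulr_ge0//; [rewrite mulr_ge0 ?sqr_ge0|rewrite addr_ge0 ?sqr_ge0].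
by rewrite (le_trans (ler_wpM2r q0 (spectrum_decay w)))// /q le_eqVlt; apply/orP; left; apply/eqP; ring.
Qed.

(** All that depends on the observation is settled here; it remains to choose
    [h], [N] and [delta] so that three numerical inequalities hold. *)
Lemma smooth_jump_lower_bound d (Omega : measurableType d) (P : probability Omega R)
    (W : R -> {RV P >-> R}) (eps : R) : two_sided_wiener W -> eps != 0 ->
  8 * a ^+ 2 * h * expR (4 * nu * h) <= L ^+ 2 / 2 ->
  a ^+ 2 * (256 * pi ^+ 2) * delta ^+ 2 * N ^+ 3 * expR (4 * nu * N) <= L ^+ 2 / 2 ->
  (\int[mu]_w (gap_energy w)%:E <= (eps ^+ 2)%:E)%E ->
  ((delta / two_point_loss R)%:E <= minimax_risk K eps W (change_point_class nu a L))%E.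
Proof.
move=> wW e0 hL NL en.
have := @two_point_risk _ _ _ _ _ wW eps e0 K (null_signal a h) (shifted_signal a h N delta)
  0 delta (change_point_class nu a L).
rewrite subr0; apply => //.
- apply: null_signal_in_class => //; apply: le_trans (le_trans hL _).
    rewrite ler_wpM2r ?expR_ge0// ler_wpM2r ?(ltW h0)// ler_wpM2r ?sqr_ge0//.
    by rewrite ler_nat.
  by have := sqr_ge0 L; lra.
- exact: shifted_signal_in_class.
- exact: null_signal_cp.
- exact: shifted_signal_cp.
- apply: eq_integrable (integrable_convolution intK mu_ uM intu) => // x _ /=.
  by rewrite conv_gap.
- apply: le_trans en; apply: le_trans blurred_gap_energy.
  rewrite le_eqVlt; apply/orP; left; apply/eqP; apply: eq_integral => x _.
  by rewrite conv_gap.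
Qed.

End blurred_gap.

(** * Integrals split at a frequency *)

Section tail_integrals.
Context {R : realType}.
Local Notation mu := (@lebesgue_measure R).
Implicit Types (f g : R -> R) (T s w x : R).

Lemma integral_powR_head s T : s < 1 -> 0 < T ->
  (\int[mu]_(x in `[0%R, T]) ((1 + x) `^ (- s))%:E <= ((1 + T) `^ (1 - s) / (1 - s))%:E)%E.
Proof.
move=> s1 T0; have s1' : 1 - s != 0 by rewrite subr_eq0 eq_sym lt_eqF.
have x0 x : 0 <= x <= T -> 0 < 1 + x by case/andP => x0 _; rewrite ltr_pwDl.
have sh x : is_derive x 1 (fun y : R => 1 + y) 1 
  by rewrite -[X in is_derive _ _ _ X]add0r; apply: is_deriveD.
have d r x : 0 <= x <= T -> is_derive x 1 (fun y => (1 + y) `^ r) (r * (1 + x) `^ (r - 1)).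
  move=> /x0 xp; have := is_derive1_comp (is_derive1_powR r xp) (sh x).
  by rewrite mulr1.
pose F y := (1 - s)^-1 * (1 + y) `^ (1 - s).
have -> : (\int[mu]_(x in `[0%R, T]) ((1 + x) `^ (- s))%:E = (F T - F 0)%:E)%E.
  apply: (@FTC2_is_derive _ _ F 0 T T0).
  - by move=> x /(d (- s)); exact: is_derive_continuous.
  - move=> x /(d (1 - s)) h; apply: (trigger_derive (is_deriveZ ((1 - s)^-1) h)).
    rewrite /GRing.scale/= mulrA mulVf// mul1r; congr (_ `^ _); ring.
by rewrite /F lee_fin mulrC lerBlDr lerDl mulr_ge0 ?powR_ge0// invr_ge0 subr_ge0 ltW.
Qed.

Lemma integral_inv_head T : 0 < T ->
  (\int[mu]_(x in `[0%R, T]) ((1 + x) `^ (- 1))%:E = (ln (1 + T))%:E)%E.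
Proof.
move=> T0.
have x0 x : 0 <= x <= T -> 0 < 1 + x by case/andP => x0 _; rewrite ltr_pwDl.
have sh x : is_derive x 1 (fun y : R => 1 + y) 1 
  by rewrite -[X in is_derive _ _ _ X]add0r; apply: is_deriveD.
have -> : ln (1 + T) = ln (1 + T) - ln (1 + 0) by rewrite addr0 ln1 subr0.
apply: (@FTC2_is_derive _ _ (fun y => ln (1 + y)) 0 T T0).
- move=> x /x0 xp; have := is_derive1_comp (is_derive1_powR (- 1) xp) (sh x).
  exact: is_derive_continuous.
- move=> x /x0 xp; have := is_derive1_comp (is_derive1_ln xp) (sh x).
  by rewrite mulr1 powR_inv1// ltW.
Qed.

(** The majorants depend on [|w|] only, so the line is folded at the origin. *)
Lemma integral_le_head_tail f g1 g2 T : 0 <= T ->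
  measurable_fun setT f -> measurable_fun setT g1 -> measurable_fun setT g2 ->
  (forall w, 0 <= f w) -> (forall w, 0 <= g1 w) -> (forall w, 0 <= g2 w) ->
  (forall w, `|w| <= T -> f w <= g1 `|w|) -> (forall w, T <= `|w| -> f w <= g2 `|w|) ->
  (\int[mu]_w (f w)%:E <=
   2%:E * (\int[mu]_(w in `[0%R, T]) (g1 w)%:E + \int[mu]_(w in `[T, +oo[) (g2 w)%:E))%E.
Proof.
move=> T0 mf m1 m2 f0 g10 g20 fg1 fg2.
pose A := `[0, T]%classic : set R; pose B := `[T, +oo[%classic : set R.
pose G (w : R) : R := \1_A w * g1 w + \1_B w * g2 w.
have mA : measurable_fun setT (\1_A : R -> R) by apply: measurable_indic; exact: measurable_itv.
have mB : measurable_fun setT (\1_B : R -> R) by apply: measurable_indic; exact: measurable_itv.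
have mAg : measurable_fun setT (fun w => \1_A w * g1 w) by exact: measurable_funM.
have mBg : measurable_fun setT (fun w => \1_B w * g2 w) by exact: measurable_funM.
have mG : measurable_fun setT G by exact: measurable_funD.
have G0 w : 0 <= G w by rewrite addr_ge0// mulr_ge0// indicE.
have mGN : measurable_fun setT (fun w => G (- w)).
  by apply: (measurableT_comp mG); exact: measurable_funN.
have fG w : f w <= G w + G (- w).
  have fGabs : f w <= G `|w|.
    rewrite /G !indicE; have [wT|Tw] := leP `|w| T.
      have -> : (`|w| \in A) = true by rewrite mem_set// /A/= in_itv/= normr_ge0 wT.
      by rewrite mul1r (le_trans (fg1 w wT))// lerDl mulr_ge0.
    have -> : (`|w| \in B) = true by rewrite mem_set// /B/= in_itv/= (ltW Tw).
    by rewrite mul1r (le_trans (fg2 w (ltW Tw)))// lerDr mulr_ge0.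
  apply: (le_trans fGabs); have [w0|w0] := leP 0 w.
    by rewrite ger0_norm// lerDl.
  by rewrite ltr0_norm// lerDr.
have intG : (\int[mu]_w (G w)%:E = \int[mu]_(w in A) (g1 w)%:E + \int[mu]_(w in B) (g2 w)%:E)%E.
  have e (D : set R) g : (\int[mu]_w (\1_D w * g w)%:E = \int[mu]_(w in D) (g w)%:E)%E.
    rewrite [RHS]integral_mkcond; apply: eq_integral => w _.
    by rewrite patchE indicE; case: (w \in D); rewrite ?mul1r ?mul0r.
  rewrite /G; under eq_integral do rewrite EFinD.
  rewrite ge0_integralD//; last 4 first.
  - by move=> w _; rewrite lee_fin mulr_ge0// indicE.
  - exact: measurableT_comp.
  - by move=> w _; rewrite lee_fin mulr_ge0// indicE.
  - exact: measurableT_comp.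
  by rewrite !e.
apply: (@le_trans _ _ (\int[mu]_w ((G w)%:E + (G (- w))%:E))%E).
  apply: ge0_le_integral => //.
  - by move=> w _; rewrite lee_fin.
  - exact: measurableT_comp.
  - by apply: emeasurable_funD; exact: measurableT_comp.
  - by move=> w _; rewrite -EFinD lee_fin.
rewrite ge0_integralD//; last 4 first.
- by move=> w _; rewrite lee_fin.
- exact: measurableT_comp.
- by move=> w _; rewrite lee_fin.
- exact: measurableT_comp.
have -> : (\int[mu]_w (G (- w))%:E = \int[mu]_w (G w)%:E)%E.
  rewrite [RHS](@ge0_integral_affine _ (-1) 0 (fun w => (G w)%:E)).
  - rewrite normrN1 mul1e; apply: eq_integral => w _.
    by rewrite mulN1r addr0.
  - by rewrite oppr_eq0 oner_neq0.
  - exact: measurableT_comp.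
  - by move=> w; rewrite lee_fin.
by rewrite intG mule_natl mule2n.
Qed.

End tail_integrals.

(** * Two bounds on the spectral energy *)

Section energy_bounds.
Context {R : realType}.
Local Notation mu := (@lebesgue_measure R).
Variables (a N delta beta kappa : R).
Hypothesis N0 : 0 < N.
Hypothesis delta0 : 0 <= delta.
Hypothesis beta0 : 0 < beta.
Implicit Types (w x y s T : R).

Local Notation E := (gap_energy a N delta beta kappa).

Lemma powRN_anti x y s : 0 <= s -> 0 < x -> x <= y -> y `^ (- s) <= x `^ (- s).
Proof.
move=> s0 x0 xy; have y0 := lt_le_trans x0 xy.
rewrite !powRN lef_pV2 ?posrE ?powR_gt0// ge0_ler_powR// nnegrE ltW//.
Qed.

Lemma powR_sqr x s : 0 <= x -> (x ^+ 2) `^ s = x `^ (2 * s).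
Proof. by move=> x0; rewrite powRrM powR_mulrn. Qed.

Let c := a ^+ 2 * kappa ^+ 2.

Let c0 : 0 <= c.
Proof. by rewrite mulr_ge0 ?sqr_ge0. Qed.

Let gap_energy_le w : E w <= c * (1 + w ^+ 2) `^ (- beta) *
  (cosT (step delta) w ^+ 2 + sinT (step delta) w ^+ 2).
Proof.
rewrite /gap_energy -/c ler_wpM2r ?addr_ge0 ?sqr_ge0// ler_piMr//.
  by rewrite mulr_ge0 ?powR_ge0.
by rewrite expr_le1 ?subr_ge0 ?trapezoid_le1// gerBl trapezoid_ge0.
Qed.

(** The transform of the interval is bounded by its length; the decay of the
    kernel alone makes the integral over the frequencies beyond [N] converge. *)
Lemma gap_energy_smooth : 1 / 2 < beta ->
  (\int[mu]_w (E w)%:E <=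
   (4 * c * delta ^+ 2 * (N `^ (1 - 2 * beta) / (2 * beta - 1)))%:E)%E.
Proof.
move=> b12; pose s := 2 * beta - 1; have s0 : 0 < s by rewrite /s; lra.
have := @integral_le_head_tail _ E (fun _ => 0)
  (fun x => 2 * c * delta ^+ 2 * x `^ (- s - 1)) N (ltW N0).
rewrite integral0 add0e.
have -> : (\int[mu]_(x in `[N, +oo[) (2 * c * delta ^+ 2 * x `^ (- s - 1))%:E =
    (2 * c * delta ^+ 2 * (N `^ (- s) / s))%:E)%E.
  under eq_integral do rewrite EFinM.
  rewrite ge0_integralZl//; last 3 first.
  - apply: measurable_funTS; apply: measurableT_comp => //; exact: measurable_powR.
  - by move=> x _; rewrite lee_fin powR_ge0.
  - by rewrite lee_fin mulr_ge0 ?sqr_ge0// mulr_ge0.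
  by rewrite integral_powR_tail.
rewrite -EFinM => main.
have -> : 4 * c * delta ^+ 2 * (N `^ (1 - 2 * beta) / (2 * beta - 1)) =
    2 * (2 * c * delta ^+ 2 * (N `^ (- s) / s)).
  by rewrite -/s (_ : 1 - 2 * beta = - s) /s; ring.
apply: main => //.
- exact: measurable_gap_energy.
- by apply: measurable_funM => //; exact: measurable_powR.
- by move=> w; exact: gap_energy_ge0.
- by move=> w; rewrite mulr_ge0 ?powR_ge0// mulr_ge0 ?sqr_ge0// mulr_ge0.
- by move=> w wN; rewrite /gap_energy trapezoid_eq1// subrr expr0n/= mulr0 mul0r.
- move=> w Nw; apply: (le_trans (gap_energy_le w)).
  have w0 : 0 < `|w| by exact: lt_le_trans Nw.
  have decay : (1 + w ^+ 2) `^ (- beta) <= `|w| `^ (- s - 1).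
    have -> : - s - 1 = 2 * (- beta) by rewrite /s; ring.
    rewrite -powR_sqr// real_normK ?num_real//.
    apply: powRN_anti; rewrite ?(ltW beta0)// ?lerDr//.
    by rewrite -real_normK ?num_real// exprn_gt0.
  rewrite mulrAC [leRHS](_ : _ = c * (2 * delta ^+ 2) * `|w| `^ (- s - 1)); last by ring.
  apply: ler_pM => //; last by rewrite ler_wpM2l// step_transform_le.
    by rewrite mulr_ge0// addr_ge0 ?sqr_ge0.
  exact: powR_ge0.
Qed.

(** The length of the interval bounds its transform below [T]; beyond [T] the
    decay [1 / w] of that transform makes the integral converge. *)
Lemma gap_energy_rough T I : beta <= 1 / 2 -> 0 < T ->
  (\int[mu]_(x in `[0%R, T]) ((1 + x) `^ (- (2 * beta)))%:E <= I%:E)%E ->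
  (\int[mu]_w (E w)%:E <=
   (2 * (4 * c * delta ^+ 2 * I + c * T `^ (- (2 * beta)) * T^-1))%:E)%E.
Proof.
move=> b12 T0 headI.
have k1 : 0 <= 4 * c * delta ^+ 2 by rewrite mulr_ge0 ?sqr_ge0// mulr_ge0.
have k2 : 0 <= c * T `^ (- (2 * beta)) by rewrite mulr_ge0 ?powR_ge0.
have mp s : measurable_fun setT (fun x : R => x `^ s) by exact: measurable_powR.
have mp1 s : measurable_fun setT (fun x : R => (1 + x) `^ s).
  by apply: (measurableT_comp (mp s)); exact: measurable_funD.
have main := @integral_le_head_tail _ E (fun x => 4 * c * delta ^+ 2 * (1 + x) `^ (- (2 * beta)))
  (fun x => c * T `^ (- (2 * beta)) * x `^ (- 1 - 1)) T (ltW T0).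
apply: (le_trans (main _ _ _ _ _ _ _ _)) => {main}.
- exact: measurable_gap_energy.
- exact: measurable_funM.
- exact: measurable_funM.
- by move=> w; exact: gap_energy_ge0.
- by move=> w; rewrite mulr_ge0 ?powR_ge0.
- by move=> w; rewrite mulr_ge0 ?powR_ge0.
- move=> w _; apply: (le_trans (gap_energy_le w)).
  have decay : (1 + w ^+ 2) `^ (- beta) <= 2 * (1 + `|w|) `^ (- (2 * beta)).
    have w0 := normr_ge0 w; have w1 : 0 <= 1 + `|w| by rewrite addr_ge0.
    apply: (@le_trans _ _ ((2^-1 * (1 + `|w|) ^+ 2) `^ (- beta))).
      apply: powRN_anti; [exact: ltW| |].
        by rewrite mulr_gt0 ?invr_gt0// exprn_gt0// ltr_pwDl.
      rewrite -(real_normK (num_real w)).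
      by have := sqr_ge0 (1 - `|w|); move: `|w| => v; nra.
    rewrite powRM ?invr_ge0 ?exprn_ge0// powR_sqr// mulrN ler_wpM2r ?powR_ge0//.
    have e2 : (2^-1 : R) `^ (- 1) = 2 by rewrite powRN powRr1 ?invrK ?invr_ge0.
    by rewrite -[leRHS]e2; apply: ger_powR; [rewrite invr_gt0 invf_le1//= ltr0n ler1n|lra].
  rewrite mulrAC [leRHS](_ : _ = c * (2 * delta ^+ 2) * (2 * (1 + `|w|) `^ (- (2 * beta)))); last by ring.
  apply: ler_pM => //; last by rewrite ler_wpM2l// step_transform_le.
    by rewrite mulr_ge0// addr_ge0 ?sqr_ge0.
  exact: powR_ge0.
- move=> w Tw; apply: (le_trans (gap_energy_le w)).
  have w0 : 0 < `|w| by exact: lt_le_trans Tw.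
  have decay : (1 + w ^+ 2) `^ (- beta) <= T `^ (- (2 * beta)).
    rewrite -mulrN -powR_sqr ?(ltW T0)//.
    apply: powRN_anti; rewrite ?(ltW beta0)// ?exprn_gt0//.
    rewrite -(real_normK (num_real w)) (@le_trans _ _ (`|w| ^+ 2)) ?lerDr//.
    by rewrite ler_sqr ?nnegrE// ltW.
  rewrite -[leRHS]mulrA -[leLHS]mulrA ler_wpM2l//.
  apply: ler_pM => //; [exact: powR_ge0|by rewrite addr_ge0 ?sqr_ge0|].
  have -> : - 1 - 1 = - 2%:R :> R by ring.
  rewrite powRN powR_mulrn// real_normK ?num_real//.
  have w20 : 0 < w ^+ 2 by rewrite -real_normK ?num_real// exprn_gt0.
  rewrite -[leRHS]mul1r ler_pdivlMr//.
  apply: le_trans (step_transform_decay w delta0).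
  rewrite ler_wpM2l ?addr_ge0 ?sqr_ge0// exprMn -[leLHS]mul1r ler_wpM2r ?sqr_ge0//.
  by rewrite exprn_ege1// (le_trans _ (pi_ge2 R))// ler1n.
have -> : (2 * (4 * c * delta ^+ 2 * I + c * T `^ (- (2 * beta)) * T^-1))%:E =
  (2%:E * ((4 * c * delta ^+ 2)%:E * I%:E + (c * T `^ (- (2 * beta)) * T^-1)%:E))%E by [].
rewrite lee_wpmul2l ?lee_fin//; apply: leeD.
- under eq_integral do rewrite EFinM.
  rewrite ge0_integralZl//; last 2 first.
  - by apply: measurable_funTS; apply: measurableT_comp => //; exact: mp1.
  - by move=> x _; rewrite lee_fin powR_ge0.
  by rewrite lee_wpmul2l// lee_fin.
- under eq_integral do rewrite EFinM.
  rewrite ge0_integralZl//; last 2 first.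
  - by apply: measurable_funTS; apply: measurableT_comp => //; exact: mp.
  - by move=> x _; rewrite lee_fin powR_ge0.
  rewrite integral_powR_tail// -EFinM lee_fin divr1 (powRN T 1) powRr1//.
  exact: ltW.
Qed.

End energy_bounds.

(** * The rates *)

Section rates.
Context {R : realType}.
Local Notation mu := (@lebesgue_measure R).

Lemma powR_exp (x y : R) : expR x `^ y = expR (x * y).
Proof. by rewrite /powR gt_eqF ?expR_gt0// expRK mulrC. Qed.

Lemma powR_expr2 (x s : R) : (x `^ s) ^+ 2 = x `^ (2 * s).
Proof. by rewrite -(powR_mulrn 2 (powR_ge0 _ _)) -powRrM mulrC. Qed.

(** A power of the logarithm is absorbed by half of the exponential it is the
    logarithm of. *)
Lemma eps_log_small (p nu L eta : R) : 0 < p -> 0 < nu -> 0 < L -> 0 < eta ->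
  exists2 eps0 : R, 0 < eps0 & forall eps, 0 < eps -> eps < eps0 ->
    0 < 1 / nu * ln (L / eps) /\ eps * (1 / nu * ln (L / eps)) `^ p <= eta.
Proof.
move=> p0 nu0 L0 eta0; pose B := (2 * p / nu) `^ p.
have B0 : 0 < B by rewrite powR_gt0// divr_gt0// mulr_gt0.
have BL : 0 < B ^+ 2 * L by rewrite mulr_gt0// exprn_gt0.
(* From [eps B exp (x / 2) = B sqrt (eps L)]. *)
exists (Num.min L (eta ^+ 2 / (B ^+ 2 * L))).
  by rewrite lt_min L0 divr_gt0// exprn_gt0.
move=> eps e0; rewrite lt_min => /andP[eL eB].
have x0 : 0 < ln (L / eps) by rewrite ln_gt0// ltr_pdivlMr// mul1r.
set x := ln _ in x0 *; split; first by rewrite mulr_gt0// divr_gt0.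
have ex : expR (x / 2) ^+ 2 = L / eps.
  by rewrite -expRM_natl mulrCA divff// mulr1 lnK// posrE divr_gt0.
have xB : (1 / nu * x) `^ p <= B * expR (x / 2).
  have -> : expR (x / 2) = (expR (x / (2 * p))) `^ p.
    by rewrite powR_exp; congr expR; field; rewrite gt_eqF.
  rewrite /B -powRM ?expR_ge0//; last by rewrite divr_ge0// ?mulr_ge0// ltW.
  rewrite ge0_ler_powR ?nnegrE//; first exact: ltW.
  - by rewrite mulr_ge0 ?divr_ge0// ltW.
  - by rewrite mulr_ge0 ?expR_ge0// divr_ge0 ?mulr_ge0// ltW.
  have -> : 1 / nu * x = 2 * p / nu * (x / (2 * p)) by field; rewrite !gt_eqF.
  rewrite ler_pM2l ?divr_gt0 ?mulr_gt0//.
  by have := expR_ge1Dx (x / (2 * p)); lra.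
apply: (le_trans (ler_wpM2l (ltW e0) xB)).
have k0 : 0 <= eps * (B * expR (x / 2)).
  by rewrite mulr_ge0 ?mulr_ge0 ?expR_ge0// ltW.
rewrite -ler_sqr ?nnegrE ?(ltW eta0)//.
have -> : (eps * (B * expR (x / 2))) ^+ 2 = eps * (B ^+ 2 * L).
  by rewrite !exprMn ex; field; rewrite gt_eqF.
by rewrite -ler_pdivlMr// ltW.
Qed.

(** A fixed, small bandwidth puts both signals in the class, however close
    their change-points. *)
Lemma class_bandwidth (a nu L : R) : 0 < a -> 0 < nu -> 0 < L ->
  exists2 h : R, 0 < h &
    8 * a ^+ 2 * h * expR (4 * nu * h) <= L ^+ 2 / 2 /\
    forall delta, 0 < delta <= 1 ->
      a ^+ 2 * (256 * pi ^+ 2) * delta ^+ 2 * h ^+ 3 * expR (4 * nu * h) <= L ^+ 2 / 2.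
Proof.
(* The three bounds on [h] control [32 (pi h)^2], [exp (4 nu h)] and the product. *)
move=> a0 nu0 L0; pose h : R := Num.min (1 / 100)
  (Num.min (1 / (4 * nu)) (L ^+ 2 / (16 * expR 1 * a ^+ 2))).
have a20 : 0 < a ^+ 2 by rewrite exprn_gt0.
have h0 : 0 < h.
  by rewrite !lt_min !divr_gt0 ?exprn_gt0 ?mulr_gt0 ?expR_gt0.
have h1 : h <= 1 / 100 by rewrite ge_min lexx.
have h2 : h <= 1 / (4 * nu) by rewrite !ge_min lexx orbT.
have h3 : h <= L ^+ 2 / (16 * expR 1 * a ^+ 2) by rewrite !ge_min lexx !orbT.
exists h => //.
have hL : 8 * a ^+ 2 * h * expR (4 * nu * h) <= L ^+ 2 / 2.
  have e1 : expR (4 * nu * h) <= expR 1.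
    rewrite ler_expR; move: h2; rewrite ler_pdivlMr ?mulr_gt0//; lra.
  move: h3; rewrite ler_pdivlMr ?mulr_gt0 ?expR_gt0// => h3.
  apply: (@le_trans _ _ (8 * a ^+ 2 * h * expR 1)); last by lra.
  by rewrite ler_wpM2l// mulr_ge0 ?mulr_ge0// ltW.
split=> // delta /andP[d0 d1]; apply: le_trans hL.
have -> : a ^+ 2 * (256 * pi ^+ 2) * delta ^+ 2 * h ^+ 3 * expR (4 * nu * h) =
    8 * a ^+ 2 * h * expR (4 * nu * h) * (32 * (pi * delta * h) ^+ 2) by ring.
rewrite ler_piMr//.
  by rewrite mulr_ge0 ?expR_ge0// mulr_ge0 ?mulr_ge0// ltW.
have [_] := andP (pihalf_02_cos_pihalf R).1; rewrite ler_pdivrMr// => p4.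
have p0 := pi_ge0 R.
have : pi * delta * h <= 4 * 1 * (1 / 100).
  apply: ler_pM => //; rewrite ?mulr_ge0 ?(ltW h0) ?(ltW d0)//.
  by apply: ler_pM => //; rewrite ?(ltW d0)//; move: p4; lra.
have : 0 <= pi * delta * h by rewrite !mulr_ge0// ltW.
by move: (pi * delta * h) => z; nra.
Qed.

Variables (K : R -> R) (beta kappa : R).
Hypothesis intK : mu.-integrable setT (EFin \o K).
Hypothesis beta0 : 0 < beta.
Hypothesis kappa0 : 0 < kappa.
Hypothesis K_decay : forall w : R,
  Normc.normc (fourier K w) <= kappa * (1 + `|w| ^+ 2) `^ (- (beta / 2)).

Let D : R := two_point_loss R.

Let D0 : 0 < D.
Proof. by rewrite mulr_gt0// sqrtr_gt0 expR_gt0. Qed.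

(** With [X = ln (L / eps) / nu] the cut-off [N = X / 4] makes the weight
    [exp (4 nu N)] equal to [L / eps]. As [delta^2] is of order [eps^2] up to powers
    of [X], the constraint of the class holds for small [eps]. *)
Lemma regular_lower_bound : 1 / 2 < beta ->
  exists2 c4 : R, 0 < c4 &
  forall nu a L : R, 0 < nu -> 0 < a -> 0 < L ->
  exists2 eps0 : R, 0 < eps0 &
  forall eps : R, 0 < eps < 1 -> eps < eps0 ->
  forall (d : measure_display) (Omega : measurableType d)
    (P : probability Omega R) (W : R -> {RV P >-> R}),
  two_sided_wiener W ->
  ((c4 * a^-1 * eps * (1 / nu * ln (L / eps)) `^ (beta - 1 / 2))%:E
    <= minimax_risk K eps W (change_point_class nu a L))%E.
Proof.
move=> b12; pose s : R := 2 * beta - 1; have s0 : 0 < s by rewrite /s; lra.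
have q0 : 0 < 4 * kappa ^+ 2 * 4 `^ s by rewrite mulr_gt0 ?powR_gt0// mulr_gt0// exprn_gt0.
(* Makes the bound of [gap_energy_smooth] equal to [eps^2]. *)
pose c : R := Num.sqrt (s / (4 * kappa ^+ 2 * 4 `^ s)).
have c0 : 0 < c by rewrite sqrtr_gt0 divr_gt0.
have c2 : c ^+ 2 = s / (4 * kappa ^+ 2 * 4 `^ s) by rewrite sqr_sqrtr// ltW// divr_gt0.
exists (c / D) => [|nu a L nu0 a0 L0]; first exact: divr_gt0.
have [h h0 [hL _]] := class_bandwidth a0 nu0 L0.
have p1 : 0 < beta - 1 / 2 by lra.
have p2 : 0 < s + 3%:R by rewrite addr_gt0.
have pi0 := pi_gt0 R.
have eta1 : 0 < a / c by rewrite divr_gt0.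
have eta2 : 0 < L / (8 * pi ^+ 2 * c ^+ 2) by rewrite divr_gt0// !mulr_gt0 ?exprn_gt0.
have [e1 e10 E1] := eps_log_small p1 nu0 L0 eta1.
have [e2 e20 E2] := eps_log_small p2 nu0 L0 eta2.
exists (Num.min e1 e2) => [|eps /andP[eps0 _]]; first by rewrite lt_min e10.
rewrite lt_min => /andP[/(E1 _ eps0)[X0 X1] /(E2 _ eps0)[_ X2]] d Omega P W wW.
have eX : expR (nu * (1 / nu * ln (L / eps))) = L / eps.
  rewrite mulrA mul1r divff ?gt_eqF// mul1r lnK// posrE.
  by apply: divr_gt0.
move: X0 X1 X2 eX; set X := 1 / nu * _ => X0 X1 X2 eX.
pose delta : R := c * a^-1 * eps * X `^ (beta - 1 / 2).
have delta0 : 0 < delta by rewrite mulr_gt0 ?powR_gt0// !mulr_gt0// invr_gt0.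
have delta1 : delta <= 1.
  have -> : delta = (eps * X `^ (beta - 1 / 2)) * (c / a) by rewrite /delta; ring.
  have ca : 1 / (c / a) = a / c by rewrite div1r invf_div.
  by rewrite -ler_pdivlMr ?divr_gt0// ca.
have N0 : 0 < X / 4 by rewrite divr_gt0.
have -> : c / D * a^-1 * eps * X `^ (beta - 1 / 2) = delta / D by rewrite /delta; ring.
have d2 : delta ^+ 2 = c ^+ 2 * a ^- 2 * eps ^+ 2 * X `^ s.
  rewrite /delta !exprMn powR_expr2 exprVn; congr (_ * _ `^ _).
  by rewrite /s; lra.
have e_neq0 : eps != 0 by rewrite gt_eqF.
have := smooth_jump_lower_bound (L := L) a0 nu0 h0 N0 delta0 delta1 intK kappa0 K_decay wW e_neq0.
rewrite -/D; apply => //.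
- rewrite d2 (_ : 4 * nu * (X / 4) = nu * X); last by field.
  rewrite eX.
  have -> : a ^+ 2 * (256 * pi ^+ 2) * (c ^+ 2 * a ^- 2 * eps ^+ 2 * X `^ s) * (X / 4) ^+ 3 * (L / eps) =
     (eps * X `^ (s + 3%:R)) * (8 * pi ^+ 2 * c ^+ 2) * (L / 2).
    rewrite powRD; last by rewrite gt_eqF ?implybT// gt_eqF.
    rewrite powR_mulrn ?(ltW X0)//.
    by move: (X `^ s) (pi : R) => Y q; field; rewrite !gt_eqF.
  have -> : L ^+ 2 / 2 = L * (L / 2) by ring.
  rewrite ler_wpM2r ?divr_ge0 ?(ltW L0)// -ler_pdivlMr//.
  by rewrite !mulr_gt0 ?exprn_gt0.
- apply: (le_trans (gap_energy_smooth a kappa N0 (ltW delta0) beta0 b12)).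
  rewrite lee_fin d2 -/s (_ : 1 - 2 * beta = - s); last by rewrite /s; ring.
  have -> : (X / 4) `^ (- s) = (X `^ s)^-1 * 4 `^ s.
    by rewrite powRM ?invr_ge0 ?(ltW X0)// powRN -[4^-1]powR_inv1// -powRrM mulN1r opprK.
  have Xs : X `^ s != 0 by rewrite gt_eqF// powR_gt0.
  have Fs : 4 `^ s != 0 :> R by rewrite gt_eqF// powR_gt0.
  rewrite c2 le_eqVlt; apply/orP; left; apply/eqP.
  move: (X `^ s) (4 `^ s) Xs Fs => Y F Y0 F0.
  by field; rewrite Y0 F0 !gt_eqF.
Qed.

(** At [beta = 1/2] the head of the spectral integral is logarithmic in [T],
    and [T = 1 / eps^2] leaves a tail of order [eps^4]. *)
Lemma critical_lower_bound : beta = 1 / 2 ->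
  forall a L : R, 0 < a -> 0 < L ->
  exists2 c5 : R, 0 < c5 &
  forall nu : R, 0 < nu ->
  exists2 eps0 : R, 0 < eps0 &
  forall eps : R, 0 < eps < 1 -> eps < eps0 ->
  forall (d : measure_display) (Omega : measurableType d)
    (P : probability Omega R) (W : R -> {RV P >-> R}),
  two_sided_wiener W ->
  ((c5 * eps * ln (1 / eps) `^ (- (1 / 2)))%:E
    <= minimax_risk K eps W (change_point_class nu a L))%E.
Proof.
move=> b12 a L a0 L0; pose A : R := a * kappa; have A0 : 0 < A by rewrite mulr_gt0.
(* The head gives [24/49 eps^2], the tail at most [eps^2 / 2]. *)
pose c : R := (7 * A)^-1; have c0 : 0 < c by rewrite invr_gt0 mulr_gt0.
exists (c / D) => [|nu nu0]; first exact: divr_gt0.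
have [h h0 [hL hN]] := class_bandwidth a0 nu0 L0.
exists (Num.min (expR (- 1)) (Num.min (c^-1) (1 / (2 * A)))).
  by rewrite !lt_min expR_gt0 invr_gt0 c0 divr_gt0// mulr_gt0.
move=> eps /andP[eps0 eps1]; rewrite !lt_min => /and3P[ee ec eA] d Omega P W wW.
pose y : R := 1 / eps; rewrite -/y; have y0 : 0 < y by rewrite divr_gt0.
have ye : expR 1 < y.
  by rewrite /y ltr_pdivlMr// -ltr_pdivlMl ?expR_gt0// mulr1 -expRN.
have y2 : 2 <= y by apply: le_trans (ltW ye); have := expR_ge1Dx (1 : R); lra.
have l1 : 1 <= ln y by rewrite -[leLHS](expRK (1 : R)) ler_ln ?posrE ?expR_gt0// ltW.
have l0 : 0 < ln y by exact: lt_le_trans l1.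
pose delta : R := c * eps * ln y `^ (- (1 / 2)).
have delta0 : 0 < delta by rewrite mulr_gt0 ?powR_gt0// mulr_gt0.
have d2 : delta ^+ 2 = c ^+ 2 * eps ^+ 2 / ln y.
  rewrite /delta exprMn powR_expr2 exprMn (_ : 2 * - (1 / 2) = - 1); last by field.
  by rewrite powR_inv1// ltW.
have delta1 : delta <= 1.
  have ce : c * eps <= 1 by rewrite -ler_pdivlMl// mulr1 ltW.
  rewrite -(@expr_le1 _ 2)// ?(ltW delta0)// d2 ler_pdivrMr// mul1r (le_trans _ l1)//.
  by rewrite -exprMn expr_le1// mulr_ge0// ltW.
have -> : c / D * eps * ln y `^ (- (1 / 2)) = delta / D by rewrite /delta; ring.
have e_neq0 : eps != 0 by rewrite gt_eqF.
have := smooth_jump_lower_bound (L := L) a0 nu0 h0 h0 delta0 delta1 intK kappa0 K_decay wW e_neq0.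
rewrite -/D; apply => //.
- by apply: hN; rewrite delta0.
have T0 : 0 < y ^+ 2 by rewrite exprn_gt0.
have b12' : beta <= 1 / 2 by rewrite b12.
have headT := integral_inv_head T0.
have b2 : 2 * beta = 1 by rewrite b12; field.
have := @gap_energy_rough _ a h delta beta kappa h0 (ltW delta0) beta0 _ (ln (1 + y ^+ 2)) b12' T0.
rewrite b2 headT => /(_ (lexx _)) /le_trans; apply; rewrite lee_fin.
have lT : ln (1 + y ^+ 2) <= 3 * ln y.
  have -> : 3 * ln y = ln (y ^+ 3) by rewrite lnXn// mulr_natl.
  by rewrite ler_ln ?posrE ?exprn_gt0 ?addr_gt0//; nra.
have yV : (y ^+ 2)^-1 = eps ^+ 2 by rewrite /y expr_div_n expr1n invf_div divr1.
rewrite powR_inv1 ?(ltW T0)// yV.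
have first_term : 4 * (a ^+ 2 * kappa ^+ 2) * delta ^+ 2 * ln (1 + y ^+ 2) <= 12 / 49 * eps ^+ 2.
  have -> : 12 / 49 * eps ^+ 2 = 4 * (a ^+ 2 * kappa ^+ 2) * delta ^+ 2 * (3 * ln y).
    by rewrite d2 /c /A; field; rewrite !gt_eqF.
  by rewrite ler_wpM2l// mulr_ge0 ?sqr_ge0// mulr_ge0// mulr_ge0 ?sqr_ge0.
have second_term : a ^+ 2 * kappa ^+ 2 * eps ^+ 2 * eps ^+ 2 <= 1 / 4 * eps ^+ 2.
  rewrite ler_wpM2r ?sqr_ge0// -!exprMn -/A.
  have A2 : A * eps <= 1 / 2 by move: (ltW eA); rewrite ler_pdivlMr ?mulr_gt0//; lra.
  have -> : 1 / 4 = (1 / 2) ^+ 2 :> R by field.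
  by rewrite ler_sqr ?nnegrE ?divr_ge0// mulr_ge0// ltW.
have := sqr_ge0 eps.
by lra.
Qed.

(** At [T = 1 / delta] head and tail balance, both of order [delta^(2 beta + 1)]. *)
Lemma singular_lower_bound : 0 < beta < 1 / 2 ->
  forall a L : R, 0 < a -> 0 < L ->
  exists2 c6 : R, 0 < c6 &
  forall nu : R, 0 < nu ->
  exists2 eps0 : R, 0 < eps0 &
  forall eps : R, 0 < eps < 1 -> eps < eps0 ->
  forall (d : measure_display) (Omega : measurableType d)
    (P : probability Omega R) (W : R -> {RV P >-> R}),
  two_sided_wiener W ->
  ((c6 * eps `^ (2 / (2 * beta + 1)))%:E
    <= minimax_risk K eps W (change_point_class nu a L))%E.
Proof.
move=> /andP[_ b12] a L a0 L0.
pose s : R := 1 - 2 * beta; have s0 : 0 < s by rewrite /s; lra.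
pose r : R := 2 * beta + 1; have r0 : 0 < r by rewrite /r; move: beta0; lra.
pose C : R := 2 * (a ^+ 2 * kappa ^+ 2) * (8 / s + 1).
have ak0 : 0 < a ^+ 2 * kappa ^+ 2 by rewrite mulr_gt0 ?exprn_gt0.
have C0 : 0 < C by rewrite !mulr_gt0// ltr_wpDl// divr_ge0// ltW.
(* So that [C delta^r = eps^2]. *)
pose c : R := C^-1 `^ r^-1; have c0 : 0 < c by rewrite powR_gt0// invr_gt0.
exists (c / D) => [|nu nu0]; first exact: divr_gt0.
have [h h0 [hL hN]] := class_bandwidth a0 nu0 L0.
exists c^-1 => [|eps /andP[eps0 eps1] ec d Omega P W wW]; first by rewrite invr_gt0.
pose delta : R := c * eps `^ (2 / r).
have delta0 : 0 < delta by rewrite mulr_gt0// powR_gt0.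
have deltar : delta `^ r = C^-1 * eps ^+ 2.
  rewrite powRM ?powR_ge0// -!powRrM mulVf ?gt_eqF// divfK ?gt_eqF//.
  by rewrite powRr1 ?invr_ge0 ?(ltW C0)// powR_mulrn// ltW.
have delta1 : delta <= 1.
  apply: (@le_trans _ _ (c * eps)); last by rewrite -ler_pdivlMl// mulr1 ltW.
  rewrite ler_pM2l// -[leRHS]powRr1 ?(ltW eps0)//.
  apply: ger_powR; first by rewrite eps0 ltW.
  by rewrite ler_pdivlMr// mul1r /r; lra.
have -> : c / D * eps `^ (2 / (2 * beta + 1)) = delta / D by rewrite /delta /r; ring.
have e_neq0 : eps != 0 by rewrite gt_eqF.
have := smooth_jump_lower_bound (L := L) a0 nu0 h0 h0 delta0 delta1 intK kappa0 K_decay wW e_neq0.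
rewrite -/D; apply => //.
- by apply: hN; rewrite delta0.
have T0 : 0 < delta^-1 by rewrite invr_gt0.
have b12' : beta <= 1 / 2 by exact: ltW.
have b21 : 2 * beta < 1 by move: b12; lra.
have headT := integral_powR_head b21 T0.
apply: (le_trans (gap_energy_rough a kappa h0 (ltW delta0) beta0 b12' T0 headT)).
rewrite lee_fin -/s invrK.
have tail : (delta^-1) `^ (- (2 * beta)) * delta = delta `^ r.
  rewrite -[delta^-1]powR_inv1 ?(ltW delta0)// -powRrM mulN1r opprK.
  by rewrite /r powRD ?gt_eqF ?implybT// powRr1// ltW.
have head : delta ^+ 2 * (1 + delta^-1) `^ s <= 2 * delta `^ r.
  have le2 : 1 + delta^-1 <= 2 * delta^-1.
    by have := invf_ge1 delta0; rewrite delta1 => d1; lra.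
  have s1 : s <= 1 by rewrite /s; move: beta0; lra.
  have two_s : (2 : R) `^ s <= 2.
    by rewrite -[leRHS]powRr1//; apply: ler_powR => //; rewrite ler1n.
  have dr : delta `^ r = delta ^+ 2 * (delta^-1) `^ s.
    rewrite -powR_mulrn ?(ltW delta0)// -[delta^-1]powR_inv1 ?(ltW delta0)// -powRrM.
    rewrite -powRD; last by apply/implyP => _; rewrite gt_eqF.
    by congr (_ `^ _); rewrite /r /s; ring.
  rewrite dr mulrCA ler_wpM2l ?sqr_ge0//.
  have dV0 := ltW T0.
  apply: (@le_trans _ _ ((2 * delta^-1) `^ s)).
    by rewrite ge0_ler_powR ?nnegrE ?(ltW s0)// ?addr_ge0// mulr_ge0.
  by rewrite powRM// ler_wpM2r ?powR_ge0.
have -> : eps ^+ 2 = C * delta `^ r by rewrite deltar mulrA divff ?gt_eqF// mul1r.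
have {}head := ler_wpM2l (_ : 0 <= 4 * (a ^+ 2 * kappa ^+ 2) / s) head.
rewrite -mulrA -[_ * _ * delta]mulrA tail.
have k0 : 0 <= 4 * (a ^+ 2 * kappa ^+ 2) / s.
  by rewrite divr_ge0 ?(ltW s0)// mulr_ge0// ltW.
move: (head k0); rewrite /C.
move: (delta `^ r) ((1 + delta^-1) `^ s) => Y Z.
have -> : 4 * (a ^+ 2 * kappa ^+ 2) / s * (delta ^+ 2 * Z) =
   4 * (a ^+ 2 * kappa ^+ 2) * delta ^+ 2 * (Z / s) by ring.
have -> : 2 * (a ^+ 2 * kappa ^+ 2) * (8 / s + 1) * Y =
   2 * (4 * (a ^+ 2 * kappa ^+ 2) / s * (2 * Y) + a ^+ 2 * kappa ^+ 2 * Y) by ring.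
by move=> ?; rewrite ler_pM2l// lerD2r mulrA.
Qed.

End rates.

Theorem theorem4 (R : realType) (K : R -> R) (beta kappa : R)
    (K_L1 : K \in Lfun (@lebesgue_measure R) 1)
    (beta_gt0 : 0 < beta) (kappa_gt0 : 0 < kappa)
    (K_decay : forall w : R,
      Normc.normc (fourier K w) <= kappa * (1 + `|w| ^+ 2) `^ (- (beta / 2))) :
  [/\ 1 / 2 < beta ->
        exists2 c4 : R, 0 < c4 &
        forall nu a L : R, 0 < nu -> 0 < a -> 0 < L ->
        exists2 eps0 : R, 0 < eps0 &
        forall eps : R, 0 < eps < 1 -> eps < eps0 ->
        forall (d : measure_display) (Omega : measurableType d)
          (P : probability Omega R) (W : R -> {RV P >-> R}),
        two_sided_wiener W ->
        ((c4 * a^-1 * eps * (1 / nu * ln (L / eps)) `^ (beta - 1 / 2))%:E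
          <= minimax_risk K eps W (change_point_class nu a L))%E,
      beta = 1 / 2 ->
        forall a L : R, 0 < a -> 0 < L ->
        exists2 c5 : R, 0 < c5 &
        forall nu : R, 0 < nu ->
        exists2 eps0 : R, 0 < eps0 &
        forall eps : R, 0 < eps < 1 -> eps < eps0 ->
        forall (d : measure_display) (Omega : measurableType d)
          (P : probability Omega R) (W : R -> {RV P >-> R}),
        two_sided_wiener W ->
        ((c5 * eps * ln (1 / eps) `^ (- (1 / 2)))%:E
          <= minimax_risk K eps W (change_point_class nu a L))%E &
      0 < beta < 1 / 2 ->
        forall a L : R, 0 < a -> 0 < L ->
        exists2 c6 : R, 0 < c6 &
        forall nu : R, 0 < nu ->
        exists2 eps0 : R, 0 < eps0 &
        forall eps : R, 0 < eps < 1 -> eps < eps0 ->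
        forall (d : measure_display) (Omega : measurableType d)
          (P : probability Omega R) (W : R -> {RV P >-> R}),
        two_sided_wiener W ->
        ((c6 * eps `^ (2 / (2 * beta + 1)))%:E
          <= minimax_risk K eps W (change_point_class nu a L))%E].
Proof.
have intK := (Lfun1_integrable _ _).1 K_L1.
split.
- exact: regular_lower_bound intK beta_gt0 kappa_gt0 K_decay.
- exact: critical_lower_bound intK beta_gt0 kappa_gt0 K_decay.
- exact: singular_lower_bound intK beta_gt0 kappa_gt0 K_decay.
Qed.
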